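(* Let $k,N\in\mathbb N$, $\Omega\subset\mathbb R^k$ open, $\mathbb K\in\{\mathbb R,\mathbb C\}$, $V$ a separable Banach space over $\mathbb K$, and let $f_1,\dots,f_N\colon\Omega\to\Omega$, $g_1,\dots,g_N\colon\Omega\to\mathbb K$, $h_0\colon\Omega\to V$ satisfy hypothesis (H) (with constants $K,L$ as in (H)). Let $\psi$ be as in the context and assume $h_0\in L^{\psi,1}(\Omega,V)$. If there is $\alpha\in[0,\tfrac12)$ with $$|g_n(x)|\le \alpha\min\Big\{\frac{|J_{f_n}(x)|}{KL},\frac1N\Big\}\quad\text{for all } n\in\{1,\dots,N\}\text{ and almost all }x\in\Omega,$$ then the elementary solution of $\varphi(x)=\sum_{n=1}^N g_n(x)\varphi(f_n(x))+h_0(x)$ in $L^{\psi,1}(\Omega,V)$ exists, it is the unique solution of this equation in $L^{\psi,1}(\Omega,V)$, and for every $j\in\mathbb N\cup\{0\}$ $$\Big\|\sum_{i=j}^\infty P^i h_0\Big\|_{L^{\psi,1}(\Omega,V)}\le \frac{(2\alpha)^j}{1-2\alpha}\|h_0\|_{L^{\psi,1}(\Omega,V)}.$$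
   Context: $\mu$ denotes $k$-dimensional Lebesgue measure. A Young function is a non-decreasing, left-continuous, convex $\Psi\colon[0,\infty)\to[0,\infty]$ with $\lim_{t\to0+}\Psi(t)=\Psi(0)=0$, $\lim_{t\to\infty}\Psi(t)=\infty$. $\psi\colon[0,\infty)\to[0,\infty)$ is a strictly increasing Young function satisfying $\Delta_2$ globally (there is $d>1$ with $\psi(2t)\le d\psi(t)$ for all $t>0$) and $\lim_{t\to0+}\psi(t)/t=\lim_{t\to\infty}t/\psi(t)=0$. $\tau(0)=0$, $\tau(t)=1/\psi(1/t)$ for $t>0$, $\tau^{-1}$ its inverse, $\tau^{-1}(\infty)=\infty$. For measurable $f\colon\Omega\to\mathbb K$, $\mu_f(s)=\mu(\{x\in\Omega:|f(x)|>s\})$. $L^{\psi,1}(\Omega,\mathbb K)$ is the set of $f\in L^1_{\mathrm{loc}}(\Omega,\mathbb K)$ with $\|f\|_{L^{\psi,1}(\Omega,\mathbb K)}:=\int_0^\infty\tau^{-1}(\mu_f(s))\,ds<\infty$. $L^{\psi,1}(\Omega,V)$ is the set of Lebesgue measurable $f\colon\Omega\to V$ with $\|f(\cdot)\|_V\in L^{\psi,1}(\Omega,\mathbb K)$, normed by $\|f\|_{L^{\psi,1}(\Omega,V)}=\|\,\|f(\cdot)\|_V\|_{L^{\psi,1}(\Omega,\mathbb K)}$ (functions equal a.e. identified). Approximate differential: a linear map $A$ is an approximate differential of measurable $F\colon\Omega\to\mathbb R^k$ at $x_0$ if for every $\varepsilon>0$, $x_0$ is a density point of $\{x\in\Omega\setminus\{x_0\}:\|F(x)-F(x_0)-A(x-x_0)\|/\|x-x_0\|<\varepsilon\}$.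 $J_F(x)$ is the determinant of the approximate differential at $x$, set to $0$ where it does not exist. Luzin's condition N: null sets are mapped to null sets. Hypothesis (H): $f_1,\dots,f_N$ are measurable, a.e. approximately differentiable and satisfy Luzin's condition N; for every $n$ and null $M\subset\mathbb R^k$, $f_n^{-1}(M)$ is null; there is $K\in\mathbb N$ such that for each $n$, $\{x\in\Omega:\operatorname{card} f_n^{-1}(x)>K\}$ is null; $g_1,\dots,g_N,h_0$ are measurable; $L=\max\{l\in\{1,\dots,N\}: \mu(\bigcap_{i=1}^l f_{n_i}(\Omega))>0\text{ for some } n_1<\dots<n_l\}$. $P\psi=\sum_{n=1}^N g_n\cdot(\psi\circ f_n)$. The elementary solution in a normed function space $\mathcal F_0$ is $\sum_{i=0}^\infty P^i h_0$, when this series converges in the norm of $\mathcal F_0$ to a function in $\mathcal F_0$ solving the equation. *)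

(* Defs.v *)
From HB Require Import structures.
From mathcomp Require Import all_boot all_order all_algebra.
From mathcomp Require Import all_classical all_reals all_analysis.
From mathcomp Require Import complex.
Set Implicit Arguments. Unset Strict Implicit. Unset Printing Implicit Defensive.
Import Order.TTheory GRing.Theory Num.Theory.
Import numFieldNormedType.Exports.
Local Open Scope classical_set_scope.
Local Open Scope ring_scope.

Definition Kof (R : realType) (b : bool) : numFieldType :=
  if b then (R[i] : numFieldType) else (R : numFieldType).

Definition KtoR (R : realType) (b : bool) : Kof R b -> R :=
  match b return Kof R b -> R with
  | true => fun z => complex.Re z
  | false => fun x => x
  end.

Definition Knorm (R : realType) (b : bool) (z : Kof R b) : R := KtoR (`|z|).

Definition Vnorm (R : realType) (b : bool) (V : normedModType (Kof R b)) (v : V) : R :=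
  KtoR (`|v|).

Definition separable_space (T : topologicalType) : Prop :=
  exists D : set T, countable D /\ dense D.

Section Leb.
Variables (R : realType) (k : nat).
Local Notation Rk := 'rV[R]_k.

Definition enorm (x : Rk) : R := Num.sqrt (\sum_(i < k) x 0 i ^+ 2).
Definition eball (x : Rk) (r : R) : set Rk := [set y | enorm (y - x) < r].

Definition box (a b : Rk) : set Rk := [set x | forall i, a 0 i <= x 0 i <= b 0 i].
Definition box_vol (a b : Rk) : R := \prod_(i < k) Num.max (b 0 i - a 0 i) 0.

Definition lebo (A : set Rk) : \bar R :=
  ereal_inf [set s | exists a b : nat -> Rk,
     A `<=` \bigcup_n box (a n) (b n) /\
     s = (\sum_(0 <= n <oo) (box_vol (a n) (b n))%:E)%E].

Definition lmeas (A : set Rk) : Prop :=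
  forall E, lebo E = (lebo (E `&` A) + lebo (E `&` ~` A))%E.

Definition null (A : set Rk) : Prop := lebo A = 0%E.

Definition ae_on (Om : set Rk) (P : Rk -> Prop) : Prop :=
  null (Om `&` [set x | ~ P x]).

Definition lmeas_fun (T : topologicalType) (Om : set Rk) (F : Rk -> T) : Prop :=
  forall U : set T, open U -> lmeas (Om `&` F @^-1` U).

Definition density_point (A : set Rk) (x0 : Rk) : Prop :=
  (fun r => fine (lebo (A `&` eball x0 r)) / fine (lebo (eball x0 r)))
     r @[r --> 0^'+] --> (1 : R).

Definition approx_diff (Om : set Rk) (F : Rk -> Rk) (A : 'M[R]_k) (x0 : Rk) : Prop :=
  forall eps : R, 0 < eps ->
    density_point [set x | Om x /\ x != x0 /\
        enorm (F x - F x0 - (x - x0) *m A) / enorm (x - x0) < eps] x0.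

Definition Jac (Om : set Rk) (F : Rk -> Rk) (x : Rk) : R :=
  match pselect (exists A, approx_diff Om F A x) with
  | left h => \det (projT1 (cid h))
  | right _ => 0
  end.

Definition distrib (Om : set Rk) (u : Rk -> R) (s : R) : \bar R :=
  lebo [set x | Om x /\ s < `|u x|].

(* integral over C of a nonnegative function |u|, via the layer-cake formula *)
Definition int_abs (C : set Rk) (u : Rk -> R) : \bar R :=
  (\int[lebesgue_measure]_(s in [set s : R | (0 <= s)%R]) distrib C u s)%E.

Definition L1loc (Om : set Rk) (u : Rk -> R) : Prop :=
  forall C : set Rk, compact C -> C `<=` Om -> (int_abs C u < +oo)%E.

Definition tau (psi : R -> R) (t : R) : R := if t == 0 then 0 else 1 / psi (1 / t).
Definition tau_inv (psi : R -> R) (u : \bar R) : \bar R :=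
  ereal_sup [set t%:E | t in [set t : R | 0 <= t /\ ((tau psi t)%:E <= u)%E]].

Definition psinormR (psi : R -> R) (Om : set Rk) (u : Rk -> R) : \bar R :=
  (\int[lebesgue_measure]_(s in [set s : R | (0 <= s)%R]) tau_inv psi (distrib Om u s))%E.

Definition LpsiR (psi : R -> R) (Om : set Rk) (u : Rk -> R) : Prop :=
  lmeas_fun Om u /\ L1loc Om u /\ (psinormR psi Om u < +oo)%E.

Definition psinorm (psi : R -> R) (b : bool) (V : normedModType (Kof R b))
   (Om : set Rk) (h : Rk -> V) : \bar R :=
  psinormR psi Om (fun x => Vnorm (h x)).

Definition Lpsi (psi : R -> R) (b : bool) (V : normedModType (Kof R b))
   (Om : set Rk) (h : Rk -> V) : Prop :=
  lmeas_fun Om h /\ LpsiR psi Om (fun x => Vnorm (h x)).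

Definition Pop (b : bool) (V : normedModType (Kof R b)) (N : nat)
   (g : 'I_N -> Rk -> Kof R b) (f : 'I_N -> Rk -> Rk) (phi : Rk -> V) : Rk -> V :=
  fun x => \sum_(n < N) g n x *: phi (f n x).

Definition solves (b : bool) (V : normedModType (Kof R b)) (N : nat)
   (Om : set Rk) (g : 'I_N -> Rk -> Kof R b) (f : 'I_N -> Rk -> Rk)
   (h0 phi : Rk -> V) : Prop :=
  ae_on Om (fun x => phi x = Pop g f phi x + h0 x).

Definition Lconst (N : nat) (Om : set Rk) (f : 'I_N -> Rk -> Rk) : nat :=
  \max_(S : {set 'I_N} | `[< (0 < lebo (\bigcap_(n in [set n | n \in S]) (f n @` Om)))%E >])
     #|S|.

Definition hypH (b : bool) (V : normedModType (Kof R b)) (N : nat)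
   (Om : set Rk) (f : 'I_N -> Rk -> Rk) (g : 'I_N -> Rk -> Kof R b) (h0 : Rk -> V)
   (K L : nat) : Prop :=
  (forall n, lmeas_fun Om (f n)) /\
  (forall n, ae_on Om (fun x => exists A, approx_diff Om (f n) A x)) /\
  (forall n (M : set Rk), M `<=` Om -> null M -> null (f n @` M)) /\
  (forall n (M : set Rk), null M -> null (Om `&` f n @^-1` M)) /\
  (0 < K)%N /\
  (forall n, null [set x | Om x /\ exists s : seq Rk,
       [/\ uniq s, size s = K.+1 & forall y, y \in s -> Om y /\ f n y = x]]) /\
  (forall n, lmeas_fun Om (g n)) /\ lmeas_fun Om h0 /\
  L = Lconst Om f.

End Leb.

Definition good_psi (R : realType) (psi : R -> R) : Prop :=
  (psi 0 = 0 /\ forall t, 0 <= t -> 0 <= psi t) /\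
  (forall s t, 0 <= s -> s < t -> psi s < psi t) /\
  (forall s t l, 0 <= s -> 0 <= t -> 0 <= l <= 1 ->
      psi (l * s + (1 - l) * t) <= l * psi s + (1 - l) * psi t) /\
  (forall t, 0 < t -> psi x @[x --> t^'-] --> psi t) /\
  (psi x @[x --> 0^'+] --> 0) /\ (psi x @[x --> +oo] --> +oo) /\
  (exists d : R, 1 < d /\ forall t, 0 < t -> psi (2 * t) <= d * psi t) /\
  (psi t / t @[t --> 0^'+] --> 0) /\ (t / psi t @[t --> +oo] --> 0).

(* Main.v *)
Require Import Defs.
From HB Require Import structures.
From mathcomp Require Import all_boot all_order all_algebra.
From mathcomp Require Import all_classical all_reals all_analysis.
From mathcomp Require Import complex.
From mathcomp Require Import perm lra ring measurable_realfun.
Set Implicit Arguments. Unset Strict Implicit. Unset Printing Implicit Defensive.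
Import Order.TTheory GRing.Theory Num.Theory.
Import numFieldNormedType.Exports.
Local Open Scope classical_set_scope.
Local Open Scope ring_scope.

(* Write [phi = tau_inv psi] and [mu_u] for the distribution function of [u], so that the norm
   is [|| u || = int phi (mu_|u|)].  The function [phi] is only quasi-concave
   ([phi] increases and [phi t / t] decreases), hence [|| . ||] need not be subadditive.  It is
   however almost additive for bounded small perturbations: if [0 <= w <= e] and
   [int w <= e a], then [|| H + w || <= || H || + 2 e phi a].

   Up to a null set, the set where [J f_n <> 0] is a countable union of measurable pieces on
   which [f_n] is close to an invertible linear map; comparing volumes piece by piece bounds the
   integral of [|J f_n|] over a preimage by the volume of the set, counted with multiplicity.
   The multiplicity is at most [K] for each [n], and almost every point lies in at most [L] of
   the ranges.  With [|g_n| <= alpha |J f_n| / (K L)] it follows that the positive operator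
   [Q u = sum_n |g_n| (u o f_n)] satisfies [int Q u <= alpha int u]; the bound
   [|g_n| <= alpha / N] gives [Q 1 <= alpha].  So [Q^i] maps an indicator of a set of measure
   [a] to a function with values at most [alpha^i] and integral at most [alpha^i a].  Adding up
   the dyadic layers of [|h_0|] and the powers [Q^i], [i >= j], gives
     [|| H + sum_(i >= j) Q^i |h_0| || <= || H || + 2 alpha^j / (1 - alpha) || h_0 ||],
   which for [H = 0] when [j >= 1], and for [H = |h_0|] and the powers [i >= 1] when [j = 0],
   is at most the stated bound.  Finiteness of this norm makes the series converge absolutely
   almost everywhere.  A second solution [u] satisfies
   [u = sum_(i < m) P^i h_0 + P^m u] almost everywhere, and [|P^m u| <= Q^m |u|] tends to 0
   almost everywhere because [sum_m Q^m |u|] is finite. *)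

(** * Quasi-concave functions and the Lorentz functional *)

Section quasiconcave.
Context {R : realType}.
Local Open Scope ereal_scope.

Record quasiconcave (phi : \bar R -> \bar R) : Prop := Quasiconcave {
  qc0 : phi 0 = 0 ;
  qc_homo : {homo phi : x y / x <= y} ;
  qc_le_ratio : forall a x : R, (0 < a)%R -> (a <= x)%R ->
    phi x%:E <= (x / a)%:E * phi a%:E ;
  qc_gt0 : forall a : R, (0 < a)%R -> 0 < phi a%:E ;
  qc_lty : forall a : R, phi a%:E < +oo ;
  qc_unbounded : forall M : R, exists x : R, M%:E <= phi x%:E }.

Variables (phi : \bar R -> \bar R) (qphi : quasiconcave phi).

Lemma qc_ge0 x : 0 <= x -> 0 <= phi x.
Proof. by move=> x0; rewrite -(qc0 qphi) qc_homo. Qed.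

Lemma qc_pinfty : phi +oo = +oo.
Proof.
apply/eqyP => r _; have [x rx] := qc_unbounded qphi r.
by rewrite (le_trans rx)// qc_homo// leey.
Qed.

Lemma qc_left_continuous (l S : \bar R) : 0 <= l -> 0 <= S ->
  (forall y, y < l -> phi y <= S) -> phi l <= S.
Proof.
move=> + S0; case: l => [r| |]// + phiS.
- rewrite lee_fin [X in is_true X -> _]le_eqVlt => /predU1P[<-|r0]; first by rewrite qc0.
  apply/lee_mul01Pr => [|q /andP[q0 q1]]; first by rewrite qc_ge0// lee_fin ltW.
  have qr0 : (0 < q * r)%R by rewrite mulr_gt0.
  have qrr : (q * r < r)%R by rewrite gtr_pMl.
  rewrite (le_trans _ (phiS (q * r)%:E _)) ?lte_fin//.
  rewrite -lee_pdivlMl// (le_trans (qc_le_ratio qphi qr0 (ltW qrr)))//.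
  by rewrite invfM mulrCA mulfV ?gt_eqF// mulr1.
- move=> _; rewrite qc_pinfty// leye_eq; apply/eqP/eqyP => A _.
  have [x Ax] := qc_unbounded qphi A.
  by rewrite (le_trans Ax)// phiS// ltry.
Qed.

Lemma qc_cvg (u : (\bar R)^nat) l :
  nondecreasing_seq u -> (forall n, 0 <= u n) -> u @ \oo --> l ->
  phi (u n) @[n --> \oo] --> phi l.
Proof.
move=> ndu u0 ul.
have lE : l = ereal_sup (range u).
  by rewrite -(cvg_lim _ ul)//; apply/cvg_lim => //; exact: ereal_nondecreasing_cvgn.
have ul' n : u n <= l by rewrite lE; apply: ereal_sup_ubound; exists n.
have -> : phi l = ereal_sup (range (phi \o u)); last first.
  by apply: ereal_nondecreasing_cvgn => m n mn; apply: qc_homo => //; exact: ndu.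
apply/eqP; rewrite eq_le; apply/andP; split; last first.
  by apply: ge_ereal_sup => _ [n _ <-]; exact: qc_homo.
have phi_sup n : phi (u n) <= ereal_sup (range (phi \o u)).
  by apply: ereal_sup_ubound; exists n.
apply: qc_left_continuous => [||y].
- exact: le_trans (u0 0%N) (ul' 0%N).
- by apply: le_trans (phi_sup 0%N); exact: qc_ge0.
- rewrite lE => /ereal_sup_gt[_ [n _ <-]] yn.
  by rewrite (le_trans _ (phi_sup n))// qc_homo// ltW.
Qed.

Lemma qc_slope (a : R) (x d : \bar R) : (0 < a)%R -> a%:E <= x -> 0 <= d ->
  phi (x + d) <= phi x + (a^-1)%:E * phi a%:E * d.
Proof.
move=> a0 ax d0.
have x0 : 0 <= x by apply: le_trans ax; rewrite lee_fin ltW.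
have slope0 : 0 < (a^-1)%:E * phi a%:E by rewrite mule_gt0 ?lte_fin ?invr_gt0 ?qc_gt0.
case: d d0 => [d d0| _|]//; last first.
  by rewrite gt0_muley// [leRHS]addey ?leey// -ltNye (lt_le_trans _ (qc_ge0 x0)).
case: x ax x0 => [x ax _| _ _|]//; last first.
  by rewrite qc_pinfty addye ?leey// gt_eqF// (@lt_le_trans _ _ 0)// mule_ge0// ltW.
rewrite lee_fin in ax; have x_gt0 : (0 < x)%R by exact: lt_le_trans ax.
rewrite lee_fin in d0.
rewrite -EFinD (le_trans (qc_le_ratio qphi x_gt0 _)) ?lerDl//.
have dx0 : (0 <= d / x)%R by rewrite divr_ge0// ltW.
rewrite mulrDl mulfV ?gt_eqF// EFinD ge0_muleDl ?lee_fin// mul1e leeD2l//.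
rewrite (le_trans (lee_wpmul2l _ (qc_le_ratio qphi a0 ax))) ?lee_fin//.
by rewrite muleA -EFinM muleAC -EFinM mulrA divfK ?gt_eqF// [(d / a)%R]mulrC.
Qed.

(* Equivalently, [y |-> phi y - phi (min y a)] is [phi a / a]-Lipschitz. *)
Lemma qc_excess (a : R) (x d : \bar R) : (0 < a)%R -> 0 <= d ->
  phi (x + d) + phi (mine x a%:E) <=
  phi x + phi (mine (x + d) a%:E) + (a^-1)%:E * phi a%:E * d.
Proof.
move=> a0 d0.
have slope0 : 0 <= (a^-1)%:E * phi a%:E * d.
  by rewrite !mule_ge0 ?qc_ge0// lee_fin ?invr_ge0 ltW.
have xxd : x <= x + d by rewrite leeDl.
have [xda|axd] := leP (x + d) a%:E.
  by rewrite min_l ?(le_trans xxd)// [phi x + _]addeC leeDl.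
have [xa|ax] := leP x a%:E.
  rewrite addeC -addeA leeD2l// (le_trans _ (qc_slope a0 _ d0))//.
  by apply: qc_homo => //; rewrite leeD2r.
by rewrite addeAC leeD2r// qc_slope// ltW.
Qed.

Lemma qc_chord (c : R) (x : \bar R) :
  (0 < c)%R -> 0 <= x -> x <= c%:E -> x * phi c%:E <= c%:E * phi x.
Proof.
move=> c0; case: x => [x| |]//; rewrite !lee_fin le_eqVlt => /predU1P[<- _|x0 xc].
  by rewrite mul0e mule_ge0 ?qc_ge0// lee_fin ltW.
have x_ge0 : 0 <= x%:E by rewrite lee_fin ltW.
rewrite (le_trans (lee_wpmul2l x_ge0 (qc_le_ratio qphi x0 xc)))//.
by rewrite muleA -EFinM mulrCA mulfV ?mulr1// gt_eqF.
Qed.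

End quasiconcave.

Section tau_inv.
Context {R : realType}.
Variables (psi : R -> R) (gpsi : good_psi psi).
Local Notation tau := (tau psi).
Local Notation tau_inv := (tau_inv psi).

Lemma good_psi_gt0 (t : R) : 0 < t -> 0 < psi t.
Proof. by case: gpsi => -[p0 _] [/(_ 0 t) + _] t0; rewrite p0; exact. Qed.

Lemma tau0 : tau 0 = 0.
Proof. by rewrite /Defs.tau eqxx. Qed.

Lemma tau_gt0 (t : R) : 0 < t -> 0 < tau t.
Proof.
by move=> t0; rewrite /Defs.tau gt_eqF// divr_gt0// good_psi_gt0// divr_gt0.
Qed.

Lemma tau_star_shaped (l t : R) : 0 <= l <= 1 -> 0 <= t -> tau (l * t) <= l * tau t.
Proof.
move=> /andP[]; rewrite le_eqVlt => /predU1P[<- _|l0 l1] t0.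
  by rewrite !mul0r tau0.
move: t0; rewrite le_eqVlt => /predU1P[<-|t0].
  by rewrite mulr0 tau0 mulr0.
rewrite /Defs.tau !gt_eqF ?mulr_gt0// !div1r.
have lt0 : 0 < l * t by rewrite mulr_gt0.
rewrite -[leRHS]invrK lef_pV2 ?posrE ?good_psi_gt0 ?invr_gt0//; last first.
  by rewrite mulr_gt0// invr_gt0 good_psi_gt0// invr_gt0.
rewrite invfM invrK ler_pdivrMl//.
have [[p0 _] [_ [/(_ (l * t)^-1 0 l) cvx _]]] := gpsi.
have := cvx; rewrite !mulr0 addr0 p0 mulr0 addr0 invfM mulrA mulfV ?gt_eqF//.
rewrite mul1r; apply => //; first by rewrite mulr_ge0// invr_ge0 ltW.
by rewrite l1 ltW.
Qed.

Local Open Scope ereal_scope.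

Lemma tau_inv_ge u (t : R) : (0 <= t)%R -> (tau t)%:E <= u -> t%:E <= tau_inv u.
Proof. by move=> t0 tu; apply: ereal_sup_ubound; exists t. Qed.

Lemma tau_inv_le u y : (forall t : R, (0 <= t)%R -> (tau t)%:E <= u -> t%:E <= y) ->
  tau_inv u <= y.
Proof. by move=> uy; apply: ge_ereal_sup => _ [t [t0 tu] <-]; exact: uy. Qed.

Lemma tau_inv0 : tau_inv 0 = 0.
Proof.
apply/eqP; rewrite eq_le tau_inv_ge ?tau0// andbT; apply: tau_inv_le => t t0.
by rewrite !lee_fin; apply: contraTT; rewrite -!ltNge; exact: tau_gt0.
Qed.

Lemma tau_inv_homo : {homo tau_inv : x y / x <= y}.
Proof.
by move=> x y xy; apply: tau_inv_le => t t0 tx; exact: tau_inv_ge (le_trans tx xy).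
Qed.

Lemma tau_inv_le_ratio (a x : R) : (0 < a)%R -> (a <= x)%R ->
  tau_inv x%:E <= (x / a)%:E * tau_inv a%:E.
Proof.
move=> a0 ax; have x0 : (0 < x)%R by exact: lt_le_trans ax.
apply: tau_inv_le => t t0; rewrite lee_fin => tx.
rewrite -lee_pdivrMl ?divr_gt0// -EFinM invf_div; apply: tau_inv_ge.
  by rewrite mulr_ge0// divr_ge0 ?ltW.
rewrite lee_fin (le_trans (tau_star_shaped _ _))//.
  by rewrite divr_ge0 ?(ltW a0) ?(ltW x0)//= ler_pdivrMr// mul1r.
by rewrite mulrAC ler_pdivrMr// ler_pM2l.
Qed.

Lemma tau_inv_gt0 (a : R) : (0 < a)%R -> 0 < tau_inv a%:E.
Proof.
move=> a0; have t1 := tau_gt0 ltr01; pose m : R := Num.min 1%R (a / tau 1)%R.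
have m0 : (0 < m)%R by rewrite lt_min ltr01 divr_gt0.
apply: (@lt_le_trans _ _ m%:E); first by rewrite lte_fin.
apply: tau_inv_ge; first exact: ltW.
have m01 : (0 <= m <= 1)%R by rewrite (ltW m0) ge_min lexx.
have := tau_star_shaped m01 ler01; rewrite mulr1 lee_fin => /le_trans; apply.
by rewrite -ler_pdivlMr// ge_min lexx orbT.
Qed.

Lemma tau_inv_lty (a : R) : tau_inv a%:E < +oo.
Proof.
have t1 := tau_gt0 ltr01.
apply: (@le_lt_trans _ _ (Num.max 1 (a / tau 1))%:E); last by rewrite ltry.
apply: tau_inv_le => t t0; rewrite !lee_fin le_max => tx.
have [//|t_gt1] := leP t 1%R; rewrite ler_pdivlMr//.
have t_gt0 : (0 < t)%R by exact: lt_trans t_gt1.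
have : (0 <= t^-1 <= 1)%R by rewrite invr_ge0 t0/= invf_le1// ltW.
move=> /tau_star_shaped - /(_ t t0); rewrite mulVf ?gt_eqF//.
by rewrite ler_pdivlMl// => /le_trans; apply.
Qed.

Lemma tau_inv_unbounded (M : R) : exists x : R, M%:E <= tau_inv x%:E.
Proof.
exists (tau (Num.max M 0%R)); apply: (@le_trans _ _ (Num.max M 0%R)%:E).
  by rewrite lee_fin le_max lexx.
by apply: tau_inv_ge; rewrite ?le_max ?lexx ?orbT.
Qed.

Lemma tau_inv_quasiconcave : quasiconcave tau_inv.
Proof.
by split; [exact: tau_inv0|exact: tau_inv_homo|exact: tau_inv_le_ratio
  |exact: tau_inv_gt0|exact: tau_inv_lty|exact: tau_inv_unbounded].
Qed.

End tau_inv.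

Section lebesgue_line.
Context {R : realType}.
Local Open Scope ereal_scope.

Lemma measurable_ger (a : R) : measurable [set s : R | (a <= s)%R].
Proof. by rewrite -set_itvcy; exact: measurable_itv. Qed.

Lemma ge0_setE (a : R) : (0 <= a)%R ->
  [set s : R | (0 <= s)%R] = `[0%R, a[%classic `|` [set s | (a <= s)%R].
Proof.
move=> a0; apply/seteqP; split => s /=; rewrite in_itv/=.
  by move=> s0; have [|] := ltP s a; [left; rewrite s0|right].
by move=> [/andP[]//|]; exact: le_trans.
Qed.

Lemma nonincreasing_emeasurable (D : set R) (f : R -> \bar R) : measurable D ->
  {homo f : s t / (s <= t)%R >-> t <= s} -> measurable_fun D f.
Proof.
move=> mD f_ni _; apply: (measurability _ (ErealGenCInfty.measurableE R)) => //.
move=> _ [_ [r ->] <-]; apply: measurableI => //.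
apply: is_interval_measurable => s t /=.
rewrite !in_itv/= !andbT => fs ft u /andP[su ut].
by rewrite in_itv/= andbT (le_trans ft)// f_ni.
Qed.

Lemma ge0_integral_shift (f : R -> \bar R) (e : R) :
  measurable_fun setT f -> (forall s, 0 <= f s) ->
  \int[lebesgue_measure]_(s in [set s : R | (e <= s)%R]) f (s - e)%R =
  \int[lebesgue_measure]_(s in [set s : R | (0 <= s)%R]) f s.
Proof.
move=> mf f0.
pose sh := (fun s : R => (s - e)%R) : measurableTypeR R -> measurableTypeR R.
have msh : measurable_fun setT sh by exact: measurable_funB.
rewrite (_ : [set s : R | (e <= s)%R] = sh @^-1` [set s : R | (0 <= s)%R]); last first.
  by apply/seteqP; split => s /=; rewrite /sh subr_ge0.
have := @ge0_integral_pushforward _ _ _ _ R sh msh lebesgue_measure _ f (measurable_ger 0).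
move=> /(_ _ _)/esym ->; [|exact: measurable_funS mf|by move=> *; exact: f0].
apply: eq_measure_integral => A mA _; apply/esym.
apply: (@lebesgue_measure_unique _ (pushforward lebesgue_measure sh)) => //.
move=> _ [[a b] _ <-].
change (@lebesgue_measure R `]a, b]%classic =
  @lebesgue_measure R (sh @^-1` `]a, b]%classic)).
have -> : sh @^-1` `]a, b]%classic = `](a + e)%R, (b + e)%R]%classic.
  by apply/seteqP; split => s /=; rewrite !in_itv/= ltrBrDr lerBlDr.
rewrite !lebesgue_measure_itv/= !lte_fin ltrD2r; case: ifPn => // _.
by rewrite -!EFinB; congr EFin; ring.
Qed.

Lemma nonincreasing_lower_sum_le (F : R -> \bar R) (e : R) M : (forall s, 0 <= F s) ->
  {homo F : s t / (s <= t)%R >-> t <= s} -> (0 < e)%R ->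
  \sum_(l < M) e%:E * F (l.+1%:R * e)%R <=
  \int[lebesgue_measure]_(s in [set s : R | (0 <= s)%R]) F s.
Proof.
move=> F0 F_ni e0; pose b (l : nat) : R := (l%:R * e)%R.
have b0 l : (0 <= b l)%R by rewrite mulr_ge0// ltW.
have bS l : (b l < b l.+1)%R by rewrite ltr_pM2r// ltr_nat.
have mF D : measurable D -> measurable_fun D F.
  by move=> mD; exact: nonincreasing_emeasurable.
apply: (@le_trans _ _ (\int[lebesgue_measure]_(s in `[0%R, b M[) F s)); last first.
  apply: ge0_subset_integral => //; [exact: measurable_ger|exact: (mF _ (measurable_ger 0))|].
  by move=> s /=; rewrite in_itv/= => /andP[].
elim: M => [|M IH]; first by rewrite big_ord0 integral_ge0.
have <- : `[0%R, b M[ `|` `[b M, b M.+1[ = `[0%R, b M.+1[%classic.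
  apply/seteqP; split => s /=; rewrite !in_itv/=.
    by move=> [/andP[-> /lt_trans->//]|/andP[bs ->]]; rewrite ?(le_trans (b0 M) bs).
  by move=> /andP[-> ->]; rewrite andbT; have [|] := ltP s (b M); [left|right].
rewrite big_ord_recr/=.
rewrite ge0_integral_setU//; first last.
- rewrite disj_set2E; apply/eqP/seteqP; split => s //=; rewrite !in_itv/=.
  by case=> /andP[_ se] /andP[]; rewrite leNgt se.
- by apply: mF; apply: measurableU; exact: measurable_itv.
apply: leeD => //.
apply: (@le_trans _ _ (\int[lebesgue_measure]_(s in `[b M, b M.+1[) cst (F (b M.+1)) s)).
  rewrite integral_cst//= lebesgue_measure_itv/= lte_fin bS muleC -EFinB.
  by rewrite /b -mulrBl -natrB// subSnn mul1r.
apply: ge0_le_integral => //; [by move=> s _ /=; exact: F0|exact: mF|].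
by move=> s /=; rewrite in_itv/= => /andP[_ /ltW]; exact: F_ni.
Qed.

End lebesgue_line.

Section lorentz.
Context d (X : measurableType d) (R : realType).
Variable mu : {sigma_finite_measure set X -> \bar R}.
Local Open Scope ereal_scope.
Implicit Types (phi : \bar R -> \bar R) (u v w H : X -> \bar R).

Local Notation Rpos := [set s : R | (0 <= s)%R].

Definition lorentz phi u :=
  \int[lebesgue_measure]_(s in Rpos) phi (mu [set x | s%:E < u x]).

Lemma measurable_superlevel u s : measurable_fun setT u -> measurable [set x | s < u x].
Proof. by move=> mmu; rewrite -[X in measurable X]setTI; exact: emeasurable_fun_o_infty. Qed.

Lemma distribution_nincr u : measurable_fun setT u ->
  {homo (fun s : R => mu [set x | s%:E < u x]) : s t / (s <= t)%R >-> t <= s}.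
Proof.
move=> mmu s t st; apply: le_measure; rewrite ?inE; try exact: measurable_superlevel.
by move=> x /=; apply: le_lt_trans; rewrite lee_fin.
Qed.

Lemma measurable_distribution phi u D : measurable_fun setT u ->
  {homo phi : x y / x <= y} -> measurable D ->
  measurable_fun D (fun s : R => phi (mu [set x | s%:E < u x])).
Proof.
move=> mmu homophi mD; apply: nonincreasing_emeasurable => // s t st.
by apply: homophi; exact: distribution_nincr.
Qed.

Section measure_between.
Variables H w : X -> \bar R.
Hypotheses (mH : measurable_fun setT H) (mw : measurable_fun setT w).
Hypothesis w0 : forall x, 0 <= w x.

Let between (s : R) := [set x | H x <= s%:E /\ s%:E < H x + w x].

Lemma distributionD (s : R) :
  mu [set x | s%:E < H x + w x] = mu [set x | s%:E < H x] + mu (between s).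
Proof.
rewrite -measureU; first last.
- by apply/seteqP; split => x //= -[] /lt_le_trans h [] /h; rewrite ltxx.
- rewrite (_ : between s =
      (setT `&` [set x | H x <= s%:E]) `&` (setT `&` [set x | s%:E < H x + w x])).
    apply: measurableI; first exact: emeasurable_fun_infty_c.
    by apply: emeasurable_fun_o_infty => //; exact: emeasurable_funD.
  by rewrite !setTI.
- exact: measurable_superlevel.
congr (mu _); apply/seteqP; split => x /=.
  by move=> sHw; have [|] := leP (H x) s%:E; [right|left].
by case=> [/lt_le_trans|[]//]; apply; rewrite leeDl.
Qed.

Let strip := [set z : X * measurableTypeR R |
  H z.1 <= (z.2 : R)%:E /\ (z.2 : R)%:E < H z.1 + w z.1].

Let measurable_strip : measurable strip.
Proof.
have m1 (u : X -> \bar R) : measurable_fun setT u ->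
    measurable_fun setT (fun z : X * measurableTypeR R => u z.1).
  by move=> mmu; apply: measurableT_comp.
have m2 : measurable_fun setT (fun z : X * measurableTypeR R => (z.2 : R)%:E).
  by apply: measurableT_comp => //; exact: EFin_measurable.
rewrite (_ : strip = (setT `&` [set z | H z.1 <= (z.2 : R)%:E]) `&`
    (setT `&` [set z | (z.2 : R)%:E < H z.1 + w z.1])); last by rewrite !setTI.
apply: measurableI; first by apply: measurable_lee => //; exact: m1.
by apply: measurable_lte => //; apply: (m1 (fun x => H x + w x)); exact: emeasurable_funD.
Qed.

Let strip_ysection (s : R) : ysection strip s = between s.
Proof. by apply/seteqP; split => x; rewrite /ysection/= inE. Qed.

Lemma measurable_between : measurable_fun setT (mu \o between).
Proof.
rewrite (_ : mu \o between = mu \o ysection strip); first exact: measurable_fun_ysection.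
by apply/funext => s /=; rewrite strip_ysection.
Qed.

Let strip_xsection_le x : lebesgue_measure (xsection strip x) <= w x.
Proof.
have -> : xsection strip x = [set s : R | H x <= s%:E /\ s%:E < H x + w x].
  by apply/seteqP; split => s; rewrite /xsection/= inE.
have [->|] := eqVneq (w x) +oo; first by rewrite leey.
have := w0 x; case: (w x) => [r r0 _| |]//.
case: (H x) => [h| |].
- rewrite (_ : [set s | _] = `[h, (h + r)%R[%classic); last first.
    by apply/seteqP; split => s /=; rewrite in_itv/= lee_fin lte_fin => /andP.
  rewrite lebesgue_measure_itv/= lte_fin ltrDl; case: ifPn => // _.
  by rewrite -EFinB addrAC subrr add0r.
- by rewrite (_ : [set s | _] = set0) ?measure0//; apply/seteqP; split => s //= -[].
- by rewrite (_ : [set s | _] = set0) ?measure0//; apply/seteqP; split => s //= -[].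
Qed.

(* Fubini on the region between the graphs of [H] and [H + w]. *)
Lemma integral_between_le :
  \int[lebesgue_measure]_(s in Rpos) mu (between s) <= \int[mu]_x w x.
Proof.
apply: (@le_trans _ _ (\int[lebesgue_measure]_s mu (between s))).
  apply: ge0_subset_integral => //; [exact: measurable_ger|exact: measurable_between].
have := indic_fubini_tonelli mu lebesgue_measure measurable_strip.
rewrite (indic_fubini_tonelli_GE mu measurable_strip).
rewrite (indic_fubini_tonelli_FE lebesgue_measure measurable_strip).
rewrite (_ : mu \o ysection strip = mu \o between); last first.
  by apply/funext => s /=; rewrite strip_ysection.
move=> /esym fubini; rewrite [leLHS]fubini; apply: ge0_le_integral => //.
- exact: (measurable_fun_xsection _ measurable_strip).
- by move=> x _; exact: strip_xsection_le.
Qed.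

End measure_between.

Lemma lorentz_shift phi H w (e : R) (c : \bar R) :
  measurable_fun setT H -> measurable_fun setT w ->
  {homo phi : x y / x <= y} -> (forall y, 0 <= y -> 0 <= phi y <= c) ->
  (0 <= e)%R -> (forall x, w x <= e%:E) ->
  lorentz phi (fun x => H x + w x) <= e%:E * c + lorentz phi H.
Proof.
move=> mH mw homophi phic e0 we.
have phi0 (A : set X) : 0 <= phi (mu A) by have /andP[] := phic _ (measure_ge0 mu A).
have mphi D : measurable D ->
    measurable_fun D (fun s : R => phi (mu [set x | s%:E < H x + w x])).
  by apply: measurable_distribution => //; exact: emeasurable_funD.
rewrite {1}/lorentz (ge0_setE e0) ge0_integral_setU//; first last.
- rewrite disj_set2E; apply/eqP/seteqP; split => s //=; rewrite in_itv/=.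
  by case=> /andP[_ se]; rewrite leNgt se.
- by apply: mphi; apply: measurableU => //; exact: measurable_ger.
- exact: measurable_ger.
apply: leeD.
  apply: (@le_trans _ _ (\int[lebesgue_measure]_(s in `[0%R, e[) cst c s)).
    apply: ge0_le_integral => //; [exact: mphi|].
    by move=> s _; have /andP[] := phic _ (measure_ge0 mu [set x | s%:E < H x + w x]).
  rewrite integral_cst//= lebesgue_measure_itv/= lte_fin muleC.
  case: ifPn => [_|]; first by rewrite sube0.
  by rewrite mul0e mule_ge0//; have /andP[/le_trans] := phic 0 (lexx _); apply.
have mphiH : measurable_fun setT (fun s : R => phi (mu [set x | s%:E < H x])).
  exact: measurable_distribution.
rewrite /lorentz -(ge0_integral_shift e)//.
apply: ge0_le_integral => //; [exact: measurable_ger|exact: (mphi _ (measurable_ger e))| |].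
  apply: nonincreasing_emeasurable; first exact: measurable_ger.
  by move=> s t st; apply: homophi; apply: distribution_nincr => //; rewrite lerB.
move=> s _; apply: homophi; apply: le_measure; rewrite ?inE.
- by apply: measurable_superlevel; exact: emeasurable_funD.
- exact: measurable_superlevel.
- by move=> x /= sHw; rewrite EFinB lteBlDr// (lt_le_trans sHw)// leeD2l.
Qed.

Variables (phi : \bar R -> \bar R) (qphi : quasiconcave phi).

Lemma qc_mu_ge0 A : 0 <= phi (mu A).
Proof. by rewrite qc_ge0. Qed.
Hint Resolve qc_mu_ge0 : core.

Lemma lorentz_ge0 u : 0 <= lorentz phi u.
Proof. exact: integral_ge0. Qed.

Lemma lorentz0 : lorentz phi (cst 0) = 0.
Proof.
apply: integral0_eq => s /= s0.
rewrite (_ : [set x | _] = set0) ?measure0 ?qc0//.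
by apply/seteqP; split => x //=; rewrite lte_fin ltNge s0.
Qed.

Lemma lorentz_markov u (s : R) : measurable_fun setT u -> (0 < s)%R ->
  s%:E * phi (mu [set x | s%:E < u x]) <= lorentz phi u.
Proof.
move=> mmu s0; have F0 t : 0 <= phi (mu [set x | t%:E < u x]) by [].
apply: le_trans (nonincreasing_lower_sum_le 1 F0 _ s0).
  by rewrite big_ord1 mul1r.
by move=> t1 t2 t12; apply: qc_homo => //; exact: distribution_nincr.
Qed.

Lemma lorentz_superlevel_fin u (s : R) : measurable_fun setT u ->
  lorentz phi u < +oo -> (0 < s)%R -> mu [set x | s%:E < u x] \is a fin_num.
Proof.
move=> mmu ufin s0; rewrite ge0_fin_numE// ltey; apply/eqP => muy.
have := le_lt_trans (lorentz_markov mmu s0) ufin.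
by rewrite muy qc_pinfty// gt0_muley// lte_fin.
Qed.

Lemma lorentz_pinfty u : measurable_fun setT u -> lorentz phi u < +oo ->
  mu [set x | u x = +oo] = 0.
Proof.
move=> mmu ufin; set A := [set x | _].
have mA : measurable A by rewrite -[A]setTI; exact: measurable_eqe.
have phiA (s : R) : (0 < s)%R -> s%:E * phi (mu A) <= lorentz phi u.
  move=> s0; apply: le_trans (lorentz_markov mmu s0).
  rewrite lee_pmul2l ?lte_fin//; apply: qc_homo => //; apply: le_measure; rewrite ?inE//.
    exact: measurable_superlevel.
  by move=> x /= ->; rewrite ltry.
apply/eqP; apply: contraTT ufin => muA0; rewrite -leNgt leye_eq; apply/eqP/eqyP => r r0.
have muA : 0 < mu A by rewrite lt0e muA0 measure_ge0.
have [c c0 cA] : exists2 c : R, (0 < c)%R & c%:E <= phi (mu A).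
  case: (mu A) muA => [a a0| _|]//; last by exists 1%R; rewrite // qc_pinfty ?leey.
  have pf : phi a%:E \is a fin_num by rewrite gt0_fin_numE ?qc_lty// qc_gt0.
  by exists (fine (phi a%:E)); rewrite ?fineK// fine_gt0// qc_gt0// qc_lty.
apply: le_trans (phiA (r / c)%R _); last by rewrite divr_gt0.
by rewrite -{1}[r](divfK (lt0r_neq0 c0)) EFinM lee_pmul2l ?lte_fin ?divr_gt0.
Qed.

Lemma cvg_distribution (u : (X -> \bar R)^nat) v s :
  (forall n, measurable_fun setT (u n)) ->
  (forall x, nondecreasing_seq (u^~ x)) -> (forall x, u n x @[n --> \oo] --> v x) ->
  mu [set x | s < u n x] @[n --> \oo] --> mu [set x | s < v x].
Proof.
move=> mmu ndu uv.
have vE x : v x = ereal_sup (range (u^~ x)).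
  by rewrite -(cvg_lim _ (uv x))//; apply/cvg_lim => //; exact: ereal_nondecreasing_cvgn.
have -> : [set x | s < v x] = \bigcup_n [set x | s < u n x].
  apply/seteqP; split => x /=.
    by rewrite vE => /ereal_sup_gt[_ [n _ <-]] sx; exists n.
  by move=> [n _] /lt_le_trans; apply; rewrite vE; apply: ereal_sup_ubound; exists n.
apply: nondecreasing_cvg_mu.
- by move=> n; exact: measurable_superlevel.
- by apply: bigcup_measurable => n _; exact: measurable_superlevel.
- by move=> m n mn; apply/subsetPset => x /= /lt_le_trans; apply; exact: ndu.
Qed.

Lemma cvg_lorentz (u : (X -> \bar R)^nat) v :
  (forall n, measurable_fun setT (u n)) ->
  (forall x, nondecreasing_seq (u^~ x)) -> (forall x, u n x @[n --> \oo] --> v x) ->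
  lorentz phi (u n) @[n --> \oo] --> lorentz phi v.
Proof.
move=> mmu ndu uv.
have ndmu s : nondecreasing_seq (fun n => mu [set x | s < u n x]).
  move=> m n mn; apply: le_measure; rewrite ?inE; try exact: measurable_superlevel.
  by move=> x /= /lt_le_trans; apply; exact: ndu.
rewrite [lorentz phi v](_ : _ =
    \int[lebesgue_measure]_(s in Rpos) limn (fun n => phi (mu [set x | s%:E < u n x]))).
  apply: cvg_monotone_convergence => //; first exact: measurable_ger.
  - move=> n; apply: measurable_distribution => //; [exact: qc_homo|exact: measurable_ger].
  - by move=> s _ m n mn; apply: qc_homo => //; exact: ndmu.
apply: eq_integral => s _; apply/esym/cvg_lim => //.
by apply: qc_cvg => //; exact: cvg_distribution.
Qed.

Lemma lorentz_lim_le (u : (X -> \bar R)^nat) v C :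
  (forall n, measurable_fun setT (u n)) ->
  (forall x, nondecreasing_seq (u^~ x)) -> (forall x, u n x @[n --> \oo] --> v x) ->
  (forall n, lorentz phi (u n) <= C) -> lorentz phi v <= C.
Proof.
move=> mmu ndu uv uC; have cv := cvg_lorentz mmu ndu uv.
rewrite -(cvg_lim _ cv)//; apply: lime_le; last exact: nearW.
by apply/cvg_ex; exists (lorentz phi v).
Qed.

Section add_bounded.
Variables (H w : X -> \bar R) (e a : R).
Hypotheses (mH : measurable_fun setT H) (mw : measurable_fun setT w).
Hypothesis w0 : forall x, 0 <= w x.

Let Hw x := H x + w x.
Let truncated y := phi (mine y a%:E).

Let mHw : measurable_fun setT Hw. Proof. exact: emeasurable_funD. Qed.

Let truncated_homo : {homo truncated : x y / x <= y}.
Proof.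
move=> x y xy; apply: (qc_homo qphi).
by rewrite le_min !ge_min xy lexx orbT.
Qed.

Lemma lorentz_truncation_excess : (0 < a)%R ->
  lorentz phi Hw + lorentz truncated H <=
  lorentz phi H + lorentz truncated Hw + (a^-1)%:E * phi a%:E * \int[mu]_x w x.
Proof.
move=> a0; have mR := @measurable_ger R 0.
have t0 (A : set X) : 0 <= truncated (mu A).
  by apply: (qc_ge0 qphi); rewrite le_min measure_ge0 lee_fin ltW.
have slope0 : 0 <= (a^-1)%:E * phi a%:E.
  by rewrite mule_ge0 ?qc_ge0// lee_fin ?invr_ge0 ltW.
pose between s := mu [set x | H x <= s%:E /\ s%:E < Hw x].
have mb : measurable_fun Rpos between.
  by apply: measurable_funS (measurable_between mH mw).
have mphi u : measurable_fun setT u ->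
    measurable_fun Rpos (fun s : R => phi (mu [set x | s%:E < u x])).
  by move=> mmu; apply: measurable_distribution => //; exact: qc_homo.
have mt u : measurable_fun setT u ->
    measurable_fun Rpos (fun s : R => truncated (mu [set x | s%:E < u x])).
  by move=> mmu; exact: measurable_distribution.
apply: (@le_trans _ _ (lorentz phi H + lorentz truncated Hw +
    (a^-1)%:E * phi a%:E * \int[lebesgue_measure]_(s in Rpos) between s)); last first.
  by rewrite leeD2l// lee_wpmul2l// integral_between_le.
rewrite -ge0_integralZl// -!ge0_integralD//; try by [exact: mphi|exact: mt].
- apply: ge0_le_integral => //.
  + by move=> s _; exact: adde_ge0.
  + by apply: emeasurable_funD; [exact: mphi|exact: mt].
  + apply: emeasurable_funD; last exact: measurable_funeM.
    by apply: emeasurable_funD; [exact: mphi|exact: mt].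
  + by move=> s _; rewrite distributionD//; exact: qc_excess.
- by move=> s _; exact: adde_ge0.
- by apply: emeasurable_funD; [exact: mphi|exact: mt].
- by move=> s _; exact: mule_ge0.
- exact: measurable_funeM.
Qed.

Lemma lorentzD_integral0 : \int[mu]_x w x = 0 -> lorentz phi Hw = lorentz phi H.
Proof.
move=> intw; apply: eq_integral => s _; congr phi; rewrite distributionD//.
rewrite [X in _ + X](_ : _ = 0) ?adde0//.
have : \int[mu]_x `|w x| = 0 by under eq_integral do rewrite gee0_abs//.
move=> /(ae_eq_integral_abs mu measurableT mw)[Z [mZ Z0 wZ]].
apply: (subset_measure0 _ mZ _ Z0) => [|x /= [Hs sHw]].
  rewrite (_ : [set x | _] =
      (setT `&` [set x | H x <= s%:E]) `&` (setT `&` [set x | s%:E < Hw x])).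
    by apply: measurableI; [exact: emeasurable_fun_infty_c|exact: emeasurable_fun_o_infty].
  by rewrite !setTI.
by apply: wZ => /= /(_ Logic.I) wx0; move: sHw; rewrite wx0 /= adde0 ltNge Hs.
Qed.

(* [phi] is the sum of [min phi (phi a)] and of a part that is [phi a / a]-Lipschitz.  The
   first part is handled by the uniform bound on [w] and the second one by the [L^1] bound;
   each contributes [e phi a]. *)
Lemma lorentzD_le : (0 <= e)%R -> (0 <= a)%R -> (forall x, w x <= e%:E) ->
  \int[mu]_x w x <= (e * a)%:E ->
  lorentz phi Hw <= lorentz phi H + (2 * e)%:E * phi a%:E.
Proof.
move=> e0; rewrite le_eqVlt => /predU1P[<- _|a0 we wa].
  rewrite mulr0 => w_le0; rewrite lorentzD_integral0 ?(qc0 qphi) ?mule0 ?adde0//.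
  by apply/eqP; rewrite eq_le w_le0 integral_ge0.
have a_ge0 : 0 <= a%:E by rewrite lee_fin ltW.
have ea0 : 0 <= (2 * e)%:E * phi a%:E.
  by rewrite mule_ge0 ?qc_ge0// lee_fin mulr_ge0.
have [->|] := eqVneq (lorentz phi H) +oo.
  by rewrite addye ?leey// -ltNye (lt_le_trans _ ea0).
rewrite -ltey => Hfin.
have t0 y : 0 <= y -> 0 <= truncated y by move=> y0; apply: (qc_ge0 qphi); rewrite le_min y0.
have shift : lorentz truncated Hw <= e%:E * phi a%:E + lorentz truncated H.
  apply: lorentz_shift => // y y0; rewrite t0//=.
  by apply: qc_homo => //; rewrite ge_min lexx orbT.
have tHfin : lorentz truncated H \is a fin_num.
  rewrite ge0_fin_numE; last by apply: integral_ge0 => s _; exact: t0.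
  apply: le_lt_trans Hfin; apply: ge0_le_integral => //.
  - exact: measurable_ger.
  - by move=> s _; exact: t0.
  - by apply: measurable_distribution => //; exact: measurable_ger.
  - by apply: measurable_distribution; [|exact: qc_homo|exact: measurable_ger].
  - by move=> s _; apply: qc_homo => //; rewrite ge_min lexx.
rewrite -(leeD2rE _ _ tHfin); apply: le_trans (lorentz_truncation_excess a0) _.
have slope : (a^-1)%:E * phi a%:E * \int[mu]_x w x <= e%:E * phi a%:E.
  rewrite (@le_trans _ _ ((a^-1)%:E * phi a%:E * (e * a)%:E))//.
    by rewrite lee_wpmul2l// mule_ge0 ?qc_ge0// lee_fin invr_ge0 ltW.
  by rewrite muleAC -EFinM mulrCA mulVf ?gt_eqF// mulr1.
rewrite -addeA -[leRHS]addeA leeD2l// (le_trans (leeD shift slope))//.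
rewrite mulr_natl mulr2n EFinD ge0_muleDl ?lee_fin//.
by rewrite addeAC.
Qed.

End add_bounded.

End lorentz.

(** * Positive operators bounded on [L^1] and on [L^oo] *)

Section layers.
Context {R : realType}.
Implicit Types (y : \bar R) (t r : R).

Definition level (n l : nat) : R := l.+1%:R / 2 ^+ n.

(* [layer n] increases to the identity, and it is a combination of indicators of
   upper level sets. *)
Definition layer (n : nat) y : R :=
  \sum_(l < n * 2 ^ n) (2 ^- n) * ((level n l)%:E < y)%E%:R.

Lemma level_gt0 n l : 0 < level n l.
Proof. by rewrite divr_gt0// exprn_gt0. Qed.

Lemma count_below_le t M : 0 <= t -> \sum_(l < M) ((l.+1%:R < t)%R%:R : R) <= t.
Proof.
move=> t0; elim: M => [|M IH]; first by rewrite big_ord0.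
have [tM|Mt] := leP t M.+1%:R.
  by rewrite big_ord_recr/= ltNge tM/= addr0.
apply: (le_trans _ (ltW Mt)).
have -> : M.+1%:R = \sum_(l < M.+1) (1 : R) by rewrite sumr_const card_ord.
by apply: ler_sum => l _; case: (_ < _); rewrite /= ?ler01 ?lexx.
Qed.

Lemma count_below_ge t M :
  Num.min M%:R (t - 1) <= \sum_(l < M) ((l.+1%:R < t)%R%:R : R).
Proof.
elim: M => [|M IH]; first by rewrite big_ord0 ge_min lexx.
have [tM|Mt] := leP t M.+1%:R; rewrite big_ord_recr/=.
  rewrite ltNge tM/= addr0 (le_trans _ IH)// le_min !ge_min lexx orbT andbT.
  by rewrite lerBlDr -natr1 in tM *; rewrite tM orbT.
rewrite Mt/= -natr1 ge_min; apply/orP; left; rewrite lerD2r (le_trans _ IH)//.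
by rewrite le_min lexx/= lerBrDr natr1 ltW.
Qed.

Lemma layerE n r : layer n r%:E =
  2 ^- n * \sum_(l < n * 2 ^ n) ((l.+1%:R < r * 2 ^+ n)%R%:R : R).
Proof.
rewrite /layer -mulr_sumr; congr (_ * _); apply: eq_bigr => l _.
by rewrite lte_fin /level ltr_pdivrMr// exprn_gt0.
Qed.

Lemma layer_ge0 n y : 0 <= layer n y.
Proof. by rewrite /layer sumr_ge0// => l _; rewrite mulr_ge0// invr_ge0 exprn_ge0. Qed.

Lemma layer_nd y : nondecreasing_seq (layer^~ y).
Proof.
apply/nondecreasing_seqP => n; rewrite /layer.
have sum_pairs (F : nat -> R) M :
    \sum_(l < M * 2) F l = \sum_(l < M) (F (l * 2)%N + F (l * 2).+1).
  elim: M => [|M IH]; first by rewrite !big_ord0.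
  by rewrite mulSn addSn add1n !big_ord_recr/= IH -addrA.
pose F l : R := 2 ^- n.+1 * ((level n.+1 l)%:E < y)%E%:R.
rewrite -(big_mkord xpredT F) (big_cat_nat _ (n := n * 2 ^ n * 2))//=; last first.
  by rewrite -mulnA -expnSr leq_mul.
rewrite ler_wpDr//.
  by apply: sumr_ge0 => l _; rewrite mulr_ge0// invr_ge0 exprn_ge0.
rewrite big_mkord sum_pairs; apply: ler_sum => l _.
have level_odd : level n.+1 (l * 2).+1 = level n l.
  by rewrite /level exprSr -[(l * 2).+2]/(l.+1 * 2)%N natrM -mulf_div divff// mulr1.
have level_even : level n.+1 (l * 2) <= level n l.
  by rewrite -level_odd /level ler_pM2r ?invr_gt0 ?exprn_gt0// ler_nat.
rewrite /F level_odd; case: ltP => /= ly; last first.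
  by rewrite !mulr0 addr0 mulr_ge0// invr_ge0 exprn_ge0.
rewrite (le_lt_trans _ ly) ?lee_fin//= !mulr1 -mulr2n -[leRHS]mulr_natr.
by rewrite exprSr invfM -mulrA mulVf// mulr1.
Qed.

Lemma layer_le n y : (0 <= y)%E -> ((layer n y)%:E <= y)%E.
Proof.
case: y => [r| |]// r0; last by rewrite leey.
rewrite lee_fin in r0; rewrite lee_fin layerE ler_pdivrMl ?exprn_gt0// mulrC count_below_le//.
by rewrite mulr_ge0// exprn_ge0.
Qed.

Lemma layer_ge n r : r <= n%:R -> r - 2 ^- n <= layer n r%:E.
Proof.
move=> rn; rewrite layerE ler_pdivlMl ?exprn_gt0// (le_trans _ (count_below_ge _ _))//.
rewrite le_min mulrBr mulfV ?gt_eqF ?exprn_gt0// [_ * r]mulrC lexx andbT.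
by rewrite natrM natrX (@le_trans _ _ (r * 2 ^+ n))// ?gerBl// ler_pM2r ?exprn_gt0.
Qed.

Lemma layer_pinfty n : layer n +oo%E = n%:R.
Proof.
rewrite /layer (eq_bigr (fun=> 2 ^- n)); last by move=> l _; rewrite ltry mulr1.
by rewrite sumr_const card_ord -[LHS]mulr_natr natrM natrX mulrCA mulVf ?mulr1// gt_eqF ?exprn_gt0.
Qed.

Lemma layer_cvg y : (0 <= y)%E -> (layer n y)%:E @[n --> \oo] --> y.
Proof.
case: y => [r| |]// r0; last first.
  by under eq_fun do rewrite layer_pinfty; exact/cvgenyP.
apply: cvg_EFin; first exact: nearW.
apply: (@squeeze_cvgr _ _ _ _ (fun n => r - 2 ^- n) (cst r)).
- near=> n; rewrite -[X in _ && X]lee_fin layer_le// andbT layer_ge//.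
  near: n; exact: nbhs_infty_ger.
- rewrite -[X in _ --> X]subr0; apply: cvgB; first exact: cvg_cst.
  under eq_fun do rewrite -exprVn.
  by apply: cvg_expr; rewrite ger0_norm ?invr_ge0// invf_lt1// ltr1n.
- exact: cvg_cst.
Unshelve. all: by end_near. Qed.

End layers.

Section layer_fun.
Context d (X : measurableType d) (R : realType).
Local Open Scope ereal_scope.
Implicit Types h : X -> \bar R.

Definition level_set h n l := [set x | (level n l)%:E < h x].

Definition layer_fun h (n : nat) : X -> \bar R :=
  fun x => \sum_(l < n * 2 ^ n) (2 ^- n)%:E * (\1_(level_set h n l) x)%:E.

Lemma layer_funE h n x : layer_fun h n x = (layer n (h x))%:E.
Proof.
rewrite /layer_fun /layer -sumEFin; apply: eq_bigr => l _.
rewrite -EFinM; congr (_ * _)%:E; rewrite indicE; congr (nat_of_bool _)%:R.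
by apply/idP/idP; rewrite inE.
Qed.

Lemma layer_fun_ge0 h n x : 0 <= layer_fun h n x.
Proof. by rewrite layer_funE lee_fin layer_ge0. Qed.

Lemma layer_fun_nd h x : nondecreasing_seq (fun n => layer_fun h n x).
Proof. by move=> m n mn; rewrite !layer_funE lee_fin; exact: layer_nd. Qed.

Lemma layer_fun_le h n x : 0 <= h x -> layer_fun h n x <= h x.
Proof. by move=> h0; rewrite layer_funE; exact: layer_le. Qed.

Lemma layer_fun_cvg h x : 0 <= h x -> layer_fun h n x @[n --> \oo] --> h x.
Proof. by move=> h0; under eq_fun do rewrite layer_funE; exact: layer_cvg. Qed.

Lemma measurable_indic_level_set h n l : measurable_fun setT h ->
  measurable_fun setT (EFin \o \1_(level_set h n l) : X -> \bar R).
Proof.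
move=> mh; apply/measurable_EFinP/measurable_indic.
exact: measurable_superlevel.
Qed.

Lemma measurable_layer_fun h n : measurable_fun setT h ->
  measurable_fun setT (layer_fun h n).
Proof.
move=> mh; apply: emeasurable_sum => l; apply: measurable_funeM.
exact: measurable_indic_level_set.
Qed.

End layer_fun.

Section positive_operator.
Context d (X : measurableType d) (R : realType).
Local Open Scope ereal_scope.
Implicit Types (T S : (X -> \bar R) -> X -> \bar R) (u v : X -> \bar R).

Record positive_operator T : Prop := PositiveOperator {
  pop_ge0 : forall u, (forall x, 0 <= u x) -> forall x, 0 <= T u x ;
  pop_measurable : forall u, measurable_fun setT u -> measurable_fun setT (T u) ;
  pop_homo : forall u v, (forall x, u x <= v x) -> forall x, T u x <= T v x ;
  popD : forall u v, (forall x, 0 <= u x) -> (forall x, 0 <= v x) ->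
    forall x, T (u \+ v) x = T u x + T v x ;
  popZ : forall (c : R) u, (0 <= c)%R -> (forall x, 0 <= u x) ->
    forall x, T (fun y => c%:E * u y) x = c%:E * T u x ;
  pop_cvg : forall (u_ : (X -> \bar R)^nat) u, (forall n x, 0 <= u_ n x) ->
    (forall x, nondecreasing_seq (u_^~ x)) -> (forall x, u_ n x @[n --> \oo] --> u x) ->
    forall x, T (u_ n) x @[n --> \oo] --> T u x }.

Lemma positive_operator_id : positive_operator id.
Proof. by []. Qed.

Lemma positive_operator_comp S T : positive_operator S -> positive_operator T ->
  positive_operator (S \o T).
Proof.
move=> pS pT; split => /=.
- by move=> u u0; apply: pop_ge0 => //; exact: pop_ge0.
- by move=> u mmu; apply: pop_measurable => //; exact: pop_measurable.
- by move=> u v uv; apply: pop_homo => //; exact: pop_homo.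
- move=> u v u0 v0 x; rewrite -popD//; try exact: pop_ge0.
  by congr (S _ x); apply/funext => y; exact: popD.
- move=> c u c0 u0 x; rewrite -popZ//; last exact: pop_ge0.
  by congr (S _ x); apply/funext => y; exact: popZ.
- move=> u_ u u0 ndu uu; apply: pop_cvg => //.
  + by move=> n; exact: pop_ge0.
  + by move=> x m n mn; apply: pop_homo => // y; exact: ndu.
  + exact: pop_cvg.
Qed.

Lemma positive_operator_iter T n : positive_operator T -> positive_operator (iter n T).
Proof.
move=> pT; elim: n => [|n IH]; first exact: positive_operator_id.
exact: (positive_operator_comp pT IH).
Qed.

Lemma positive_operator_sum I (r : seq I) (T_ : I -> (X -> \bar R) -> X -> \bar R) :
  (forall i, positive_operator (T_ i)) ->
  positive_operator (fun u x => \sum_(i <- r) T_ i u x).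
Proof.
move=> pT; split.
- by move=> u u0 x; apply: sume_ge0 => i _; exact: pop_ge0.
- by move=> u mmu; apply: emeasurable_sum => i; exact: pop_measurable.
- by move=> u v uv x; apply: lee_sum => i _; exact: pop_homo.
- by move=> u v u0 v0 x; rewrite -big_split/=; apply: eq_bigr => i _; exact: popD.
- move=> c u c0 u0 x; rewrite ge0_sume_distrr; last by move=> i _; exact: pop_ge0.
  by apply: eq_bigr => i _; exact: popZ.
- move=> u_ u u0 ndu uu x; apply: cvg_nnesum => i _; last exact: pop_cvg.
  by apply: nearW => n; exact: pop_ge0.
Qed.

Lemma pop_lin_sum T M (c : R) (u : nat -> X -> \bar R) x : positive_operator T ->
  (0 <= c)%R -> (forall l x, 0 <= u l x) ->
  T (fun y => \sum_(l < M) c%:E * u l y) x = \sum_(l < M) c%:E * T (u l) x.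
Proof.
move=> pT c0 u0.
have cu0 l y : 0 <= c%:E * u l y by rewrite mule_ge0.
elim: M => [|M IH].
  rewrite big_ord0 -[RHS](mul0e (T (u 0%N) x)) -popZ//.
  by congr (T _ x); apply/funext => y; rewrite big_ord0 mul0e.
rewrite big_ord_recr/= -IH -popZ// -popD//; last by move=> y; exact: sume_ge0.
by congr (T _ x); apply/funext => y; rewrite big_ord_recr.
Qed.

Variable mu : {measure set X -> \bar R}.

Record bounded_operator (c : R) T : Prop := BoundedOperator {
  bop_const_ge0 : (0 <= c)%R ;
  bop_le : forall (b : R) u, (0 <= b)%R -> (forall x, u x <= b%:E) ->
    forall x, T u x <= (c * b)%:E ;
  bop_integral : forall u, measurable_fun setT u -> (forall x, 0 <= u x) ->
    \int[mu]_x T u x <= c%:E * \int[mu]_x u x }.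

Lemma bounded_operator_id : bounded_operator 1 id.
Proof. by split => // [b u b0 ub x|u _ _]; rewrite ?mul1r ?mul1e. Qed.

Lemma bounded_operator_comp a b S T : positive_operator T ->
  bounded_operator a S -> bounded_operator b T -> bounded_operator (a * b) (S \o T).
Proof.
move=> pT bS bT; have b0 := bop_const_ge0 bT; have a0 := bop_const_ge0 bS; split => /=.
- exact: mulr_ge0.
- move=> c u c0 uc x; rewrite -mulrA; apply: (bop_le bS); first exact: mulr_ge0.
  exact: bop_le.
- move=> u mmu u0; apply: (le_trans (bop_integral bS _ _)).
  + exact: pop_measurable.
  + exact: pop_ge0.
  + by rewrite EFinM -muleA lee_wpmul2l//; exact: bop_integral.
Qed.

Lemma bounded_operator_iter a T n : positive_operator T -> bounded_operator a T ->
  bounded_operator (a ^+ n) (iter n T).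
Proof.
move=> pT bT; elim: n => [|n IH]; first exact: bounded_operator_id.
by rewrite exprS; apply: (bounded_operator_comp _ bT IH); exact: positive_operator_iter.
Qed.

Lemma bounded_operator_sum I (r : seq I) (c : I -> R)
    (T_ : I -> (X -> \bar R) -> X -> \bar R) :
  (forall i, positive_operator (T_ i)) -> (forall i, bounded_operator (c i) (T_ i)) ->
  bounded_operator (\sum_(i <- r) c i) (fun u x => \sum_(i <- r) T_ i u x).
Proof.
move=> pT bT; have c0 i := bop_const_ge0 (bT i); split.
- by apply: sumr_ge0 => i _.
- move=> b u b0 ub x; rewrite mulr_suml -sumEFin; apply: lee_sum => i _.
  exact: bop_le.
- move=> u mmu u0; rewrite ge0_integral_sum//.
  + rewrite -sumEFin ge0_sume_distrl; last by move=> i _; rewrite lee_fin.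
    by apply: lee_sum => i _; exact: bop_integral.
  + by move=> i; exact: pop_measurable.
  + by move=> i x _; exact: pop_ge0.
Qed.

Lemma integral_pop_layer_fun_le T (c : R) u n : positive_operator T ->
  (forall A, measurable A -> \int[mu]_x T (EFin \o \1_A) x <= c%:E * mu A) ->
  measurable_fun setT u ->
  \int[mu]_x T (layer_fun u n) x <= c%:E * \int[mu]_x layer_fun u n x.
Proof.
move=> pT intT mmu.
have k0 : (0 <= (2 : R) ^- n)%R by rewrite invr_ge0 exprn_ge0.
have ind0 l x : 0 <= (\1_(level_set u n l) x)%:E :> \bar R by rewrite lee_fin.
have mind l := measurable_indic_level_set n l mmu.
have mT l : measurable_fun setT (T (EFin \o \1_(level_set u n l))) by exact: pop_measurable.
have T0 l x : 0 <= T (EFin \o \1_(level_set u n l)) x by apply: (pop_ge0 pT) => y; exact: ind0.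
under eq_integral => x _ do
  rewrite (pop_lin_sum _ (u := fun l => EFin \o \1_(level_set u n l)) _ pT)//.
rewrite ge0_integral_sum//; [|by move=> l; exact: measurable_funeM
  |by move=> l x _; rewrite mule_ge0].
rewrite /layer_fun ge0_integral_sum//; last first.
  by move=> l; apply: measurable_funeM; exact: mind.
rewrite ge0_sume_distrr; last first.
  by move=> l _; apply: integral_ge0 => x _; rewrite mule_ge0.
apply: lee_sum => l _; rewrite !ge0_integralZl//; last exact: mind.
have ml : measurable (level_set u n l) by exact: measurable_superlevel.
by rewrite muleCA lee_wpmul2l// integral_indic ?setIT//; exact: intT.
Qed.

Lemma integral_pop_le T (c : R) u : positive_operator T -> (0 <= c)%R ->
  (forall A, measurable A -> \int[mu]_x T (EFin \o \1_A) x <= c%:E * mu A) ->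
  measurable_fun setT u -> (forall x, 0 <= u x) ->
  \int[mu]_x T u x <= c%:E * \int[mu]_x u x.
Proof.
move=> pT c0 intT mmu u0.
have layer_le n : \int[mu]_x T (layer_fun u n) x <= c%:E * \int[mu]_x u x.
  apply: le_trans (integral_pop_layer_fun_le n pT intT mmu) _.
  rewrite lee_wpmul2l//; apply: ge0_le_integral => //.
  - by move=> x _; exact: layer_fun_ge0.
  - exact: measurable_layer_fun.
  - by move=> x _; exact: layer_fun_le.
have nd x : nondecreasing_seq (fun n => T (layer_fun u n) x).
  by move=> m n mn; apply: pop_homo => // y; exact: layer_fun_nd.
rewrite (_ : \int[mu]_x T u x = \int[mu]_x limn (fun n => T (layer_fun u n) x)); last first.
  apply: eq_integral => x _; apply/esym/cvg_lim => //; apply: pop_cvg => //.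
  - exact: layer_fun_ge0.
  - exact: layer_fun_nd.
  - by move=> y; exact: layer_fun_cvg.
have T0 n x : 0 <= T (layer_fun u n) x by apply: pop_ge0 => //; exact: layer_fun_ge0.
have mT n : measurable_fun setT (T (layer_fun u n)).
  by apply: pop_measurable => //; exact: measurable_layer_fun.
rewrite monotone_convergence//; apply: lime_le; last exact: nearW.
apply: ereal_nondecreasing_is_cvgn => m n mn.
by apply: ge0_le_integral => // x _; exact: nd.
Qed.

End positive_operator.

Section lorentz_interpolation.
Context d (X : measurableType d) (R : realType).
Variable mu : {sigma_finite_measure set X -> \bar R}.
Variables (phi : \bar R -> \bar R) (qphi : quasiconcave phi).
Variables (T : (X -> \bar R) -> X -> \bar R) (c : R).
Hypotheses (pT : positive_operator T) (bT : bounded_operator mu c T).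
Local Open Scope ereal_scope.
Local Notation lorentz := (lorentz mu phi).

Let c0 : (0 <= c)%R. Proof. exact: bop_const_ge0 bT. Qed.

Let indic_ge0 (A : set X) x : 0 <= (EFin \o \1_A) x :> \bar R.
Proof. by rewrite lee_fin. Qed.

Lemma lorentzD_indic_le H (b : R) (A : set X) : measurable_fun setT H ->
  (0 <= b)%R -> measurable A -> mu A \is a fin_num ->
  lorentz (fun x => H x + b%:E * T (EFin \o \1_A) x) <=
  lorentz H + (2 * c)%:E * (b%:E * phi (mu A)).
Proof.
move=> mH b0 mA muA.
have mind : measurable_fun setT (EFin \o \1_A : X -> \bar R).
  exact/measurable_EFinP/measurable_indic.
have mT : measurable_fun setT (T (EFin \o \1_A)) by exact: pop_measurable.
have T0 x : 0 <= T (EFin \o \1_A) x by exact: pop_ge0.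
have TA x : b%:E * T (EFin \o \1_A) x <= (b * c)%:E.
  rewrite EFinM lee_wpmul2l// -[c]mulr1; apply: (bop_le bT) => // y.
  by rewrite lee_fin indicE; case: (_ \in _).
have intA : \int[mu]_x (b%:E * T (EFin \o \1_A) x) <= (b * c * fine (mu A))%:E.
  rewrite ge0_integralZl// -mulrA EFinM lee_wpmul2l//.
  rewrite (le_trans (bop_integral bT mind _))//.
  by rewrite integral_indic// setIT EFinM fineK.
apply: le_trans (lorentzD_le qphi mH _ _ _ _ TA intA) _.
- exact: measurable_funeM.
- by move=> x; rewrite mule_ge0.
- exact: mulr_ge0.
- exact: fine_ge0.
by rewrite fineK// mulrCA [(b * _)%R]mulrC EFinM -muleA.
Qed.

Variables (h H : X -> \bar R).
Hypotheses (mh : measurable_fun setT h) (mH : measurable_fun setT H).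
Hypotheses (h0 : forall x, 0 <= h x) (H0 : forall x, 0 <= H x).

Lemma lorentzD_level_sets_le n M : lorentz h < +oo ->
  lorentz (fun x => H x +
    \sum_(l < M) (2 ^- n)%:E * T (EFin \o \1_(level_set h n l)) x) <=
  lorentz H + (2 * c)%:E * \sum_(l < M) (2 ^- n)%:E * phi (mu (level_set h n l)).
Proof.
move=> hfin; have k0 : (0 <= (2 : R) ^- n)%R by rewrite invr_ge0 exprn_ge0.
elim: M => [|M IH].
  by under eq_fun do rewrite big_ord0 adde0; rewrite big_ord0 mule0 adde0.
under eq_fun do rewrite big_ord_recr/= addeA.
rewrite big_ord_recr/= ge0_muleDr; first last.
- by rewrite mule_ge0// qc_ge0.
- by apply: sume_ge0 => l _; rewrite mule_ge0// qc_ge0.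
rewrite addeA; apply: le_trans (leeD2r _ IH).
apply: lorentzD_indic_le => //.
- apply: emeasurable_funD => //; apply: emeasurable_sum => l; apply: measurable_funeM.
  by apply: pop_measurable => //; exact: measurable_indic_level_set.
- exact: measurable_superlevel.
- exact: (lorentz_superlevel_fin qphi mh hfin (level_gt0 _ _)).
Qed.

Lemma lorentzD_operator_le : lorentz h < +oo ->
  lorentz (fun x => H x + T h x) <= lorentz H + (2 * c)%:E * lorentz h.
Proof.
move=> hfin.
apply: (lorentz_lim_le qphi (u := fun n x => H x + T (layer_fun h n) x)).
- move=> n; apply: emeasurable_funD => //; apply: pop_measurable => //.
  exact: measurable_layer_fun.
- by move=> x m n mn; rewrite leeD2l// pop_homo// => y; exact: layer_fun_nd.
- move=> x; apply: cvgeD; [|exact: cvg_cst|].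
    by have Th0 := pop_ge0 pT h0 x; rewrite ge0_adde_def// inE.
  apply: pop_cvg => //; [exact: layer_fun_ge0|exact: layer_fun_nd|].
  by move=> y; exact: layer_fun_cvg.
move=> n; under eq_fun do
  rewrite (pop_lin_sum _ (u := fun l => EFin \o \1_(level_set h n l)) _ pT) ?invr_ge0 ?exprn_ge0//.
apply: le_trans (lorentzD_level_sets_le _ _ hfin) _.
rewrite leeD2l// lee_wpmul2l ?lee_fin ?mulr_ge0//.
have phi0 s : 0 <= phi (mu [set x | s%:E < h x]) by rewrite qc_ge0.
apply: (nonincreasing_lower_sum_le _ phi0); last by rewrite invr_gt0 exprn_gt0.
by move=> s t st; apply: qc_homo => //; exact: distribution_nincr.
Qed.

End lorentz_interpolation.

Section operator_series.
Context d (X : measurableType d) (R : realType).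
Variable mu : {sigma_finite_measure set X -> \bar R}.
Variables (T : (X -> \bar R) -> X -> \bar R) (alpha : R).
Hypotheses (pT : positive_operator T) (bT : bounded_operator mu alpha T).
Local Open Scope ereal_scope.
Implicit Types u h H : X -> \bar R.

Definition operator_tail j u : X -> \bar R := fun x => \sum_(j <= i <oo) iter i T u x.

Let alpha0 : (0 <= alpha)%R. Proof. exact: bop_const_ge0 bT. Qed.

Lemma iter_pop_ge0 i u : (forall x, 0 <= u x) -> forall x, 0 <= iter i T u x.
Proof. by apply: pop_ge0; exact: positive_operator_iter. Qed.

Lemma operator_tail_cvg j u x : (forall x, 0 <= u x) ->
  (fun m => \sum_(j <= i < m) iter i T u x) @ \oo --> operator_tail j u x.
Proof. by move=> u0; apply: is_cvg_nneseries => i _ _; exact: iter_pop_ge0. Qed.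

Let measurable_partial_sum j m u : measurable_fun setT u ->
  measurable_fun setT (fun x => \sum_(j <= i < m) iter i T u x).
Proof.
move=> mmu; apply: emeasurable_sum => i.
by apply: pop_measurable => //; exact: positive_operator_iter.
Qed.

Lemma measurable_operator_tail j u : measurable_fun setT u -> (forall x, 0 <= u x) ->
  measurable_fun setT (operator_tail j u).
Proof.
move=> mmu u0; apply: emeasurable_fun_cvg (fun m => measurable_partial_sum j m mmu) _.
by move=> x _; exact: operator_tail_cvg.
Qed.

Lemma geometric_sum_le j m : (alpha < 1)%R ->
  (\sum_(j <= i < m) alpha ^+ i <= alpha ^+ j / (1 - alpha))%R.
Proof.
move=> a1; have b0 : (0 < 1 - alpha)%R by rewrite subr_gt0.
have [/ltnW mj|jm] := ltnP m j.
  by rewrite big_geq// divr_ge0 ?exprn_ge0// ltW.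
rewrite -(subnKC jm) geometric_partial_tail geometric_seriesE ?lt_eqF//=.
by rewrite ler_pM2r ?invr_gt0// ler_piMr ?exprn_ge0// gerBl exprn_ge0.
Qed.

Variables (phi : \bar R -> \bar R) (qphi : quasiconcave phi).
Local Notation lorentz := (lorentz mu phi).

Lemma lorentzD_operator_tail_le j h H : (alpha < 1)%R ->
  measurable_fun setT h -> measurable_fun setT H ->
  (forall x, 0 <= h x) -> (forall x, 0 <= H x) -> lorentz h < +oo ->
  lorentz (fun x => H x + operator_tail j h x) <=
  lorentz H + (2 * (alpha ^+ j / (1 - alpha)))%:E * lorentz h.
Proof.
move=> a1 mh mH h0 H0 hfin.
apply: (lorentz_lim_le qphi (u := fun m x => H x + \sum_(j <= i < m) iter i T h x)).
- by move=> m; apply: emeasurable_funD => //; exact: measurable_partial_sum.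
- move=> x p q pq; rewrite leeD2l//.
  by apply: lee_sum_nneg_natr => // i _ _; exact: iter_pop_ge0.
- move=> x; apply: cvgeD; [|exact: cvg_cst|exact: operator_tail_cvg].
  by rewrite ge0_adde_def// inE//; apply: nneseries_ge0 => i _ _; exact: iter_pop_ge0.
move=> m.
have pI i : positive_operator (iter i T) by exact: positive_operator_iter.
have bI i : bounded_operator mu (alpha ^+ i) (iter i T) by exact: bounded_operator_iter.
apply: le_trans (lorentzD_operator_le qphi (positive_operator_sum (index_iota j m) pI)
  (bounded_operator_sum (index_iota j m) pI bI) mh mH h0 H0 hfin) _.
rewrite leeD2l// lee_wpmul2r ?lorentz_ge0// lee_fin ler_pM2l//.
exact: geometric_sum_le.
Qed.

Let one_add_geometric_le : (alpha < 1 / 2)%R ->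
  (1 + 2 * (alpha / (1 - alpha)) <= (1 - 2 * alpha)^-1)%R.
Proof.
move=> ahalf; have a0 := alpha0.
have b1 : (0 < 1 - alpha)%R by lra.
have b2 : (0 < 1 - 2 * alpha)%R by lra.
rewrite -subr_ge0.
have -> : ((1 - 2 * alpha)^-1 - (1 + 2 * (alpha / (1 - alpha))) =
    (2 * alpha ^+ 2) / ((1 - 2 * alpha) * (1 - alpha)))%R.
  by field; rewrite !gt_eqF.
by rewrite divr_ge0 ?mulr_ge0 ?sqr_ge0// ltW.
Qed.

Let two_mul_geometric_le j : (alpha < 1 / 2)%R ->
  (2 * (alpha ^+ j.+1 / (1 - alpha)) <= (2 * alpha) ^+ j.+1 / (1 - 2 * alpha))%R.
Proof.
move=> ahalf; have a0 := alpha0.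
have b1 : (0 < 1 - alpha)%R by lra.
have b2 : (0 < 1 - 2 * alpha)%R by lra.
have aj : (0 <= alpha ^+ j.+1)%R by rewrite exprn_ge0.
have two : (2 <= 2 ^+ j.+1 :> R)%R by rewrite exprS ler_peMr// exprn_ege1// ler1n.
rewrite mulrA exprMn; apply: ler_pM; rewrite ?invr_ge0 ?mulr_ge0//; first exact: ltW.
  by rewrite ler_wpM2r.
by rewrite lef_pV2 ?posrE// lerD2l lerN2 ler_peMl// ler1n.
Qed.

(* For [j = 0] the summand [h] is treated as the unperturbed function [H]: otherwise the
   factor [2] of [lorentzD_operator_tail_le] would also hit the first term of the series. *)
Lemma lorentz_operator_tail_le j h : (alpha < 1 / 2)%R -> measurable_fun setT h ->
  (forall x, 0 <= h x) -> lorentz h < +oo ->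
  lorentz (operator_tail j h) <= ((2 * alpha) ^+ j / (1 - 2 * alpha))%:E * lorentz h.
Proof.
move=> ahalf mh h0 hfin; have a0 := alpha0; have a1 : (alpha < 1)%R by lra.
have hL : 0 <= lorentz h by exact: lorentz_ge0.
case: j => [|j].
  have -> : operator_tail 0 h = fun x => h x + operator_tail 1 h x.
    apply/funext => x; rewrite /operator_tail (nneseries_split _ 1); last first.
      by move=> i _; exact: iter_pop_ge0.
    by rewrite big_nat1.
  rewrite (le_trans (lorentzD_operator_tail_le 1 a1 mh mh h0 h0 hfin))//.
  rewrite -{1}[lorentz h]mul1e -ge0_muleDl ?lee_fin//; last first.
    by rewrite mulr_ge0// divr_ge0 ?exprn_ge0// subr_ge0 ltW.
  rewrite lee_wpmul2r// lee_fin expr0 expr1 div1r.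
  exact: one_add_geometric_le.
have -> : operator_tail j.+1 h = fun x => cst 0 x + operator_tail j.+1 h x.
  by apply/funext => x; rewrite add0e.
rewrite (le_trans (lorentzD_operator_tail_le j.+1 a1 mh (measurable_cst 0) h0 _ hfin))//.
rewrite lorentz0// add0e lee_wpmul2r// lee_fin.
exact: two_mul_geometric_le.
Qed.

End operator_series.

Section transfer.
Context d (X : measurableType d) (R : realType).
Variable mu : {measure set X -> \bar R}.
Local Open Scope ereal_scope.
Variables (N : nat) (weight : 'I_N -> X -> R) (f : 'I_N -> X -> X) (alpha : R).
Hypotheses (mweight : forall n, measurable_fun setT (weight n)).
Hypotheses (mf : forall n, measurable_fun setT (f n)).
Hypothesis weight0 : forall n x, (0 <= weight n x)%R.
Implicit Types u : X -> \bar R.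

Definition transfer u : X -> \bar R := fun x => \sum_n (weight n x)%:E * u (f n x).

Lemma positive_operator_transfer : positive_operator transfer.
Proof.
apply: positive_operator_sum => n; split.
- by move=> u u0 x; rewrite mule_ge0// lee_fin.
- move=> u mmu; apply: emeasurable_funM; first exact/measurable_EFinP.
  exact: measurableT_comp.
- by move=> u v uv x; rewrite lee_wpmul2l// lee_fin.
- by move=> u v u0 v0 x; rewrite ge0_muleDr.
- by move=> c u c0 u0 x; rewrite muleCA.
- by move=> u_ u _ _ uu x; exact: cvgeZl.
Qed.

Lemma bounded_operator_transfer : (0 <= alpha)%R ->
  (forall x, (\sum_n weight n x <= alpha)%R) ->
  (forall A, measurable A ->
    \int[mu]_x (\sum_n (weight n x)%:E * (\1_A (f n x))%:E) <= alpha%:E * mu A) ->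
  bounded_operator mu alpha transfer.
Proof.
move=> alpha0 sum_weight int_weight; split => //.
- move=> c u c0 uc x; apply: (@le_trans _ _ (\sum_n (weight n x)%:E * c%:E)).
    by apply: lee_sum => n _; rewrite lee_wpmul2l// lee_fin.
  under eq_bigr do rewrite -EFinM.
  by rewrite sumEFin lee_fin -mulr_suml ler_wpM2r.
- by move=> u; apply: integral_pop_le => //; exact: positive_operator_transfer.
Qed.

End transfer.

(** * Scalars, norms and countable bases *)

Section scalars.
Context {R : realType} {b : bool}.
Local Notation KK := (Kof R b).
Implicit Types (z w : KK) (r s : R).

Definition RtoK (r : R) : Kof R b :=
  match b return Kof R b with true => (r%:C)%C | false => r end.

Lemma RtoKK z : 0 <= z -> RtoK (KtoR z) = z.
Proof.
rewrite /RtoK /KtoR; move: z; rewrite /Kof; case: b => //= z.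
by move=> z0; apply: RRe_real; exact: ger0_real.
Qed.

Lemma KtoRK r : KtoR (RtoK r) = r.
Proof. by rewrite /RtoK /KtoR; case: b. Qed.

Lemma ler_RtoK r s : (RtoK r <= RtoK s) = (r <= s).
Proof. by rewrite /RtoK; case: b => //; rewrite lecR. Qed.

Lemma ltr_RtoK r s : (RtoK r < RtoK s) = (r < s).
Proof. by rewrite /RtoK; case: b => //; rewrite ltcR. Qed.

Lemma RtoK0 : RtoK 0 = 0.
Proof. by rewrite /RtoK; case: b. Qed.

Lemma RtoKD r s : RtoK (r + s) = RtoK r + RtoK s.
Proof. by rewrite /RtoK; case: b => //; rewrite rmorphD. Qed.

Lemma RtoKM r s : RtoK (r * s) = RtoK r * RtoK s.
Proof. by rewrite /RtoK; case: b => //; rewrite rmorphM. Qed.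

Lemma RtoK_gt0 r : 0 < r -> 0 < RtoK r.
Proof. by move=> r0; rewrite -RtoK0 ltr_RtoK. Qed.

Lemma gt0_RtoK z : 0 < z -> exists2 r : R, 0 < r & z = RtoK r.
Proof.
move=> z0; exists (KtoR z); last by rewrite RtoKK// ltW.
by rewrite -ltr_RtoK RtoKK ?ltW// RtoK0.
Qed.

Lemma KnormE z : `|z| = RtoK (Knorm z).
Proof. by rewrite /Knorm RtoKK. Qed.

Lemma Knorm_ge0 z : 0 <= Knorm z.
Proof. by rewrite -ler_RtoK -KnormE RtoK0. Qed.

Variable V : normedModType KK.
Implicit Types u v : V.

Lemma VnormE v : `|v| = RtoK (Vnorm v).
Proof. by rewrite /Vnorm RtoKK. Qed.

Lemma Vnorm_ge0 v : 0 <= Vnorm v.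
Proof. by rewrite -ler_RtoK -VnormE RtoK0. Qed.

Lemma VnormD u v : Vnorm (u + v) <= Vnorm u + Vnorm v.
Proof. by rewrite -ler_RtoK RtoKD -!VnormE ler_normD. Qed.

Lemma VnormZ z v : Vnorm (z *: v) = Knorm z * Vnorm v.
Proof. by rewrite -[LHS]KtoRK -VnormE normrZ VnormE KnormE -RtoKM KtoRK. Qed.

Lemma VnormN v : Vnorm (- v) = Vnorm v.
Proof. by rewrite /Vnorm normrN. Qed.

Lemma Vnorm0 : Vnorm (0 : V) = 0.
Proof. by rewrite -[LHS]KtoRK -VnormE normr0 -RtoK0 KtoRK. Qed.

Lemma Vnorm_sum I (s : seq I) (P : pred I) (F : I -> V) :
  Vnorm (\sum_(i <- s | P i) F i) <= \sum_(i <- s | P i) Vnorm (F i).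
Proof.
elim/big_ind2: _ => [|u1 r1 u2 r2 h1 h2|//]; first by rewrite Vnorm0.
by rewrite (le_trans (VnormD _ _))// lerD.
Qed.

Lemma Vnorm_distC u v : Vnorm (u - v) = Vnorm (v - u).
Proof. by rewrite -opprB VnormN. Qed.

Lemma Vnorm_distD v' u v : Vnorm (u - v) <= Vnorm (u - v') + Vnorm (v' - v).
Proof. by rewrite -[u - v](subrKA v'); exact: VnormD. Qed.

Lemma Vnorm_dist u v : `|Vnorm u - Vnorm v| <= Vnorm (u - v).
Proof.
have uv := VnormD (u - v) v; have vu := VnormD (v - u) u.
rewrite !subrK (Vnorm_distC v) in uv vu.
by rewrite ler_norml; apply/andP; split; lra.
Qed.

Lemma Vnorm_cvgP (F : nat -> V) v : (F @ \oo --> v) <->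
  (forall r : R, 0 < r -> \forall n \near \oo, Vnorm (v - F n) < r).
Proof.
split=> [/cvgrPdist_lt h r /RtoK_gt0/h|h].
  by apply: filterS => n; rewrite VnormE ltr_RtoK.
apply/cvgrPdist_lt => e /gt0_RtoK[r r0 ->]; have := h r r0.
by apply: filterS => n; rewrite VnormE ltr_RtoK.
Qed.

Definition Vball v r : set V := [set w | Vnorm (w - v) < r].

Lemma VballE v r : Vball v r = ball v (RtoK r).
Proof.
by rewrite -ball_normE; apply/seteqP; split => w; rewrite /Vball/= distrC VnormE ltr_RtoK.
Qed.

Lemma open_Vball v r : 0 < r -> open (Vball v r).
Proof. by move=> r0; rewrite VballE; apply: ball_open; exact: RtoK_gt0. Qed.

Lemma open_subVball (U : set V) v : open U -> U v -> exists2 r : R, 0 < r & Vball v r `<=` U.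
Proof.
move=> oU Uv.
have /nbhs_ballP[e /= /gt0_RtoK[r r0 ->] eU] := open_nbhs_nbhs (conj oU Uv).
by exists r; rewrite ?VballE.
Qed.

Lemma Vnorm_continuous : continuous (@Vnorm R b V).
Proof.
move=> v; apply/cvgrPdist_lt => r r0.
apply/nbhs_ballP; exists (RtoK r); first exact: RtoK_gt0.
by rewrite -VballE => w; rewrite /Vball/= Vnorm_distC; exact: le_lt_trans (Vnorm_dist _ _).
Qed.

End scalars.

Section countable_bases.
Context {R : realType}.

Definition is_base (T : topologicalType) (I : Type) (B : I -> set T) :=
  (forall i, open (B i)) /\
  forall (U : set T) x, open U -> U x -> exists2 i, B i x & B i `<=` U.

Lemma is_base_setX (S T : topologicalType) (I J : Type) (B : I -> set S) (C : J -> set T) :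
  is_base B -> is_base C -> is_base (fun ij : I * J => B ij.1 `*` C ij.2).
Proof.
move=> [oB bB] [oC bC]; split => [ij|U [x y] oU Uxy].
  rewrite openE => -[x y] [/= Bx Cy]; exists (B ij.1, C ij.2) => //=.
  by split; apply: open_nbhs_nbhs.
have [[P Q] /= [nP nQ] PQU] : nbhs (x, y) U by apply: open_nbhs_nbhs; split.
have [i Bi BiP] := bB _ x (@open_interior _ P) nP.
have [j Cj CjQ] := bC _ y (@open_interior _ Q) nQ.
exists (i, j) => //= -[u v] [/= Bu Cv]; apply: PQU; split => /=.
  exact: interior_subset (BiP _ Bu).
exact: interior_subset (CjQ _ Cv).
Qed.

Lemma is_base_measurable d (X : measurableType d) (T : topologicalType) (I : countType)
    (B : I -> set T) (D : set X) (h : X -> T) (U : set T) :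
  is_base B -> (forall i, measurable (D `&` h @^-1` B i)) -> open U ->
  measurable (D `&` h @^-1` U).
Proof.
move=> [oB bB] mB oU.
rewrite (_ : _ `&` _ = \bigcup_i (if `[< B i `<=` U >] then D `&` h @^-1` B i else set0)).
  apply: countable_bigcupT_measurable; first exact: countableP.
  by move=> i; case: asboolP => // _; exact: measurable0.
apply/seteqP; split => x; last first.
  by move=> [i _]; case: asboolP => // BU [Dx /BU].
by move=> [Dx Ux]; have [i Bx BU] := bB U _ oU Ux; exists i => //; case: asboolP.
Qed.

Lemma is_base_dense_subset (T : topologicalType) (I : Type) (B : I -> set T) (P : set T) :
  is_base B -> P !=set0 ->
  exists p : I -> T, (forall i, P (p i)) /\ P `<=` closure (range p).
Proof.
move=> [oB bB] [z Pz].
have /choice[p pP] i : exists y, P y /\ (P `&` B i !=set0 -> B i y).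
  by have [[y [Py By]]|PB0] := pselect (P `&` B i !=set0); [exists y|exists z].
exists p; split=> [i|x Px U /= nU]; first by have [] := pP i.
have [i Bx BU] := bB _ x (@open_interior _ U) nU.
have [_ /(_ (ex_intro _ x (conj Px Bx))) Bp] := pP i.
by exists (p i); split; [exists i|exact: interior_subset (BU _ Bp)].
Qed.

Definition dense_family (b : bool) (V : normedModType (Kof R b)) (I : Type) (p : I -> V) :=
  forall v (r : R), 0 < r -> exists i, Vnorm (v - p i) < r.

Lemma Vball_is_base (b : bool) (V : normedModType (Kof R b)) (I : Type) (p : I -> V) :
  dense_family p -> is_base (fun i : I * nat => Vball (p i.1) (i.2.+1%:R^-1 : R)).
Proof.
move=> dp; split => [i|U x oU Ux]; first by apply: open_Vball; rewrite invr_gt0.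
have [r r0 rU] := open_subVball oU Ux.
have /ltr_add_invr[n] : 0 < r / 2 by rewrite divr_gt0.
rewrite add0r => nr; have n0 : 0 < n.+1%:R^-1 :> R by rewrite invr_gt0.
have [i xi] := dp x _ n0; exists (i, n) => // y yi; apply: rU.
rewrite /Vball/= (le_lt_trans (Vnorm_distD (p i) _ _))// [ltRHS]splitr.
by rewrite ltrD ?(lt_trans yi)// Vnorm_distC (lt_trans xi).
Qed.

Lemma separable_dense_family (b : bool) (V : normedModType (Kof R b)) :
  separable_space V -> exists p : nat -> V, dense_family p.
Proof.
move=> [D [/countable_injP[f finj] dD]].
have /choice[p pP] n : exists v, (exists d, D d /\ f d = n) -> D v /\ f v = n.
  have [[d Dd]|nD] := pselect (exists d, D d /\ f d = n); first by exists d.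
  by exists 0.
exists p => v r r0.
have [|d [dv Dd]] := dD (Vball v r) _ (open_Vball v r0).
  by exists v; rewrite /Vball/= subrr Vnorm0.
have [Dp fp] := pP (f d) (ex_intro _ d (conj Dd erefl)).
by exists (f d); rewrite (finj _ _ _ _ fp) ?inE// Vnorm_distC.
Qed.

Lemma rat_approx (x e : R) : 0 < e -> exists q : rat, `|x - ratr q| < e.
Proof.
move=> e0; have /rat_in_itvoo[q] : x - e < x + e by rewrite ltrBlDr -addrA ltrDl addr_gt0.
by rewrite in_itv/= => /andP[qx xq]; exists q; rewrite distrC ltr_distl qx.
Qed.

Lemma mx_rat_approx m n (A : 'M[R]_(m, n)) (e : R) : 0 < e ->
  exists Q : 'M[rat]_(m, n), forall i j, `|(A - map_mx ratr Q) i j| < e.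
Proof.
move=> e0; have /choice[q qP] ij : exists q : rat, `|A ij.1 ij.2 - ratr q| < e.
  exact: rat_approx.
by exists (\matrix_(i, j) q (i, j)) => i j; rewrite !mxE; exact: (qP (i, j)).
Qed.

Definition ratK (b : bool) (p : rat * rat) : Kof R b :=
  match b return Kof R b with
  | true => (ratr p.1 +i* ratr p.2)%C | false => ratr p.1 end.

Lemma normc_le_ReIm (x y : R) : complex.Re `|(x +i* y)%C| <= `|x| + `|y|.
Proof.
rewrite normc_def/= -[leRHS]ger0_norm ?addr_ge0// -sqrtr_sqr ler_wsqrtr//.
by rewrite sqrrD !real_normK ?num_real// lerD2r lerDl mulrn_wge0 ?mulr_ge0.
Qed.

Lemma ratK_dense (b : bool) : dense_family (ratK b : _ -> (Kof R b)^o).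
Proof.
move=> z r r0; have r20 : 0 < r / 2 by rewrite divr_gt0.
rewrite /Vnorm /KtoR /ratK; move: z; rewrite /Kof; case: b => /= z; last first.
  by have [q qz] := rat_approx z r0; exists (q, 0).
case: z => x y; have [p px] := rat_approx x r20; have [q qy] := rat_approx y r20.
exists (p, q); apply: le_lt_trans (normc_le_ReIm _ _) _.
by rewrite [ltRHS]splitr ltrD.
Qed.

End countable_bases.

(** * Lebesgue outer measure *)

Section lebesgue_outer.
Context {R : realType} {k : nat}.
Local Notation Rk := 'rV[R]_k.+1.
Local Open Scope ereal_scope.
Implicit Types (a b x : Rk) (A B : set Rk).

Definition leb : set Rk -> \bar R := @lebo R k.+1.

Lemma box_vol_ge0 a b : (0 <= box_vol a b)%R.
Proof. by apply: prodr_ge0 => i _; rewrite le_max lexx orbT. Qed.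

Lemma box_vol_diag a : box_vol a a = 0%R.
Proof. by rewrite /box_vol big_ord_recl subrr maxxx mul0r. Qed.

Lemma box_volE a b : (forall i, a 0%R i <= b 0%R i)%R ->
  box_vol a b = (\prod_i (b 0 i - a 0 i))%R.
Proof. by move=> ab; apply: eq_bigr => i _; rewrite max_l// subr_ge0. Qed.

Lemma box_le a b x : box a b x -> forall i, (a 0%R i <= b 0%R i)%R.
Proof. by move=> abx i; have /andP[] := abx i; exact: le_trans. Qed.

Lemma leb_cover_le A (a b : nat -> Rk) : A `<=` \bigcup_n box (a n) (b n) ->
  leb A <= \sum_(n <oo) (box_vol (a n) (b n))%:E.
Proof. by move=> Aab; apply: ereal_inf_lbound; exists a, b. Qed.

Lemma leb_ge0 A : 0 <= leb A.
Proof.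
apply: le_ereal_inf_tmp => _ [a [b [_ ->]]]; apply: nneseries_ge0 => n _ _.
by rewrite lee_fin box_vol_ge0.
Qed.

Lemma leb0 : leb set0 = 0.
Proof.
apply/eqP; rewrite eq_le leb_ge0 andbT.
have /leb_cover_le/le_trans : set0 `<=` \bigcup_(n : nat) box (0%R : Rk) 0%R by [].
by apply; rewrite eseries0// => n _ _; rewrite box_vol_diag.
Qed.

Lemma le_leb : {homo leb : A B / A `<=` B >-> A <= B}.
Proof.
move=> A B AB; apply/ereal_inf_le_tmp => _ [a [b [Bab ->]]].
by exists a, b; split => //; exact: subset_trans Bab.
Qed.

Lemma leb_lt_cover A (e : R) : leb A < +oo -> (0 < e)%R ->
  exists ab : nat -> Rk * Rk, A `<=` \bigcup_n box (ab n).1 (ab n).2 /\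
    \sum_(n <oo) (box_vol (ab n).1 (ab n).2)%:E <= leb A + e%:E.
Proof.
move=> Afin e0; have fA : leb A \is a fin_num by rewrite ge0_fin_numE// leb_ge0.
have [_ [a [b [Aab ->]]] /ltW le] := lb_ereal_inf_adherent e0 fA.
by exists (fun n => (a n, b n)); split.
Qed.

Lemma leb_sigma_subadditive : sigma_subadditive leb.
Proof.
move=> A; have [[i ioo]|] := pselect (exists i, leb (A i) = +oo).
  rewrite (eseries_pinfty _ _ ioo) ?leey// => n _.
  by rewrite -ltNye (lt_le_trans _ (leb_ge0 _)).
rewrite -forallNE => Afin; apply/lee_addgt0Pr => e e0.
rewrite (le_trans _ (epsilon_trick _ _ (ltW e0)))//; last by move=> n; exact: leb_ge0.
have /choice[G PG] n : exists ab : nat -> Rk * Rk,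
    A n `<=` \bigcup_m box (ab m).1 (ab m).2 /\
    \sum_(m <oo) (box_vol (ab m).1 (ab m).2)%:E <= leb (A n) + (e / (2 ^ n.+1)%:R)%:E.
  apply: leb_lt_cover; first by rewrite ltey; exact/eqP.
  by rewrite divr_gt0// ltr0n expn_gt0.
pose v p := (box_vol (G p.1 p.2).1 (G p.1 p.2).2)%:E.
have v0 p : 0 <= v p by rewrite lee_fin box_vol_ge0.
have /card_esym/card_set_bijP[f fbij] := card_nat2.
apply: (@le_trans _ _ (\sum_(i <oo) v (f i))).
  apply: (@leb_cover_le _ (fun i => (G (f i).1 (f i).2).1) (fun i => (G (f i).1 (f i).2).2)).
  move=> x [n _ /(PG n).1[m _ xnm]].
  have [_ _ /(_ (n, m) Logic.I)[i _ fi]] := fbij.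
  by exists i => //; rewrite fi.
rewrite nneseries_esumT// -(reindex_esum setT setT f v)//.
have -> : [set: nat * nat] = [set: nat] `*`` (fun=> [set: nat]) by apply/seteqP; split.
rewrite -(@esum_esum _ _ _ _ _ (fun n m => v (n, m)))// -nneseries_esumT; last first.
  by move=> n; apply: esum_ge0.
apply: lee_nneseries => n _; first by move=> _; exact: esum_ge0.
by rewrite -nneseries_esumT//; exact: (PG n).2.
Qed.

HB.instance Definition _ := isOuterMeasure.Build R Rk leb
  leb0 leb_ge0 le_leb leb_sigma_subadditive.

Lemma leb_box_le a b : leb (box a b) <= (box_vol a b)%:E.
Proof.
pose pad (c : Rk) (n : nat) : Rk := if n is 0%N then c else 0%R.
apply: (@le_trans _ _ (\sum_(n <oo) (box_vol (pad a n) (pad b n))%:E)).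
  by apply: leb_cover_le => x abx; exists 0%N.
rewrite (nneseries_split _ 1); last by move=> n _; rewrite lee_fin box_vol_ge0.
rewrite big_nat1 eseries0 ?adde0//.
by move=> n n1 _; case: n n1 => // n _; rewrite box_vol_diag.
Qed.

Lemma leb_image_le A (F : Rk -> Rk) (c : R) : (0 < c)%R ->
  (forall a b, leb (F @` (A `&` box a b)) <= (c * box_vol a b)%:E) ->
  leb (F @` A) <= c%:E * leb A.
Proof.
move=> c0 Fbox.
have [Ay|] := eqVneq (leb A) +oo; first by rewrite Ay gt0_muley ?leey// lte_fin.
rewrite -ltey => Afin; apply/lee_addgt0Pr => e e0.
have [ab [Aab sumab]] := leb_lt_cover Afin (divr_gt0 e0 c0).
have -> : c%:E * leb A + e%:E = c%:E * (leb A + (e / c)%:E).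
  rewrite ge0_muleDr ?leb_ge0 ?lee_fin ?divr_ge0 ?(ltW e0) ?(ltW c0)//.
  by rewrite -EFinM mulrCA mulfV ?mulr1// gt_eqF.
apply: le_trans (lee_wpmul2l _ sumab); last by rewrite lee_fin ltW.
rewrite -nneseriesZl//; last by move=> n _; rewrite lee_fin box_vol_ge0.
apply: (@le_trans _ _ (leb (\bigcup_n (F @` (A `&` box (ab n).1 (ab n).2))))).
  by apply: le_leb => _ [x Ax <-]; have [n _ xn] := Aab _ Ax; exists n => //; exists x.
apply: le_trans (leb_sigma_subadditive _) _.
by apply: lee_nneseries => n _; [move=> _; exact: leb_ge0|rewrite -EFinM].
Qed.

Lemma leb_finite_cover (I : finType) (S : I -> set Rk) A (v : R) : A `<=` \bigcup_i S i ->
  (forall i, leb (S i) <= v%:E) -> leb A <= (#|I|%:R * v)%:E.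
Proof.
move=> AS Sv; rewrite mulr_natl -sumr_const -sumEFin.
apply: (@le_trans _ _ (\sum_(i : I) leb (S i))); last by apply: lee_sum => i _.
apply: (@le_trans _ _ (leb (\big[setU/set0]_(i : I) S i))).
  apply: le_leb => x /AS[i _ Six]; rewrite (bigD1 i)//; by left.
elim/big_rec2: _ => [|i y1 y2 _ IH]; first by rewrite leb0.
by rewrite (le_trans (outer_measureU2 _ _ _))// leeD2l.
Qed.

Lemma leb_width B (d : 'I_k.+1 -> R) : (forall i, 0 <= d i)%R ->
  (forall x y, B x -> B y -> forall i, x 0%R i - y 0%R i <= d i)%R ->
  leb B <= (\prod_i d i)%:E.
Proof.
move=> d0 Bd; have [->|/set0P[z Bz]] := eqVneq B set0.
  by rewrite leb0 lee_fin prodr_ge0.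
pose a : Rk := (\row_i inf [set x 0 i | x in B])%R.
have inf_has i : has_inf [set x 0%R i | x in B].
  split; first by exists (z 0%R i), z.
  by exists (z 0 i - d i)%R => _ [x Bx <-]; rewrite lerBlDr addrC -lerBlDr; exact: Bd.
apply: (@le_trans _ _ (leb (box a (a + \row_i d i)%R))).
  apply: le_leb => x Bx i; rewrite !mxE; apply/andP; split.
    by apply: ge_inf; [exact: (inf_has i).2|exists x].
  rewrite -lerBlDr; apply: lb_le_inf; first exact: (inf_has i).1.
  by move=> _ [y By <-]; rewrite lerBlDr addrC -lerBlDr; exact: Bd.
rewrite (le_trans (leb_box_le _ _))// lee_fin box_volE => [|i].
  by apply: ler_prod => i _; rewrite !mxE addrAC subrr add0r d0/=.
by rewrite !mxE lerDl.
Qed.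

Lemma le_prod_limit (x : \bar R) (l M : 'I_k.+1 -> R) :
  (forall n : nat, x <= (\prod_i (l i + M i / n.+1%:R))%:E) -> x <= (\prod_i l i)%:E.
Proof.
move=> xn.
have cv : (\prod_i (l i + M i / n.+1%:R))%:E @[n --> \oo] --> (\prod_i l i)%:E.
  apply: cvg_EFin; first exact: nearW.
  apply: (cvg_big (@mul_continuous R)) => i _.
  rewrite -[X in _ --> X]addr0; apply: cvgD; first exact: cvg_cst.
  rewrite -(mulr0 (M i)); apply: cvgM; [exact: cvg_cst|exact: cvg_harmonic].
rewrite -(cvg_lim _ cv)//; apply: lime_ge; last exact: nearW.
by apply/cvg_ex; eexists; exact: cv.
Qed.

End lebesgue_outer.

Section caratheodory_measurable.
Context {R : realType} {k : nat}.
Local Notation Rk := 'rV[R]_k.+1.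
Local Notation X := (caratheodory_type (@leb R k)).
Implicit Types a b x y : Rk.

Definition clip_hi (i : 'I_k.+1) (c : R) b : Rk :=
  \row_j (if j == i then Num.min (b 0 j) c else b 0 j).
Definition clip_lo (i : 'I_k.+1) (c : R) a : Rk :=
  \row_j (if j == i then Num.max (a 0 j) c else a 0 j).

Lemma box_vol_clip i c a b :
  box_vol a (clip_hi i c b) + box_vol (clip_lo i c a) b = box_vol a b.
Proof.
rewrite /box_vol (bigD1 i)//= [X in (_ + X)](bigD1 i)//= [in RHS](bigD1 i)//=.
rewrite !mxE eqxx.
under eq_bigr => j /negPf ji do rewrite mxE ji.
under [X in (_ + _ * X)]eq_bigr => j /negPf ji do rewrite mxE ji.
rewrite -mulrDl; congr (_ * _).
move: (a 0 i) (b 0 i) => s t.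
by case: (leP t c) => ?; case: (leP s c) => ?; case: (leP (t - s) 0) => ?;
  case: (leP (t - c) 0) => ?; case: (leP (c - s) 0) => ?; lra.
Qed.

Lemma measurable_halfspace i (c : R) : measurable ([set x : Rk | x 0 i <= c] : set X).
Proof.
apply: le_caratheodory_measurable => E.
apply: le_ereal_inf_tmp => _ [a [b [Eab ->]]].
have -> : (\sum_(n <oo) (box_vol (a n) (b n))%:E =
  \sum_(n <oo) (box_vol (a n) (clip_hi i c (b n)))%:E +
  \sum_(n <oo) (box_vol (clip_lo i c (a n)) (b n))%:E)%E.
  rewrite -nneseriesD; [|by move=> *; rewrite lee_fin box_vol_ge0..].
  by apply: eq_eseriesr => n _; rewrite -EFinD box_vol_clip.
apply: leeD; apply: leb_cover_le => x [/Eab[n _ abx]] /=.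
  move=> xc; exists n => // j; rewrite mxE; have /andP[-> xb] := abx j => /=.
  by case: eqVneq => [->|//]; rewrite le_min xc andbT; have /andP[] := abx i.
move=> /negP; rewrite -ltNge => cx; exists n => // j; rewrite mxE.
have /andP[ax ->] := abx j; rewrite andbT.
by case: eqVneq => [->|//]; rewrite ge_max (ltW cx) andbT; have /andP[] := abx i.
Qed.

Lemma measurable_coord i : measurable_fun setT (fun x : X => (x : Rk) 0 i).
Proof.
move=> _; apply: (measurability _ (RGenOInfty.measurableE R)) => //.
move=> _ [_ [r ->] <-]; rewrite setTI.
rewrite (_ : _ @^-1` _ = ~` [set x : Rk | x 0 i <= r]).
  by apply: measurableC; exact: measurable_halfspace.
by apply/seteqP; split => x /=; rewrite in_itv/= andbT ltNge => /negP.
Qed.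

Lemma measurable_coordwise (D : 'I_k.+1 -> set R) : (forall i, measurable (D i)) ->
  measurable ([set x : Rk | forall i, D i (x 0 i)] : set X).
Proof.
move=> mD; rewrite (_ : [set x | _] = \bigcap_(i in [set: 'I_k.+1])
    ((fun x : X => (x : Rk) 0 i) @^-1` D i)); last first.
  by apply/seteqP; split => x h i //; [move=> _; exact: h|exact: (h i Logic.I)].
apply: fin_bigcap_measurable => // i _.
by rewrite -[X in measurable X]setTI; exact: measurable_coord.
Qed.

Lemma measurable_box a b : measurable (box a b : set X).
Proof.
rewrite (_ : box a b = [set x : Rk | forall i, `[a 0 i, b 0 i]%classic (x 0 i)]).
  exact: (measurable_coordwise (D := fun i => `[a 0 i, b 0 i]%classic)).
by apply/seteqP; split => x abx i; have := abx i; rewrite /= in_itv.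
Qed.

Lemma rV_norm_le x (r : R) : 0 <= r -> (`|x| <= r <-> forall i, `|x 0 i| <= r).
Proof.
move=> r0; rewrite /Num.norm/= mx_normrE; split.
  by move=> /bigmax_leP[_ h] i; exact: (h (0, i) isT).
by move=> h; apply/bigmax_leP; split => // -[i j] _ /=; rewrite (ord1 i); exact: h.
Qed.

Lemma rV_norm_coord x i : `|x 0 i| <= `|x|.
Proof. by have /(rV_norm_le x) := normr_ge0 x; move=> [/(_ (lexx _)) + _]; exact. Qed.

Lemma rV_norm_lt x (r : R) : 0 < r -> (`|x| < r <-> forall i, `|x 0 i| < r).
Proof.
move=> r0; split=> [xr i|xr]; first exact: le_lt_trans (rV_norm_coord x i) xr.
by rewrite /Num.norm/= mx_normrE; apply/bigmax_ltP; split => // -[i j] _; rewrite (ord1 i).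
Qed.

Lemma measurable_norm_ball x (r : R) : 0 < r -> measurable ([set y : Rk | `|y - x| < r] : set X).
Proof.
move=> r0; rewrite (_ : [set y | _] = [set y : Rk | forall i, ball (x 0 i) r (y 0 i)]).
  by apply: (measurable_coordwise (D := fun i => ball (x 0 i) r)) => i; exact: measurable_ball.
apply/seteqP; split => y /=; rewrite (rV_norm_lt _ r0) => h i; have := h i;
  by rewrite /ball/= distrC !mxE.
Qed.

Lemma rV_rat_approx x (e : R) : 0 < e -> exists q : 'rV[rat]_k.+1, `|x - map_mx ratr q| < e.
Proof.
by move=> e0; have [q xq] := mx_rat_approx x e0; exists q; apply/rV_norm_lt.
Qed.

Lemma measurable_open_rV (U : set Rk) : open U -> measurable (U : set X).
Proof.
move=> oU; rewrite -[U]setTI.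
have base := @Vball_is_base R false Rk _ (map_mx ratr) rV_rat_approx.
apply: (is_base_measurable (h := id : X -> Rk) base) => // i.
by rewrite setTI; apply: measurable_norm_ball; rewrite invr_gt0.
Qed.

Lemma measurable_closed_rV (C : set Rk) : closed C -> measurable (C : set X).
Proof.
move=> cC; rewrite -[C]setCK; apply: measurableC; apply: measurable_open_rV.
exact: closed_openC.
Qed.

Lemma measurable_compact_rV (C : set Rk) : compact C -> measurable (C : set X).
Proof.
by move=> cC; apply: measurable_closed_rV; apply: compact_closed => //; exact: norm_hausdorff.
Qed.

Definition cube (n : nat) : set Rk := box (const_mx (- n%:R)) (const_mx n%:R).

Lemma cubeP n x : cube n x <-> `|x| <= n%:R.
Proof.
split=> [h|/rV_norm_le - /(_ (ler0n _ _)) h i].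
  by apply/rV_norm_le => // i; have := h i; rewrite !mxE ler_norml.
by rewrite !mxE -ler_norml.
Qed.

Lemma cube_cover x : exists n, cube n x.
Proof.
exists (Num.truncn `|x|).+1; apply/cubeP; apply: ltW.
by have /andP[] := truncn_itv (normr_ge0 x).
Qed.

Lemma leb_cube_fin n : (leb (cube n) < +oo)%E.
Proof. exact: le_lt_trans (leb_box_le _ _) (ltry _). Qed.

Lemma leb_compact_fin (C : set Rk) : compact C -> (leb C < +oo)%E.
Proof.
move=> /compact_bounded[M [_ CM]]; pose n := (Num.truncn (`|M| + 1)).+1.
apply: le_lt_trans (leb_cube_fin n); apply: le_leb => x Cx; apply/cubeP.
apply: (@le_trans _ _ (`|M| + 1)).
  by apply: CM => //; rewrite (le_lt_trans (ler_norm M))// ltrDl.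
by apply: ltW; have /andP[] := truncn_itv (addr_ge0 (normr_ge0 M) ler01).
Qed.

Definition lebX : set X -> \bar R := @leb R k.

HB.instance Definition _ := isMeasure.Build _ _ _ lebX
  (caratheodory_measure0 (@leb R k)) (caratheodory_measure_ge0 (mu := @leb R k))
  (caratheodory_measure_sigma_additive (mu := @leb R k)).

Lemma leb_sigma_finite : sigma_finite setT lebX.
Proof.
exists cube; last by move=> i; split; [exact: measurable_box|exact: leb_cube_fin].
by apply/seteqP; split => // x _; have [n nx] := cube_cover x; exists n.
Qed.

HB.instance Definition _ := Measure_isSigmaFinite.Build _ _ _ lebX leb_sigma_finite.

End caratheodory_measurable.

Section null_sets.
Context {R : realType} {k : nat}.
Local Notation Rk := 'rV[R]_k.+1.
Local Notation X := (caratheodory_type (@leb R k)).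
Implicit Types A B : set Rk.
Local Open Scope ereal_scope.

Lemma null_subset A B : A `<=` B -> leb B = 0 -> leb A = 0.
Proof. by move=> /le_leb AB B0; apply/eqP; rewrite eq_le leb_ge0 andbT -B0. Qed.

Lemma null_measurable A : leb A = 0 -> measurable (A : set X).
Proof.
move=> A0; apply: le_caratheodory_measurable => E.
change (leb (E `&` A) + leb (E `&` ~` A) <= leb E).
rewrite (_ : leb (E `&` A) = 0) ?add0e; first by apply: le_leb => x [].
by apply: null_subset A0 => x [].
Qed.

Lemma null_bigcup (F : nat -> set Rk) : (forall n, leb (F n) = 0) ->
  leb (\bigcup_n F n) = 0.
Proof.
move=> F0; apply/eqP; rewrite eq_le leb_ge0 andbT.
by rewrite (le_trans (leb_sigma_subadditive _))// eseries0.
Qed.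

Lemma null_bigcup_count (I : countType) (F : I -> set Rk) : (forall i, leb (F i) = 0) ->
  leb (\bigcup_i F i) = 0.
Proof.
move=> F0; apply: (@null_subset _ (\bigcup_n (if unpickle n is Some i then F i else set0))).
  by move=> x [i _ Fix]; exists (pickle i) => //; rewrite pickleK.
by apply: null_bigcup => n; case: unpickle => //; exact: leb0.
Qed.

Lemma null_setU A B : leb A = 0 -> leb B = 0 -> leb (A `|` B) = 0.
Proof.
move=> A0 B0; apply/eqP; rewrite eq_le leb_ge0 andbT.
apply: (le_trans (outer_measureU2 leb _ _)).
by rewrite [X in X + _]A0 [X in _ + X]B0 adde0.
Qed.

Variable Om : set Rk.
Implicit Types P Q : Rk -> Prop.

Lemma ae_onS P Q : (forall x, Om x -> P x -> Q x) -> ae_on Om P -> ae_on Om Q.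
Proof. by move=> PQ; apply: null_subset => x [Ox nQ]; split => // /(PQ _ Ox). Qed.

Lemma ae_onT P : (forall x, Om x -> P x) -> ae_on Om P.
Proof.
move=> hP; apply: (@null_subset _ set0); last exact: leb0.
by move=> x [Ox /(_ (hP x Ox))].
Qed.

Lemma ae_on_all (I : countType) (P : I -> Rk -> Prop) :
  (forall i, ae_on Om (P i)) -> ae_on Om (fun x => forall i, P i x).
Proof.
move=> hP; apply: null_subset (null_bigcup_count hP) => x [Ox /existsNP[i nP]].
by exists i.
Qed.

Lemma ae_onI P Q : ae_on Om P -> ae_on Om Q -> ae_on Om (fun x => P x /\ Q x).
Proof.
move=> hP hQ; apply: null_subset (null_setU hP hQ) => x [Ox /not_andP[nP|nQ]].
  by left.
by right.
Qed.

Definition null_preimages (F : Rk -> Rk) :=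
  forall M, leb M = 0 -> leb (Om `&` F @^-1` M) = 0.

Lemma ae_on_comp (F : Rk -> Rk) P : (forall x, Om x -> Om (F x)) -> null_preimages F ->
  ae_on Om P -> ae_on Om (fun x => P (F x)).
Proof.
move=> FOm nF hP; apply: null_subset (nF _ hP) => x [Ox nP]; split => //.
by split => //; exact: FOm.
Qed.

End null_sets.

Section regularity.
Context {R : realType} {k : nat}.
Local Notation Rk := 'rV[R]_k.+1.
Local Notation X := (caratheodory_type (@leb R k)).
Implicit Types (a b x : Rk) (A : set Rk).

Lemma box_thicken a b (e : R) : 0 < e -> exists t : R, 0 < t /\
  box_vol (a - const_mx t) (b + const_mx t) <= box_vol a b + e.
Proof.
move=> e0; apply: contrapT => /forallNP h.
pose l i := Num.max (b 0 i - a 0 i) 0.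
have : ((box_vol a b + e)%:E <= (\prod_i l i)%:E)%E.
  apply: (@le_prod_limit _ _ _ _ (fun=> 2)) => n.
  have n0 : 0 < n.+1%:R^-1 :> R by rewrite invr_gt0.
  have := h n.+1%:R^-1; rewrite n0 => /not_andP[//|/negP]; rewrite -ltNge => /ltW thick.
  rewrite lee_fin (le_trans thick)//; apply: ler_prod => i _.
  rewrite le_max lexx orbT/= !mxE /l; move: (n.+1%:R^-1 : R) n0 => t t0.
  by case: (leP (b 0 i - a 0 i) 0) => ?; rewrite ge_max; apply/andP; split; lra.
by rewrite lee_fin gerDl leNgt e0.
Qed.

Definition obox a b : set Rk := [set x | forall i, a 0 i < x 0 i < b 0 i].

Lemma open_obox a b : open (obox a b).
Proof.
rewrite openE => x abx.
have coord_nbhs i : nbhs x [set y : Rk | a 0 i < y 0 i < b 0 i].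
  rewrite (_ : [set y : Rk | _] = (fun y : Rk => y 0 i) @^-1` `]a 0 i, b 0 i[%classic).
    apply: open_nbhs_nbhs; split; last by rewrite /= in_itv; exact: abx.
    by apply: open_comp => [y _|]; [exact: coord_continuous|exact: itv_open].
  by apply/seteqP; split => y; rewrite /= in_itv.
exact: (@filter_forall _ _ (fun i (y : Rk) => a 0 i < y 0 i < b 0 i) (nbhs x) _ coord_nbhs).
Qed.

Lemma leb_open A (e : R) : (leb A < +oo)%E -> 0 < e ->
  exists U, [/\ open U, A `<=` U & (leb U <= leb A + e%:E)%E].
Proof.
move=> Afin e0; have e20 : 0 < e / 2 by rewrite divr_gt0.
have [ab [Aab sumab]] := leb_lt_cover Afin e20.
have /choice[t tP] n : exists t : R, 0 < t /\
    box_vol ((ab n).1 - const_mx t) ((ab n).2 + const_mx t) <=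
    box_vol (ab n).1 (ab n).2 + (e / 2) / (2 ^ n.+1)%:R.
  by apply: box_thicken; rewrite divr_gt0// ltr0n expn_gt0.
pose U n := obox ((ab n).1 - const_mx (t n)) ((ab n).2 + const_mx (t n)).
have leU n : (leb (U n) <= (box_vol (ab n).1 (ab n).2 + (e / 2) / (2 ^ n.+1)%:R)%:E)%E.
  have Ubox : U n `<=` box ((ab n).1 - const_mx (t n)) ((ab n).2 + const_mx (t n)).
    by move=> x xn i; have /andP[ax xb] := xn i; rewrite (ltW ax) (ltW xb).
  by rewrite (le_trans (le_leb Ubox))// (le_trans (leb_box_le _ _))// lee_fin (tP n).2.
exists (\bigcup_n U n); split.
- by apply: bigcup_open => n _; exact: open_obox.
- move=> x /Aab[n _ xn]; exists n => // i; rewrite !mxE; have /andP[ax xb] := xn i.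
  by have [t0 _] := tP n; apply/andP; split; lra.
- apply: le_trans (leb_sigma_subadditive _) _.
  apply: le_trans (lee_nneseries _ (fun n _ => leU n)) _ => [n _ _|]; first exact: leb_ge0.
  have := @epsilon_trick R (fun n => (box_vol (ab n).1 (ab n).2)%:E) (e / 2) xpredT.
  under eq_eseriesr do rewrite -EFinD.
  move=> /(_ _ (ltW e20)) /le_trans; apply.
    by move=> n; rewrite lee_fin box_vol_ge0.
  by rewrite (le_trans (leeD2r _ sumab))// -addeA -EFinD -mulr2n -[_ *+ 2]mulr_natr divfK//.
Qed.

Lemma measurable_outer A (e : R) : measurable (A : set X) -> 0 < e ->
  exists U, [/\ open U, A `<=` U & (leb (U `\` A) <= e%:E)%E].
Proof.
move=> mA e0.
have /choice[U UP] n : exists U, [/\ open U, A `&` cube n `<=` U &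
    (leb (U `\` (A `&` cube n)) <= (e / (2 ^ n.+1)%:R)%:E)%E].
  have Afin : (leb (A `&` cube n) < +oo)%E.
    by apply: le_lt_trans (leb_cube_fin n); apply: le_leb => x [].
  have en : 0 < e / (2 ^ n.+1)%:R by rewrite divr_gt0// ltr0n expn_gt0.
  have [U [oU AU leU]] := leb_open Afin en; exists U; split => //.
  have mAn : measurable (A `&` cube n : set X) by apply: measurableI => //; exact: measurable_box.
  have := mAn U; rewrite setIidr// => UE; move: leU; rewrite -/leb [X in (X <= _)%E]UE -setDE.
  by rewrite leeD2lE// ge0_fin_numE// leb_ge0.
exists (\bigcup_n U n); split.
- by apply: bigcup_open => n _; have [] := UP n.
- move=> x Ax; have [n nx] := cube_cover x; exists n => //.
  by have [_ + _] := UP n; apply.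
- apply: (@le_trans _ _ (leb (\bigcup_n (U n `\` (A `&` cube n))))).
    by apply: le_leb => x [[n _ Unx] nAx]; exists n => //; split => // -[].
  apply: le_trans (leb_sigma_subadditive _) _.
  apply: le_trans (epsilon_trick0 xpredT (ltW e0)).
  apply: lee_nneseries => n _; first by move=> _; exact: leb_ge0.
  by have [] := UP n.
Qed.

Lemma measurable_sigma_compact A : measurable (A : set X) ->
  exists C : nat * nat -> set Rk, [/\ forall p, compact (C p), forall p, C p `<=` A
    & leb (A `\` \bigcup_p C p) = 0%E].
Proof.
move=> mA; have mAC : measurable (~` A : set X) by exact: measurableC.
have /choice[U UP] n : exists U, [/\ open U, ~` A `<=` U &
    (leb (U `\` ~` A) <= (n.+1%:R^-1)%:E)%E].
  by apply: measurable_outer => //; rewrite invr_gt0.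
exists (fun p => ~` U p.1 `&` cube p.2); split.
- move=> [n m] /=; apply: bounded_closed_compact.
    exists m%:R; split; first exact: num_real.
    by move=> M mM x [_ /cubeP xm]; exact: le_trans xm (ltW mM).
  apply: closedI; first by rewrite closedC; have [] := UP n.
  rewrite (_ : cube m = (fun x : Rk => `|x|) @^-1` [set r | r <= m%:R]); last first.
    by apply/seteqP; split => x /cubeP.
  by apply: closed_comp => [x _|]; [exact: norm_continuous|exact: closed_le].
- by move=> [n m] x /= [nUx _]; apply: contrapT => nAx; apply: nUx; have [_ + _] := UP n; apply.
- apply/eqP; rewrite eq_le leb_ge0 andbT; apply/lee_addgt0Pr => e e0; rewrite add0e.
  have /ltr_add_invr[n] := e0; rewrite add0r => ne.
  have [_ _ Un] := UP n.
  apply: (@le_trans _ _ (leb (U n `\` ~` A))).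
    apply: le_leb => x [Ax nC]; split; last by move=> /(_ Ax).
    apply: contrapT => nUx; apply: nC; have [m mx] := cube_cover x.
    by exists (n, m).
  by rewrite (le_trans Un)// lee_fin ltW.
Qed.

End regularity.

Section lipschitz.
Context {R : realType} {k : nat}.
Local Notation Rk := 'rV[R]_k.+1.
Implicit Types (a b x y : Rk) (A : set Rk) (F : Rk -> Rk).

Lemma truncn_shift_itv (a x s : R) : 0 < s -> a <= x ->
  a + s * (Num.truncn ((x - a) / s))%:R <= x <= a + s * (Num.truncn ((x - a) / s)).+1%:R.
Proof.
move=> s0 ax; have /truncn_itv/andP[tx xt] : 0 <= (x - a) / s.
  by rewrite divr_ge0 ?subr_ge0// ltW.
by rewrite -lerBrDl mulrC -ler_pdivlMr// tx/= -lerBlDl mulrC -ler_pdivrMr// ltW.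
Qed.

Lemma leb_lipschitz_grid A F a b (l s : R) : 0 < l -> 0 < s ->
  (forall x y, A x -> A y -> `|F x - F y| <= l * `|x - y|) ->
  (forall i, a 0 i <= b 0 i) ->
  (leb (F @` (A `&` box a b)) <= (\prod_i (l * (b 0 i - a 0 i) + l * s))%:E)%E.
Proof.
move=> l0 s0 Fl ab.
pose N i := (Num.truncn ((b 0 i - a 0 i) / s)).+1.
pose cell (g : {dffun forall i : 'I_k.+1, 'I_(N i)}) := [set x : Rk | forall i,
  a 0 i + s * (g i)%:R <= x 0 i <= a 0 i + s * (g i).+1%:R].
have cellP : F @` (A `&` box a b) `<=` \bigcup_g (F @` (A `&` cell g)).
  move=> _ [x [Ax abx] <-].
  pose t i := Num.truncn ((x 0 i - a 0 i) / s).
  have tN i : (t i < N i)%N.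
    by rewrite ltnS le_truncn// ler_pM2r ?invr_gt0// lerB//; have /andP[] := abx i.
  exists (finfun (fun i => Ordinal (tN i))) => //; exists x => //; split => // i.
  by rewrite ffunE; apply: truncn_shift_itv => //; have /andP[] := abx i.
have leb_cell g : (leb (F @` (A `&` cell g)) <= (\prod_(i < k.+1) (l * s))%:E)%E.
  apply: leb_width => [i|_ _ [x [Ax xg] <-] [y [Ay yg] <-] i].
    by rewrite mulr_ge0// ltW.
  have -> : F x 0 i - F y 0 i = (F x - F y) 0 i by rewrite !mxE.
  rewrite (le_trans (ler_norm _))// (le_trans (rV_norm_coord _ _))// (le_trans (Fl _ _ Ax Ay))//.
  rewrite ler_pM2l//; apply/rV_norm_le => [|j]; first exact: ltW.
  rewrite !mxE; have /andP[x1 x2] := xg j; have /andP[y1 y2] := yg j.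
  rewrite -natr1 mulrDr mulr1 in x2 y2.
  by rewrite ler_norml; apply/andP; split; lra.
apply: le_trans (leb_finite_cover cellP leb_cell) _.
rewrite card_dep_ffun foldrE big_image/= natr_prod -big_split/= lee_fin.
apply: ler_prod => i _; rewrite card_ord mulr_ge0 ?mulr_ge0 ?(ltW l0) ?(ltW s0)//=.
rewrite /N -natr1 mulrDl mul1r lerD2r mulrCA ler_pM2l// -ler_pdivlMr//.
by rewrite truncn_le// divr_ge0 ?subr_ge0// ltW.
Qed.

Lemma leb_lipschitz A F (l : R) : 0 < l ->
  (forall x y, A x -> A y -> `|F x - F y| <= l * `|x - y|) ->
  (leb (F @` A) <= (l ^+ k.+1)%:E * leb A)%E.
Proof.
move=> l0 Fl; apply: leb_image_le => [|a b]; first by rewrite exprn_gt0.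
have [->|/set0P[z [_ /box_le ab]]] := eqVneq (A `&` box a b) set0.
  by rewrite image_set0 leb0 lee_fin mulr_ge0 ?box_vol_ge0// exprn_ge0// ltW.
have -> : l ^+ k.+1 * box_vol a b = \prod_i (l * (b 0 i - a 0 i)).
  by rewrite big_split/= prodr_const card_ord box_volE.
by apply: (@le_prod_limit _ _ _ _ (fun=> l)) => n; apply: leb_lipschitz_grid; rewrite ?invr_gt0.
Qed.

End lipschitz.

Section linear.
Context {R : realType} {k : nat}.
Local Notation Rk := 'rV[R]_k.+1.
Local Notation Mk := 'M[R]_k.+1.
Implicit Types (a b x y r : Rk) (A : set Rk) (S T : Mk) (i j : 'I_k.+1).

Definition row_replace j r : Mk :=
  \matrix_(i, l) if i == j then r 0 l else (i == l)%:R.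

Lemma mul_row_replace j r x l :
  (x *m row_replace j r) 0 l = (if l == j then 0 else x 0 l) + x 0 j * r 0 l.
Proof.
rewrite mxE (bigD1 j)//= mxE eqxx addrC; congr (_ + _).
rewrite (eq_bigr (fun i => x 0 i * (i == l)%:R)); last first.
  by move=> i /negPf ij; rewrite mxE ij.
case: eqVneq => [->|lj].
  by rewrite big1// => i /negPf ij; rewrite ij mulr0.
rewrite (bigD1 l)//= eqxx mulr1 big1 ?addr0// => i /andP[_ /negPf il].
by rewrite il mulr0.
Qed.

Lemma det_row_replace j r : \det (row_replace j r) = r 0 j.
Proof.
rewrite (expand_det_col _ j) (bigD1 j)//= big1 ?addr0; last first.
  by move=> i /negPf ij; rewrite mxE ij mul0r.
rewrite mxE eqxx /cofactor addnn -signr_odd odd_double expr0 mul1r.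
rewrite (_ : row' j _ = 1%:M) ?det1 ?mulr1//.
apply/matrixP => p q; rewrite !mxE eq_sym (negPf (neq_lift _ _)).
by rewrite (inj_eq lift_inj).
Qed.

Definition det_bounded S :=
  forall A, (leb ((mulmx^~ S) @` A) <= `|\det S|%:E * leb A)%E.

Lemma det_bounded1 : det_bounded 1%:M.
Proof.
move=> A; rewrite det1 normr1 mul1e; apply: le_leb => _ [x Ax <-].
by rewrite mulmx1.
Qed.

Lemma det_boundedM S T : det_bounded S -> det_bounded T -> det_bounded (S *m T).
Proof.
move=> bS bT A; rewrite (_ : _ @` A = (mulmx^~ T) @` ((mulmx^~ S) @` A)).
  by rewrite (le_trans (bT _))// det_mulmx normrM mulrC EFinM -muleA lee_wpmul2l.
by rewrite image_comp; apply: eq_imagel => x _ /=; rewrite mulmxA.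
Qed.

Lemma det_bounded_perm (s : {perm 'I_k.+1}) : det_bounded (perm_mx s).
Proof.
move=> A; rewrite det_perm normr_sign; apply: leb_image_le => // a b; rewrite mul1r.
have permE x l : (x *m perm_mx s) 0 l = x 0 (s^-1 l)%g.
  by rewrite -{1}[s]invgK -col_permE mxE.
rewrite (_ : box_vol a b = box_vol (a *m perm_mx s) (b *m perm_mx s)).
  apply: le_trans (leb_box_le _ _); apply: le_leb => _ [x [_ abx] <-] l.
  by rewrite !permE; exact: abx.
rewrite /box_vol (reindex_inj (@perm_inj _ s^-1%g))/=.
by apply: eq_bigr => l _; rewrite !permE.
Qed.

Lemma itv_subdivision (a b x : R) n : a <= x <= b ->
  exists p : 'I_n.+1, a + (b - a) / n.+1%:R * p%:R <= x <= a + (b - a) / n.+1%:R * p.+1%:R.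
Proof.
move=> /andP[ax xb]; have := le_trans ax xb; rewrite le_eqVlt => /predU1P[ab|ab].
  by rewrite -ab in xb *; exists ord0; rewrite subrr !mul0r addr0 ax.
set s := (b - a) / n.+1%:R; have s0 : 0 < s by rewrite divr_gt0// subr_gt0.
have /andP[tx xt] := truncn_shift_itv s0 ax.
have [tn|nt] := ltnP (Num.truncn ((x - a) / s)) n.+1; first by exists (Ordinal tn); rewrite tx.
exists ord_max => /=; apply/andP; split.
  by apply: le_trans tx; rewrite lerD2l ler_pM2l// ler_nat ltnW.
by rewrite /s divfK ?pnatr_eq0// addrC subrK.
Qed.

Lemma leb_row_replace_slabs A j r a b n : (forall i, a 0 i <= b 0 i) ->
  (leb ((mulmx^~ (row_replace j r)) @` (A `&` box a b)) <=
   (\prod_i ((if i == j then `|r 0 j| * (b 0 j - a 0 j) else b 0 i - a 0 i) +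
     (if i == j then 0 else `|r 0 i| * (b 0 j - a 0 j)) / n.+1%:R))%:E)%E.
Proof.
move=> ab; pose w i := b 0 i - a 0 i; have w0 i : 0 <= w i by rewrite subr_ge0.
pose s := w j / n.+1%:R; have s0 : 0 <= s by rewrite divr_ge0.
pose slab (p : 'I_n.+1) := [set x : Rk | a 0 j + s * p%:R <= x 0 j <= a 0 j + s * p.+1%:R].
pose F := mulmx^~ (row_replace j r) : Rk -> Rk.
have slabP : F @` (A `&` box a b) `<=` \bigcup_p (F @` (box a b `&` slab p)).
  move=> _ [x [Ax abx] <-]; have [p xp] := itv_subdivision n (abx j).
  by exists p => //; exists x.
pose d i := if i == j then `|r 0 j| * s else w i + `|r 0 i| * s.
have d0 i : 0 <= d i by rewrite /d; case: ifP => _; [|apply: addr_ge0 => //]; exact: mulr_ge0.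
have leb_slab p : (leb (F @` (box a b `&` slab p)) <= (\prod_i d i)%:E)%E.
  apply: leb_width => // _ _ [x [abx xp] <-] [y [aby yp] <-] i.
  have xyj : `|x 0 j - y 0 j| <= s.
    move: xp yp; rewrite /slab/= -natr1 mulrDr mulr1 => /andP[x1 x2] /andP[y1 y2].
    by rewrite ler_norml; apply/andP; split; lra.
  have rxy : x 0 j * r 0 i - y 0 j * r 0 i <= `|r 0 i| * s.
    by rewrite -mulrBl (le_trans (ler_norm _))// normrM mulrC ler_wpM2l.
  rewrite /F !mul_row_replace /d; case: eqVneq => [ij|ij].
    by rewrite !add0r (le_trans rxy)// ij.
  rewrite opprD addrACA lerD// /w.
  by have /andP[? ?] := abx i; have /andP[? ?] := aby i; lra.
apply: le_trans (leb_finite_cover slabP leb_slab) _.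
rewrite card_ord lee_fin (bigD1 j)//= [leRHS](bigD1 j)//= /d !eqxx mul0r addr0.
rewrite mulrA [n.+1%:R * _]mulrCA [n.+1%:R * s]mulrC divfK ?pnatr_eq0//.
rewrite (eq_bigr (fun i => w i + `|r 0 i| * s)) => [|i /negPf ->//].
by rewrite [in leRHS](eq_bigr (fun i => w i + `|r 0 i| * s)) => [|i /negPf ->]; rewrite ?mulrA.
Qed.

Lemma det_bounded_row_replace j r : r 0 j != 0 -> det_bounded (row_replace j r).
Proof.
move=> rj A; rewrite det_row_replace; apply: leb_image_le => [|a b].
  by rewrite normr_gt0.
have [->|/set0P[z [_ /box_le ab]]] := eqVneq (A `&` box a b) set0.
  by rewrite image_set0 leb0 lee_fin mulr_ge0 ?box_vol_ge0.
have -> : `|r 0 j| * box_vol a b =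
    \prod_i (if i == j then `|r 0 j| * (b 0 j - a 0 j) else b 0 i - a 0 i).
  rewrite box_volE// (bigD1 j)//= [RHS](bigD1 j)//= eqxx mulrA; congr (_ * _).
  by apply: eq_bigr => i /negPf ->.
apply: le_prod_limit => n; exact: leb_row_replace_slabs.
Qed.

Definition replace_rows (s : seq 'I_k.+1) T : Mk :=
  \matrix_(i, l) if i \in s then T i l else (i == l)%:R.

Lemma replace_rows_rcons s j T : j \notin s -> all (fun i => T i j == 0) s ->
  replace_rows (rcons s j) T = replace_rows s T *m row_replace j (row j T).
Proof.
move=> js /allP Tj; apply/matrixP => i l.
have -> : (replace_rows s T *m row_replace j (row j T)) i l =
    (row i (replace_rows s T) *m row_replace j (row j T)) 0 l.
  by rewrite -row_mul [RHS]mxE.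
rewrite mul_row_replace !mxE mem_rcons inE; case: eqVneq => [->|ij] /=.
  by rewrite (negPf js) mul1r [j == l]eq_sym; case: eqVneq => _; rewrite add0r.
case: ifPn => [i_s|_].
  by rewrite (eqP (Tj i i_s)) mul0r addr0; case: eqVneq => // ->; exact/eqP/Tj.
by rewrite mul0r addr0; case: (eqVneq l j) => // ->; rewrite (negPf ij).
Qed.

Lemma det_bounded_replace_rows s T : uniq s -> pairwise (fun i j => T i j == 0) s ->
  (forall i, T i i != 0) -> det_bounded (replace_rows s T).
Proof.
move=> + + Tii; elim/last_ind: s => [|s j IH].
  move=> _ _; rewrite (_ : replace_rows [::] T = 1%:M); first exact: det_bounded1.
  by apply/matrixP => i l; rewrite !mxE.
rewrite rcons_uniq pairwise_rcons => /andP[js us] /andP[Tj Ts].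
rewrite replace_rows_rcons//; apply: det_boundedM; first exact: IH.
by apply: det_bounded_row_replace; rewrite mxE.
Qed.

Lemma det_bounded_triangular s T : perm_eq s (enum 'I_k.+1) ->
  pairwise (fun i j => T i j == 0) s -> (forall i, T i i != 0) -> det_bounded T.
Proof.
move=> sE Ts Tii; rewrite (_ : T = replace_rows s T).
  by apply: det_bounded_replace_rows => //; rewrite (perm_uniq sE) enum_uniq.
by apply/matrixP => i l; rewrite mxE (perm_mem sE) mem_enum.
Qed.

Lemma leb_mulmx_le S A : S \in unitmx ->
  (leb ((mulmx^~ S) @` A) <= `|\det S|%:E * leb A)%E.
Proof.
move=> uS; suff : det_bounded S by exact.
have := cormen_lup_correct S.
have := cormen_lup_perm S; have := @cormen_lup_lower _ _ S; have := @cormen_lup_upper _ _ S.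
have := cormen_lup_detL S.
case: (cormen_lup S) => -[_ L] U /= detL Uup Llow /is_perm_mxP[s ->].
move=> sS; have SE : S = perm_mx s^-1 *m (L *m U).
  have -> : L *m U = perm_mx s *m S by [].
  by rewrite mulmxA -perm_mxM mulVg perm_mx1 mul1mx.
have sorted_enum : sorted (fun i j : 'I_k.+1 => (i < j)%N) (enum 'I_k.+1).
  by have := iota_ltn_sorted 0 k.+1; rewrite -val_enum_ord sorted_map.
have detU : \det U != 0.
  by move: uS; rewrite SE unitmxE !det_mulmx detL mul1r unitfE mulf_eq0 negb_or => /andP[].
have diagU : forall i, U i i != 0.
  move: detU; rewrite -det_tr det_trig; last first.
    by apply/is_trig_mxP => i j ij; rewrite mxE Uup.
  by move=> /prodf_neq0 Uii i; have := Uii i isT; rewrite mxE.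
rewrite SE; apply: det_boundedM; first exact: det_bounded_perm.
apply: det_boundedM.
  apply: (@det_bounded_triangular (enum 'I_k.+1)) => // [|i].
    rewrite sorted_pairwise in sorted_enum; last by move=> ? ? ?; exact: ltn_trans.
    apply: sub_pairwise sorted_enum => i j ij.
    by rewrite Llow ?(ltnW ij)// -val_eqE ltn_eqF.
  by rewrite Llow// eqxx oner_eq0.
apply: (@det_bounded_triangular (rev (enum 'I_k.+1))) => //.
  by rewrite perm_rev.
apply: (@sub_pairwise _ (fun i j : 'I_k.+1 => (j < i)%N)) => [i j ij|]; first by rewrite Uup.
by rewrite -sorted_pairwise ?rev_sorted// => ? ? ? /[swap]; exact: ltn_trans.
Qed.

Lemma leb_mulmx_ge S A : S \in unitmx ->
  (`|\det S|%:E * leb A <= leb ((mulmx^~ S) @` A))%E.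
Proof.
move=> uS; have uS' : invmx S \in unitmx by rewrite unitmx_inv.
have dS : \det S != 0 by rewrite -unitfE -unitmxE.
have := leb_mulmx_le ((mulmx^~ S) @` A) uS'.
rewrite image_comp (_ : _ @` A = A); last first.
  by rewrite -[RHS]image_id; apply: eq_imagel => x _ /=; rewrite mulmxK.
move=> h; rewrite (le_trans (lee_wpmul2l _ h)) ?lee_fin//.
by rewrite muleA -EFinM -normrM -det_mulmx mulmxV// det1 normr1 mul1e.
Qed.

End linear.

Section euclidean.
Context {R : realType} {k : nat}.
Local Notation Rk := 'rV[R]_k.+1.
Local Notation Mk := 'M[R]_k.+1.
Implicit Types (x y u : Rk) (A : set Rk).

Lemma norm_le_enorm x : `|x| <= enorm x.
Proof.
apply/rV_norm_le => [|i]; first exact: sqrtr_ge0.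
rewrite -sqrtr_sqr /enorm ler_wsqrtr// (bigD1 i)//= lerDl.
by apply: sumr_ge0 => j _; exact: sqr_ge0.
Qed.

Lemma enorm_le_norm x : enorm x <= k.+1%:R * `|x|.
Proof.
rewrite -[leRHS]ger0_norm ?mulr_ge0// -sqrtr_sqr /enorm ler_wsqrtr//.
apply: (@le_trans _ _ (\sum_(i < k.+1) `|x| ^+ 2)).
  apply: ler_sum => i _; rewrite -[leLHS]ger0_norm ?sqr_ge0// normrX.
  by rewrite lerXn2r ?nnegrE// rV_norm_coord.
rewrite sumr_const card_ord -[leLHS]mulr_natl exprMn ler_wpM2r ?sqr_ge0//.
by rewrite expr2 ler_peMl// ler1n.
Qed.

Lemma enormZ (c : R) x : 0 <= c -> enorm (c *: x) = c * enorm x.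
Proof.
move=> c0; rewrite /enorm -{2}(ger0_norm c0) -sqrtr_sqr -sqrtrM ?sqr_ge0//.
by rewrite mulr_sumr; congr Num.sqrt; apply: eq_bigr => i _; rewrite mxE exprMn.
Qed.

Lemma norm_mulmx_le u (M : Mk) (c : R) : 0 <= c -> (forall i j, `|M i j| <= c) ->
  `|u *m M| <= k.+1%:R * c * `|u|.
Proof.
move=> c0 Mc; apply/rV_norm_le => [|j]; first by rewrite !mulr_ge0.
rewrite mxE (le_trans (ler_norm_sum _ _ _))//.
apply: (@le_trans _ _ (\sum_(i < k.+1) c * `|u|)).
  by apply: ler_sum => i _; rewrite normrM mulrC ler_pM// rV_norm_coord.
by rewrite sumr_const card_ord -[leLHS]mulr_natl mulrA.
Qed.

Lemma norm_mulmx_bound (M : Mk) : exists2 C : R, 0 < C & forall u, `|u *m M| <= C * `|u|.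
Proof.
exists (k.+1%:R * (`|M| + 1)); first by rewrite mulr_gt0// ltr_wpDl.
move=> u; apply: norm_mulmx_le => [|i j]; first by rewrite addr_ge0.
rewrite (@le_trans _ _ `|M|) ?lerDl// {2}/Num.norm/= mx_normrE.
exact: (le_bigmax_cond _ (fun ij => `|M ij.1 ij.2|) (j := (i, j))).
Qed.

Lemma mulmx_continuous (M : Mk) : continuous (mulmx^~ M : Rk -> Rk).
Proof.
move=> x A /nbhs_ballP[e /= e0 eA]; have [C C0 MC] := norm_mulmx_bound M.
apply/nbhs_ballP; exists (e / C); first by rewrite /= divr_gt0.
move=> y; rewrite -ball_normE/= => xy; apply: eA.
by rewrite -ball_normE/= -mulmxBl (le_lt_trans (MC _))// mulrC -ltr_pdivlMr.
Qed.

Let leb_homothety_le x (r : R) A : 0 < r ->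
  (leb ((fun y => x + r *: y)%R @` A) <= (r ^+ k.+1)%:E * leb A)%E.
Proof.
move=> r0; apply: leb_lipschitz => // y z _ _.
by rewrite opprD addrACA subrr add0r -scalerBr normrZ gtr0_norm.
Qed.

Lemma leb_homothety x (r : R) A : 0 < r ->
  leb ((fun y => x + r *: y)%R @` A) = ((r ^+ k.+1)%:E * leb A)%E.
Proof.
move=> r0; have rn0 : 0 < r ^+ k.+1 by rewrite exprn_gt0.
apply/eqP; rewrite eq_le leb_homothety_le//=.
have rV0 : 0 < r^-1 by rewrite invr_gt0.
have inverse : (fun y => - (r^-1 *: x) + r^-1 *: y) @` ((fun y => x + r *: y) @` A) = A.
  rewrite image_comp -[RHS]image_id; apply: eq_imagel => y _ /=.
  by rewrite scalerDr scalerA mulVf ?gt_eqF// scale1r addKr.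
have := leb_homothety_le (- (r^-1 *: x)) ((fun y => x + r *: y) @` A) rV0.
by rewrite inverse exprVn lee_pdivlMl.
Qed.

Lemma leb_eball x (r : R) : 0 < r ->
  leb (eball x r) = ((r ^+ k.+1)%:E * leb (eball (0 : Rk) 1))%E.
Proof.
move=> r0; rewrite -(leb_homothety x)//; congr leb.
apply/seteqP; split => [y|_ [y + <-]]; rewrite /eball/=.
  move=> yr; exists (r^-1 *: (y - x)).
    by rewrite /= subr0 enormZ ?invr_ge0 ?(ltW r0)// mulrC ltr_pdivrMr// mul1r.
  by rewrite scalerA mulfV ?gt_eqF// scale1r addrC subrK.
rewrite subr0 => y1; rewrite addrAC subrr add0r enormZ ?(ltW r0)//.
by rewrite -[ltRHS]mulr1 ltr_pM2l.
Qed.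

Lemma leb_eball1_fin_num : leb (eball (0 : Rk) 1) \is a fin_num.
Proof.
rewrite ge0_fin_numE ?leb_ge0//; apply: le_lt_trans (leb_cube_fin 1); apply: le_leb => x.
rewrite /eball/= subr0 => /ltW x1.
by apply/cubeP; exact: le_trans (norm_le_enorm _) x1.
Qed.

Lemma leb_eball_fin_num x (r : R) : 0 < r -> leb (eball x r) \is a fin_num.
Proof. by move=> r0; rewrite leb_eball// -(fineK leb_eball1_fin_num) -EFinM. Qed.

(* The exact measure of the unit ball cancels, so its positivity suffices. *)
Lemma det_le_lipschitz (S : Mk) (c : R) : (0 < leb (eball (0 : Rk) 1))%E -> S \in unitmx ->
  0 < c -> (forall u, `|u *m S| <= c * `|u|) -> `|\det S| <= c ^+ k.+1.
Proof.
move=> v0 uS c0 Sc; have vfin := leb_eball1_fin_num.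
have := leb_mulmx_ge (eball 0 1) uS.
have image_le : (leb ((mulmx^~ S) @` eball 0 1) <= (c ^+ k.+1)%:E * leb (eball (0 : Rk) 1))%E.
  by apply: leb_lipschitz => // x y _ _; rewrite -mulmxBl.
move=> /le_trans/(_ image_le); rewrite -(fineK vfin) -!EFinM lee_fin ler_pM2r//.
by rewrite fine_gt0// v0/= -ge0_fin_numE// leb_ge0.
Qed.

End euclidean.

(** * Lebesgue measurable functions *)

Section lebesgue_measurable_functions.
Context {R : realType} {k : nat}.
Local Notation Rk := 'rV[R]_k.+1.
Local Notation X := (caratheodory_type (@leb R k)).
Variables (Om : set Rk) (oOm : open Om).
Implicit Types (S T : topologicalType) (F : Rk -> Rk).

Let mOm : measurable (Om : set X). Proof. exact: measurable_open_rV. Qed.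

Lemma lmeas_fun_measurable (u : Rk -> R) : lmeas_fun Om u ->
  measurable_fun (Om : set X) (u : X -> R).
Proof.
move=> mmu _; apply: (measurability _ (RGenOInfty.measurableE R)) => //.
by move=> _ [_ [r ->] <-]; rewrite set_itvoy; exact: (mmu _ (@open_gt _ r)).
Qed.

Lemma lmeas_fun_comp S T (u : Rk -> S) (h : S -> T) :
  lmeas_fun Om u -> continuous h -> lmeas_fun Om (h \o u).
Proof.
move=> mmu ch U oU; apply: (mmu (h @^-1` U)).
by apply: open_comp => // x _; exact: ch.
Qed.

Lemma lmeas_fun_continuous T (h : Rk -> T) : continuous h -> lmeas_fun Om h.
Proof.
move=> ch U oU; apply: (measurable_open_rV (U := Om `&` h @^-1` U)).
by apply: openI => //; apply: open_comp => // x _; exact: ch.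
Qed.

Lemma measurable_preimage F (B : set Rk) : lmeas_fun Om F -> null_preimages Om F ->
  measurable (B : set X) -> measurable (Om `&` F @^-1` B : set X).
Proof.
move=> mF nF mB; have [C [cC CB C0]] := measurable_sigma_compact mB.
rewrite (_ : Om `&` F @^-1` B = (\bigcup_p (Om `&` F @^-1` C p)) `|`
    (Om `&` F @^-1` (B `\` \bigcup_p C p))); last first.
  apply/seteqP; split => x.
    move=> [Ox Bx]; have [[p _ Cx]|nC] := pselect ((\bigcup_p C p) (F x)); last by right.
    by left; exists p.
  by move=> [[p _ [Ox /CB Bx]]|[Ox []]].
apply: measurableU; last by apply: null_measurable; exact: nF.
apply: countable_bigcupT_measurable; first exact: countableP.
move=> p; rewrite (_ : _ `&` _ = Om `\` (Om `&` F @^-1` (~` C p))); last first.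
  apply/seteqP; split => x; first by move=> [Ox Cx]; split => // -[].
  by move=> [Ox h]; split => //; apply: contrapT => nC; apply: h.
apply: measurableD => //; apply: mF; rewrite openC.
by apply: compact_closed => //; exact: norm_hausdorff.
Qed.

Lemma lmeas_fun_comp_map T F (h : Rk -> T) : (forall x, Om x -> Om (F x)) ->
  lmeas_fun Om F -> null_preimages Om F -> lmeas_fun Om h -> lmeas_fun Om (h \o F).
Proof.
move=> FOm mF nF mh U oU.
rewrite (_ : _ `&` _ = Om `&` F @^-1` (Om `&` h @^-1` U)); last first.
  apply/seteqP; split => x; first by move=> [Ox Ux]; split => //; split => //; exact: FOm.
  by move=> [Ox [_ Ux]].
by apply: (measurable_preimage mF nF); exact: mh.
Qed.

Lemma lmeas_fun_pair S T (I J : countType) (B : I -> set S) (C : J -> set T)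
    (F : Rk -> S) (G : Rk -> T) : is_base B -> is_base C ->
  lmeas_fun Om F -> lmeas_fun Om G -> lmeas_fun Om (fun x => (F x, G x)).
Proof.
move=> bB bC mF mG U oU.
apply: (is_base_measurable (X := X) (is_base_setX bB bC)) => // -[i j].
rewrite (_ : _ `&` _ = (Om `&` F @^-1` B i) `&` (Om `&` G @^-1` C j)).
  by apply: measurableI; [apply: mF; case: bB|apply: mG; case: bC].
by apply/seteqP; split => x; [case=> Ox [Bx Cx]|case=> -[Ox Bx] [_ Cx]].
Qed.

Variables (b : bool) (V : normedModType (Kof R b)) (p : nat -> V).
Hypothesis dp : dense_family p.

Lemma lmeas_fun_Vnorm_dist (F : Rk -> V) (v : V) : lmeas_fun Om F ->
  measurable_fun (Om : set X) (fun x : X => Vnorm (F x - v)).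
Proof.
move=> mF; apply: lmeas_fun_measurable.
apply: (lmeas_fun_comp (h := fun w => Vnorm (w - v))) => // w.
apply: (@continuous_comp _ _ _ (fun w => w - v)); last exact: Vnorm_continuous.
by apply: (@continuousB _ _ _ id (fun=> v)); [exact: cvg_id|exact: cst_continuous].
Qed.

Lemma lmeas_fun_Vnorm (F : Rk -> V) : lmeas_fun Om F -> lmeas_fun Om (fun x => Vnorm (F x)).
Proof. by move=> mF; apply: (lmeas_fun_comp mF); exact: Vnorm_continuous. Qed.

Lemma lmeas_funD (F G : Rk -> V) : lmeas_fun Om F -> lmeas_fun Om G ->
  lmeas_fun Om (fun x => F x + G x).
Proof.
move=> mF mG; have bV := Vball_is_base dp.
exact: (lmeas_fun_comp (lmeas_fun_pair bV bV mF mG) (@add_continuous V)).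
Qed.

Lemma lmeas_funZ (a : Rk -> Kof R b) (F : Rk -> V) : lmeas_fun Om a -> lmeas_fun Om F ->
  lmeas_fun Om (fun x => a x *: F x).
Proof.
move=> ma mF; have bK := Vball_is_base (@ratK_dense R b); have bV := Vball_is_base dp.
exact: (lmeas_fun_comp (lmeas_fun_pair bK bV ma mF) (@scale_continuous _ V)).
Qed.

Lemma lmeas_fun_sum I (s : seq I) (F : I -> Rk -> V) : (forall i, lmeas_fun Om (F i)) ->
  lmeas_fun Om (fun x => \sum_(i <- s) F i x).
Proof.
move=> mF; elim: s => [|i s IH].
  by under eq_fun do rewrite big_nil; apply: lmeas_fun_continuous; exact: cst_continuous.
by under eq_fun do rewrite big_cons; exact: lmeas_funD.
Qed.

Lemma lmeas_fun_cvg (F : nat -> Rk -> V) (G : Rk -> V) : (forall m, lmeas_fun Om (F m)) ->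
  ae_on Om (fun x => F m x @[m --> \oo] --> G x) -> lmeas_fun Om G.
Proof.
move=> mF aecv U oU; set Z := Om `&` [set x | ~ (F m x @[m --> \oo] --> G x)].
have mZ : measurable (Z : set X) by exact: null_measurable.
pose D : set X := Om `\` Z.
have mD : measurable D by exact: measurableD.
have cvD x : D x -> F m x @[m --> \oo] --> G x.
  by move=> [Ox nZ]; apply: contrapT => ncv; apply: nZ.
have mdist v : measurable_fun D (fun x : X => Vnorm (G x - v)).
  apply: (measurable_fun_cvg (h := fun m (x : X) => Vnorm (F m x - v) : R)) => [m|x Dx].
    by apply: measurable_funS (lmeas_fun_Vnorm_dist v (mF m)) => // x [].
  have cvB : F m x - v @[m --> \oo] --> G x - v.
    by apply: cvgB; [exact: cvD|exact: cvg_cst].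
  exact: (cvg_comp _ _ cvB (@Vnorm_continuous R b V _)).
have mDU : measurable (D `&` G @^-1` U).
  apply: (is_base_measurable (X := X) (Vball_is_base dp)) => // i.
  rewrite (_ : G @^-1` _ = [set x | Vnorm (G x - p i.1) < i.2.+1%:R^-1])//.
  have := mdist (p i.1) mD _ (measurable_itv `]-oo, (i.2.+1%:R^-1)[).
  by congr (measurable (_ `&` _)); apply/seteqP; split => x; rewrite /= in_itv.
have : measurable (D `&` G @^-1` U `|` Om `&` G @^-1` U `&` Z : set X).
  by apply: measurableU => //; apply: null_measurable; apply: null_subset aecv => x [].
rewrite (_ : _ `|` _ = Om `&` G @^-1` U)//.
apply/seteqP; split => x; first by move=> [[[Ox _] Ux]|[]].
by move=> [Ox Ux]; have [Zx|nZ] := pselect (Z x); [right|left].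
Qed.

End lebesgue_measurable_functions.

(** * The area inequality for approximately differentiable maps *)

Section linear_error.
Context {R : realType} {k : nat}.
Local Notation Rk := 'rV[R]_k.+1.
Local Notation Mk := 'M[R]_k.+1.
Local Notation X := (caratheodory_type (@leb R k)).
Implicit Types (x y z : Rk) (S T : Mk) (P E : set Rk).
Variable F : Rk -> Rk.

Definition linear_error T x y : Rk := F x - F y - (x - y) *m T.

Lemma linear_errorB z T x y : linear_error T x y = linear_error T x z - linear_error T y z.
Proof. by rewrite /linear_error !mulmxBl; apply/rowP => i; rewrite !mxE; ring. Qed.

Lemma linear_errorC T x y : `|linear_error T x y| = `|linear_error T y x|.
Proof.
rewrite -normrN; congr `|_|.
by rewrite /linear_error !mulmxBl; apply/rowP => i; rewrite !mxE; ring.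
Qed.

Lemma linear_error_norm_le (S T : Mk) x y :
  `|linear_error T x y| <= `|linear_error S x y| + `|(x - y) *m (S - T)|.
Proof.
rewrite -[linear_error T x y](_ : linear_error S x y + (x - y) *m (S - T) = _) ?ler_normD//.
by rewrite mulmxBr /linear_error; apply/rowP => i; rewrite !mxE; ring.
Qed.

Definition near_affine T (c : R) P := forall x y, P x -> P y ->
  `|linear_error T x y| <= c * `|x - y|.

Definition near_linear T (kap : R) P := forall x y, P x -> P y ->
  `|linear_error T x y| <= kap * `|(x - y) *m T|.

Lemma near_linearS T kap P E : E `<=` P -> near_linear T kap P -> near_linear T kap E.
Proof. by move=> EP lP x y /EP Px /EP Py; exact: lP. Qed.

Lemma near_linear_lipschitz T kap P : 0 <= kap -> near_linear T kap P ->
  exists2 C : R, 0 < C & forall x y, P x -> P y -> `|F x - F y| <= C * `|x - y|.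
Proof.
move=> kap0 lP; have [C C0 TC] := norm_mulmx_bound T.
exists ((1 + kap) * C) => [|x y Px Py]; first by rewrite mulr_gt0// ltr_wpDr.
have -> : F x - F y = linear_error T x y + (x - y) *m T by rewrite subrK.
rewrite (le_trans (ler_normD _ _))// addrC -mulrA mulrDl mul1r lerD//.
by rewrite (le_trans (lP _ _ Px Py))// ler_wpM2l.
Qed.

Lemma near_linear_expansive T kap P x y : kap < 1 -> near_linear T kap P -> P x -> P y ->
  `|(x - y) *m T| <= (1 - kap)^-1 * `|F x - F y|.
Proof.
move=> kap1 lP Px Py; rewrite ler_pdivlMl ?subr_gt0// mulrBl mul1r lerBlDr.
have := ler_normB (F x - F y) (linear_error T x y); rewrite subKr => /le_trans; apply.
by rewrite lerD2l; exact: lP.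
Qed.

Lemma leb_near_linear_image T kap E : kap < 1 -> T \in unitmx -> near_linear T kap E ->
  (`|\det T|%:E * leb E <= ((1 - kap)^-1 ^+ k.+1)%:E * leb (F @` E))%E.
Proof.
move=> kap1 uT lE; apply: le_trans (leb_mulmx_ge E uT) _.
have low := near_linear_expansive kap1 lE.
have /choice[G GP] y : exists x, (F @` E) y -> E x /\ F x = y.
  have [[x Ex xy]|] := pselect ((F @` E) y); first by exists x.
  by move=> ny; exists 0.
apply: (@le_trans _ _ (leb ((fun y => G y *m T) @` (F @` E)))).
  apply: le_leb => _ [x Ex <-]; exists (F x); first by exists x.
  have [EG FG] := GP (F x) (ex_intro2 _ _ x Ex erefl).
  have := low _ _ EG Ex; rewrite FG subrr normr0 mulr0 normr_le0 mulmxBl subr_eq0.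
  by move=> /eqP.
apply: leb_lipschitz => [|y z Fy Fz]; first by rewrite invr_gt0 subr_gt0.
have [EGy FGy] := GP _ Fy; have [EGz FGz] := GP _ Fz.
by rewrite -mulmxBl (le_trans (low _ _ EGy EGz))// FGy FGz.
Qed.

Definition luzinN (Om : set Rk) := forall M, M `<=` Om -> leb M = 0%E -> leb (F @` M) = 0%E.

Lemma measurable_image_lipschitz (Om Q : set Rk) (C : R) : luzinN Om ->
  measurable (Q : set X) -> Q `<=` Om ->
  (forall x y, Q x -> Q y -> `|F x - F y| <= C * `|x - y|) -> 0 < C ->
  measurable (F @` Q : set X).
Proof.
move=> luzin mQ QOm QC C0.
have [K [cK KQ K0]] := measurable_sigma_compact mQ.
have -> : F @` Q = (\bigcup_p F @` K p) `|` F @` (Q `\` \bigcup_p K p).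
  rewrite -image_bigcup -image_setU; congr (_ @` _).
  apply/seteqP; split => x; last by case=> [[p _ /KQ]|[]].
  by move=> Qx; have [] := pselect ((\bigcup_p K p) x); [left|right].
apply: measurableU; last first.
  by apply: null_measurable; apply: luzin => // x [/QOm].
apply: countable_bigcupT_measurable => [|p]; first exact: countableP.
apply: measurable_compact_rV; apply: continuous_compact; last exact: cK.
apply/subspace_continuousP => x Kx; apply/cvgrPdist_lt => e e0.
rewrite near_withinE; apply/nbhs_ballP; exists (e / C); first by rewrite /= divr_gt0.
move=> y; rewrite -ball_normE/= => xy Ky.
have := QC _ _ (KQ _ _ Kx) (KQ _ _ Ky) => /le_lt_trans; apply.
by rewrite mulrC -ltr_pdivlMr.
Qed.

End linear_error.

Section approximation_points.
Context {R : realType} {k : nat}.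
Local Notation Rk := 'rV[R]_k.+1.
Local Notation Mk := 'M[R]_k.+1.
Local Notation X := (caratheodory_type (@leb R k)).
Local Notation unit_ball := (eball (0 : Rk) 1).
Implicit Types (x y z : Rk) (D G P Q : set Rk) (S T : Mk).

Lemma density_point_eball_gt0 D x : density_point D x -> (0 < leb unit_ball)%E.
Proof.
move=> dx; rewrite lt0e leb_ge0 andbT; apply/negP => /eqP v0.
have := cvgr_gt _ dx => /(_ _ 0 ltr01).
move=> /(filterI (nbhs_right_gt 0)) /filter_ex[r [r0]].
by have := leb_eball x r0; rewrite v0 mule0 /leb => ->; rewrite invr0 mulr0 ltxx.
Qed.

Lemma density_point_setC_le D G x (theta : R) : measurable (G : set X) -> D `<=` G ->
  density_point D x -> 0 < theta ->
  exists2 d : R, 0 < d & forall r, 0 < r < d ->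
    (leb (eball x r `\` G) <= theta%:E * leb (eball x r))%E.
Proof.
move=> mG DG dx theta0; have v0 := density_point_eball_gt0 dx.
have : \forall r \near 0^'+, 1 - theta < fine (leb (D `&` eball x r)) / fine (leb (eball x r)).
  by have /cvgr_gt := dx; apply; rewrite gtrBl.
move=> /nbhs_ballP[d /= d0 near_d]; exists d => // r /andP[r0 rd].
have := near_d r _ r0; rewrite /ball/= sub0r normrN gtr0_norm// => /(_ rd).
set B := eball x r; have Bfin : leb B \is a fin_num by exact: leb_eball_fin_num.
have subfin A : A `<=` B -> leb A \is a fin_num.
  move=> AB; rewrite ge0_fin_numE ?leb_ge0// (le_lt_trans (le_leb AB))//.
  by rewrite -ge0_fin_numE// leb_ge0.
have B0 : 0 < fine (leb B).
  rewrite fine_gt0// -ge0_fin_numE ?leb_ge0// Bfin andbT /B leb_eball// mule_gt0//.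
  by rewrite lte_fin exprn_gt0.
rewrite ltr_pdivlMr// mulrBl mul1r => density.
have BE : leb B = (leb (B `&` G) + leb (B `\` G))%E by rewrite setDE; exact: (mG B).
have DBG : (leb (D `&` B) <= leb (B `&` G))%E.
  by apply: le_leb => y [Dy By]; split => //; exact: DG.
have DBfin : leb (D `&` B) \is a fin_num by apply: subfin => y [].
have BGfin : leb (B `&` G) \is a fin_num by apply: subfin => y [].
have BDGfin : leb (B `\` G) \is a fin_num by apply: subfin => y [].
have := congr1 fine BE; rewrite fineD// => fineBE.
move: DBG; rewrite -(fineK DBfin) -(fineK BGfin) -(fineK BDGfin) -(fineK Bfin).
by rewrite -EFinM !lee_fin; move: density => /=; lra.
Qed.

Variables (Om : set Rk) (F : Rk -> Rk).
Hypotheses (oOm : open Om) (mF : lmeas_fun Om F).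
Local Notation err := (linear_error F).

Definition approx_set T (e : R) x : set Rk := [set y | Om y /\ `|err T y x| <= e * `|y - x|].

Lemma measurable_approx_set T e x : measurable (approx_set T e x : set X).
Proof.
have m0 : lmeas_fun Om (fun y => (F y, y)).
  have bRk := @Vball_is_base R false Rk _ (map_mx ratr) rV_rat_approx.
  apply: (lmeas_fun_pair bRk bRk mF); apply: lmeas_fun_continuous => // y.
  exact: cvg_id.
pose h (p : Rk * Rk) : R := e * `|p.2 - x| - `|p.1 - F x - (p.2 - x) *m T|.
have ch : continuous h.
  have c2 : continuous (fun p : Rk * Rk => p.2 - x).
    by move=> p; apply: cvgB; [exact: cvg_snd|exact: cvg_cst].
  move=> p; apply: cvgB.
    by apply: cvgM; [exact: cvg_cst|apply: cvg_norm; exact: c2].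
  apply: cvg_norm; apply: cvgB; first by apply: cvgB; [exact: cvg_fst|exact: cvg_cst].
  exact: (continuous_comp (c2 p) (@mulmx_continuous _ _ T _)).
have mh : measurable_fun (Om : set X) (fun y : X => h (F y, (y : Rk))).
  by apply: lmeas_fun_measurable => //; exact: (lmeas_fun_comp m0 ch).
rewrite (_ : approx_set T e x = Om `&` (fun y : X => h (F y, (y : Rk))) @^-1` `[0, +oo[%classic).
  by apply: mh; [exact: measurable_open_rV|exact: measurable_itv].
by apply/seteqP; split => y [Oy]; rewrite /= in_itv/= andbT subr_ge0; split.
Qed.

(* Chosen so that exceptional sets of relative measure at most [theta] in balls of radii [r]
   and [2 (k + 1) r] cannot cover the smaller ball. *)
Definition theta : R := (2 + (2 * k.+1%:R) ^+ k.+1)^-1.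

Lemma theta_gt0 : 0 < theta.
Proof. by rewrite invr_gt0 addr_gt0// exprn_gt0// mulr_gt0. Qed.

Definition approx_points T (e d : R) : set Rk := [set x | Om x /\ forall r, 0 < r < d ->
  (leb (eball x r `\` approx_set T e x) <= theta%:E * leb (eball x r))%E].

Lemma approx_points_common T e d x y : (0 < leb unit_ball)%E ->
  approx_points T e d x -> approx_points T e d y -> x != y ->
  2 * k.+1%:R * `|x - y| < d ->
  exists z, [/\ `|z - x| <= `|x - y|, approx_set T e x z & approx_set T e y z].
Proof.
move=> v0 [_ fx] [_ fy] xy xyd; have vfin := @leb_eball1_fin_num R k.
set r := `|x - y| in xyd *; have r0 : 0 < r by rewrite normr_gt0 subr_eq0.
set c : R := 2 * k.+1%:R in xyd.
have c1 : 1 <= c by rewrite /c -natrM ler1n.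
have c0 : 0 < c by exact: lt_le_trans c1.
have cr0 : 0 < c * r by exact: mulr_gt0.
apply: contrapT => /forallNP noz.
have sub : eball x r `<=`
    (eball x r `\` approx_set T e x) `|` (eball y (c * r) `\` approx_set T e y).
  move=> z zx; have zxr : `|z - x| < r by exact: le_lt_trans (norm_le_enorm _) zx.
  have [gx|] := pselect (approx_set T e x z); last by left.
  right; split; last by move=> gy; apply: (noz z); split => //; exact: ltW.
  rewrite /eball/= (le_lt_trans (enorm_le_norm _))// /c -mulrA mulrCA ltr_pM2l//.
  rewrite -(subrKA x z) (le_lt_trans (ler_normD _ _))// mulr_natl mulr2n.
  by rewrite ltr_leD.
have : (leb (eball x r) <= theta%:E * leb (eball x r) + theta%:E * leb (eball y (c * r)))%E.
  apply: le_trans (le_leb sub) _; apply: le_trans (outer_measureU2 leb _ _) _.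
  apply: leeD; [apply: fx|apply: fy]; rewrite ?r0 ?cr0//=.
  by rewrite (le_lt_trans _ xyd)// ler_peMl// ltW.
rewrite (leb_eball x r0) (leb_eball y cr0) -(fineK vfin) -!EFinM -EFinD lee_fin.
rewrite !mulrA -mulrDl ler_pM2r; last by rewrite fine_gt0// v0/= -ge0_fin_numE// leb_ge0.
rewrite exprMn mulrA -mulrDl ler_pMl ?exprn_gt0// -[X in X + _]mulr1 -mulrDr.
rewrite /theta mulrC ler_pdivlMr ?mul1r ?addr_gt0 ?exprn_gt0//.
by rewrite -/c lerD2r leNgt ltr1n.
Qed.

Lemma approx_points_near_affine T e d x y : (0 < leb unit_ball)%E -> 0 <= e ->
  approx_points T e d x -> approx_points T e d y -> 2 * k.+1%:R * `|x - y| < d ->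
  `|err T x y| <= 3 * e * `|x - y|.
Proof.
move=> v0 e0 ax ay xyd; have [->|xy] := eqVneq x y.
  by rewrite /linear_error !subrr mul0mx subr0 !normr0 mulr0.
have [z [zx [_ errx] [_ erry]]] := approx_points_common v0 ax ay xy xyd.
have zy : `|z - y| <= 2 * `|x - y|.
  by rewrite -(subrKA x z) (le_trans (ler_normD _ _))// mulr_natl mulr2n lerD.
rewrite (linear_errorB _ z) (le_trans (ler_normB _ _))//.
rewrite (linear_errorC _ _ x z) (linear_errorC _ _ y z).
have := ler_wpM2l e0 zx; have := ler_wpM2l e0 zy; lra.
Qed.

Lemma approx_diff_points S T e x : Om x -> approx_diff Om F S x -> 0 < e ->
  (forall u : Rk, `|u *m (S - T)| <= e / 2 * `|u|) ->
  exists2 d : R, 0 < d & forall d', d' <= d -> approx_points T e d' x.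
Proof.
move=> Ox dS e0 ST; have e1 : 0 < e / 2 / k.+1%:R by rewrite !divr_gt0.
have Dapprox : [set y | Om y /\ y != x /\
    enorm (F y - F x - (y - x) *m S) / enorm (y - x) < e / 2 / k.+1%:R] `<=` approx_set T e x.
  move=> y [Oy [yx ye]]; split => //.
  have yx0 : 0 < enorm (y - x) by apply: lt_le_trans (norm_le_enorm _); rewrite normr_gt0 subr_eq0.
  rewrite ltr_pdivrMr// in ye; rewrite (le_trans (linear_error_norm_le F S T y x))//.
  rewrite [X in X * _](splitr e) mulrDl lerD//.
  rewrite (le_trans (norm_le_enorm _))// (le_trans (ltW ye))//.
  by rewrite -[leLHS]mulrA ler_pM2l ?divr_gt0// ler_pdivrMl//; exact: enorm_le_norm.
have [d d0 dens] := density_point_setC_le (measurable_approx_set T e x) Dapprox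
  (dS _ e1) theta_gt0.
exists d => // d' d'd; split => // r /andP[r0 rd']; apply: dens.
by rewrite r0 (lt_le_trans rd').
Qed.

(* [P] need not be measurable: [Q] is cut out of [Om] by the inequalities against a
   countable dense subset of [P]. *)
Lemma near_affine_enlarge T (c : R) P : 0 <= c -> P `<=` Om -> near_affine F T c P ->
  exists Q, [/\ measurable (Q : set X), P `<=` Q, Q `<=` Om & near_affine F T c Q].
Proof.
move=> c0 POm aP; have [->|/set0P Pn0] := eqVneq P set0; first by exists set0; split.
have bRk := @Vball_is_base R false Rk _ (map_mx ratr) rV_rat_approx.
have [p [pP Pp]] := is_base_dense_subset bRk Pn0.
exists (Om `&` closure (range p) `&` \bigcap_i approx_set T c (p i)); split.
- apply: measurableI.
    apply: measurableI; first exact: measurable_open_rV.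
    by apply: measurable_closed_rV; exact: closed_closure.
  rewrite -[X in measurable X]setCK setC_bigcap; apply: measurableC.
  apply: countable_bigcupT_measurable => [|i]; first exact: countableP.
  by apply: measurableC; exact: measurable_approx_set.
- move=> x Px; split; first by split; [exact: POm|exact: Pp].
  by move=> i _; split; [exact: POm|exact: aP].
- by move=> x [[]].
move=> x y [[Ox xp] xA] [[Oy _] yA]; apply/ler_addgt0Pr => e e0.
have c20 : 0 < 2 * c + 1 by rewrite ltr_wpDl// mulr_ge0.
have [_ [[i _ <-]]] := xp _ (nbhsx_ballx x (e / (2 * c + 1)) (divr_gt0 e0 c20)).
rewrite -ball_normE/= ltr_pdivlMr// => xpi.
have [_ errx] := xA i Logic.I; have [_ erry] := yA i Logic.I.
rewrite (linear_errorB _ (p i)) (le_trans (ler_normB _ _))// (le_trans (lerD errx erry))//.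
have ypi : `|y - p i| <= `|x - y| + `|x - p i|.
  by rewrite -(subrKA x y) (le_trans (ler_normD _ _))// distrC.
have := ler_wpM2l c0 ypi; have := normr_ge0 (x - p i); lra.
Qed.

End approximation_points.

Section linear_pieces.
Context {R : realType} {k : nat}.
Local Notation Rk := 'rV[R]_k.+1.
Local Notation Mk := 'M[R]_k.+1.
Local Notation X := (caratheodory_type (@leb R k)).
Local Notation unit_ball := (eball (0 : Rk) 1).
Implicit Types (x y u : Rk) (S T : Mk).
Variables (Om : set Rk) (F : Rk -> Rk) (kap : R).
Hypotheses (oOm : open Om) (mF : lmeas_fun Om F) (kap01 : 0 < kap < 1).

Let kap0 : 0 < kap. Proof. by case/andP: kap01. Qed.
Let kap1 : kap < 1. Proof. by case/andP: kap01. Qed.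

(* A rational matrix, the numbers giving the error and the radius, and the centre of the
   cell in which the points are kept close to each other. *)
Let index : countType := ('M[rat]_k.+1 * nat * nat * 'rV[rat]_k.+1)%type.
Implicit Type i : index.

Definition piece_mx i : Mk := map_mx ratr i.1.1.1.
Definition piece_error i : R := i.1.1.2.+1%:R^-1.
Definition piece_radius i : R := i.1.2.+1%:R^-1.

Definition piece_points i : set Rk :=
  approx_points Om F (piece_mx i) (piece_error i) (piece_radius i) `&`
  [set x | `|x - map_mx ratr i.2| < piece_radius i / (4 * k.+1%:R)].

Definition small_error i := forall u,
  3 * piece_error i * `|u| <= kap * `|u *m piece_mx i|.

Let piece_error_gt0 i : 0 < piece_error i. Proof. by rewrite invr_gt0. Qed.

Lemma small_error_unitmx i : small_error i -> piece_mx i \in unitmx.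
Proof.
move=> small_i; rewrite -row_free_unit; apply: inj_row_free => u uT0.
have := small_i u; rewrite uT0 normr0 mulr0 pmulr_rle0 ?mulr_gt0//.
by rewrite normr_le0 => /eqP.
Qed.

Lemma piece_points_near_affine i : (0 < leb unit_ball)%E ->
  near_affine F (piece_mx i) (3 * piece_error i) (piece_points i).
Proof.
move=> v0 x y [ax xi] [ay yi].
apply: (approx_points_near_affine v0 (ltW (piece_error_gt0 i)) ax ay).
have xy : `|x - y| < 2 * (piece_radius i / (4 * k.+1%:R)).
  rewrite -(subrKA (map_mx ratr i.2) x) (le_lt_trans (ler_normD _ _))//.
  by rewrite mulr_natl mulr2n ltrD// distrC.
rewrite -ltr_pdivlMl ?mulr_gt0// (lt_le_trans xy)// le_eqVlt; apply/orP; left; apply/eqP.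
by move: (k.+1%:R : R) (lt0r_neq0 (ltr0Sn R k)) => t t0; field.
Qed.

Lemma perturbation_bounds S T (C e : R) : 0 < e -> e * (4 * C) < kap ->
  (forall u, `|u| <= C * `|u *m S|) -> (forall u, `|u *m (S - T)| <= e / 2 * `|u|) ->
  forall u, 3 * e * `|u| <= kap * `|u *m T| /\ `|u *m S| <= (1 + kap) * `|u *m T|.
Proof.
move=> e0 eC SC ST u; have k0 := kap0.
have uS : `|u *m S| <= `|u *m T| + e / 2 * `|u|.
  have -> : u *m S = u *m T + u *m (S - T) by rewrite -mulmxDr addrC subrK.
  by rewrite (le_trans (ler_normD _ _))// lerD2l.
have e4u : 4 * (e * `|u|) <= kap * `|u *m S|.
  have := ler_wpM2l (ltW e0) (SC u).
  have := ler_wpM2r (normr_ge0 (u *m S)) (ltW eC); lra.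
have kuS : kap * `|u *m S| <= kap * `|u *m T| + kap * (e / 2 * `|u|).
  by rewrite -mulrDr ler_wpM2l// ltW.
have eu0 : 0 <= e * `|u| by rewrite mulr_ge0// ltW.
have keu : kap * (e / 2 * `|u|) <= e / 2 * `|u|.
  by rewrite ler_piMl ?(ltW kap1)// mulrAC mulr_ge0.
by split; lra.
Qed.

Lemma piece_points_cover S x : Om x -> approx_diff Om F S x -> S \in unitmx ->
  exists i, [/\ piece_points i x, small_error i &
    `|\det S| <= (1 + kap) ^+ k.+1 * `|\det (piece_mx i)|].
Proof.
move=> Ox dS uS; have v0 := density_point_eball_gt0 (dS _ ltr01).
have [C C0 SC] := norm_mulmx_bound (invmx S).
have lowS u : `|u| <= C * `|u *m S| by rewrite -{1}(mulmxK uS u).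
have /ltr_add_invr[n] : 0 < kap / (4 * C) by rewrite divr_gt0// mulr_gt0.
rewrite add0r ltr_pdivlMr ?mulr_gt0//; set e : R := n.+1%:R^-1 => eC.
have e0 : 0 < e by rewrite invr_gt0.
have [Q SQ] := mx_rat_approx S (divr_gt0 (divr_gt0 e0 (ltr0n _ 2)) (ltr0Sn _ k)).
have ST u : `|u *m (S - map_mx ratr Q)| <= e / 2 * `|u|.
  rewrite (le_trans (norm_mulmx_le u _ (fun p q => ltW (SQ p q))))//.
    by rewrite !divr_ge0// ltW.
  by rewrite [k.+1%:R * _]mulrC divfK// pnatr_eq0.
have [d d0 dx] := approx_diff_points oOm mF Ox dS e0 ST.
have /ltr_add_invr[m] := d0; rewrite add0r => /ltW md.
have [|q xq] := @rV_rat_approx R k x (m.+1%:R^-1 / (4 * k.+1%:R)).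
  by rewrite divr_gt0 ?invr_gt0// mulr_gt0.
have bounds := perturbation_bounds e0 eC lowS ST.
pose i : index := (Q, n, m, q).
have small_i : small_error i by move=> u; exact: (bounds u).1.
have uT := small_error_unitmx small_i.
exists i; split => //; first by split => //; exact: dx.
rewrite -{1}(mulKVmx uT S) det_mulmx normrM mulrC ler_wpM2r//.
apply: det_le_lipschitz => //.
- by rewrite unitmx_mul unitmx_inv uT.
- by rewrite addr_gt0.
- by move=> u; rewrite mulmxA; have := (bounds (u *m invmx (piece_mx i))).2; rewrite mulmxKV.
Qed.

Lemma linear_pieces : exists (P : nat -> set Rk) (T : nat -> Mk),
  [/\ forall j, measurable (P j : set X) /\ P j `<=` Om, forall j, T j \in unitmx,
    forall j, near_linear F (T j) kap (P j) &
    forall x S, Om x -> approx_diff Om F S x -> S \in unitmx ->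
      exists2 j, P j x & `|\det S| <= (1 + kap) ^+ k.+1 * `|\det (T j)|].
Proof.
have [v0|nv0] := pselect (0 < leb unit_ball)%E; last first.
  exists (fun=> set0), (fun=> 1%:M); split => [j|j|j x y|x S _ /(_ 1 ltr01)]//.
  - by split => //; exact: measurable0.
  - exact: unitmx1.
  - by move=> /density_point_eball_gt0.
have /choice[Q QP] i : exists Q : set Rk, [/\ measurable (Q : set X), Q `<=` Om,
    piece_points i `<=` Q & near_affine F (piece_mx i) (3 * piece_error i) Q].
  have [||Q [mQ PQ QOm aQ]] := near_affine_enlarge oOm mF _ _ (@piece_points_near_affine i v0).
  - by rewrite mulr_ge0// ltW.
  - by move=> x [[]].
  - by exists Q.
pose pick_index j := if unpickle j is Some i then
  if `[< small_error i >] then Some (i : index) else None else None.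
have pickP j i : pick_index j = Some i -> small_error i.
  by rewrite /pick_index; case: unpickle => // i'; case: asboolP => // ? [<-].
exists (fun j => if pick_index j is Some i then Q i else set0),
  (fun j => if pick_index j is Some i then piece_mx i else 1%:M); split.
- move=> j; case: (pick_index j) => [i|]; first by have [] := QP i.
  by split => //; exact: measurable0.
- move=> j; case E: (pick_index j) => [i|]; last exact: unitmx1.
  exact: small_error_unitmx (pickP _ _ E).
- move=> j; case E: (pick_index j) => [i|]// x y Qx Qy.
  have [_ _ _ aQ] := QP i; exact: le_trans (aQ _ _ Qx Qy) (pickP _ _ E _).
move=> x S Ox dS uS; have [i [ix small_i detS]] := piece_points_cover Ox dS uS.
have pickE : pick_index (pickle i) = Some i.
  by rewrite /pick_index pickleK; case: asboolP.
by exists (pickle i); rewrite pickE//; have [_ _ + _] := QP i; apply.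
Qed.

End linear_pieces.

Section area_pieces.
Context {R : realType} {k : nat}.
Local Notation Rk := 'rV[R]_k.+1.
Local Notation Mk := 'M[R]_k.+1.
Local Notation X := (caratheodory_type (@leb R k)).
Implicit Types (x y : Rk) (B E : set Rk).
Variables (Om : set Rk) (F : Rk -> Rk) (gam : X -> R) (c kap : R).
Hypotheses (oOm : open Om) (mF : lmeas_fun Om F).
Hypotheses (luzin : luzinN F Om) (nF : null_preimages Om F).
Hypotheses (mgam : measurable_fun (Om : set X) gam) (gam0 : forall x, 0 <= gam x).
Hypothesis gamJ : ae_on Om (fun x => gam x <= c * `|Jac Om F x|).
Hypotheses (c0 : 0 <= c) (kap01 : 0 < kap < 1).

Let kap0 : 0 < kap. Proof. by case/andP: kap01. Qed.
Let kap1 : kap < 1. Proof. by case/andP: kap01. Qed.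
Let mOm : measurable (Om : set X). Proof. exact: measurable_open_rV. Qed.

Let mgamS (D : set X) : D `<=` Om -> measurable_fun D (fun x => (gam x)%:E).
Proof. by move=> DOm; apply/measurable_EFinP; exact: measurable_funS DOm mgam. Qed.

Lemma Jac_neq0_approx_diff x : Jac Om F x != 0 ->
  exists2 S, approx_diff Om F S x & Jac Om F x = \det S.
Proof.
rewrite /Jac; case: pselect => [dF _|_]; last by rewrite eqxx.
by exists (projT1 (cid dF)) => //; exact: projT2 (cid dF).
Qed.

Lemma jacobian_pieces : exists (Q : nat -> set X) (T : nat -> Mk),
  [/\ trivIset setT Q, forall j, measurable (Q j) /\ Q j `<=` Om, forall j, T j \in unitmx,
    forall j, near_linear F (T j) kap (Q j) /\
      forall x, Q j x -> gam x <= c * ((1 + kap) ^+ k.+1 * `|\det (T j)|) &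
    ae_on Om (fun x => gam x != 0 -> (\bigcup_j Q j) x)].
Proof.
have [P [T [mP uT lP cover]]] := linear_pieces oOm mF kap01.
pose bound j := c * ((1 + kap) ^+ k.+1 * `|\det (T j)|).
pose P' j : set X := P j `&` (Om `&` [set x | gam x <= bound j]).
have mP' j : measurable (P' j).
  apply: measurableI; first by have [] := mP j.
  by apply: (measurable_fun_le mOm mgam); exact: measurable_cst.
have QP' j : seqDU P' j `<=` P' j by move=> x [].
exists (seqDU P'), T; split => [|j|//|j|].
- exact: trivIset_seqDU.
- split; last by move=> x /QP'[_ []].
  by apply: measurableD => //; apply: bigsetU_measurable => i _; exact: mP'.
- by split; [apply: near_linearS (lP j) => x /QP'[]|move=> x /QP'[_ []]].
apply: ae_onS gamJ => x Ox gx gx0; rewrite -seqDU_bigcup_eq.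
have J0 : Jac Om F x != 0.
  apply: contraTneq gx => ->; rewrite normr0 mulr0 -ltNge lt0r gx0; exact: gam0.
have [S dS JS] := Jac_neq0_approx_diff J0.
have [|j Pjx detS] := cover x S Ox dS; first by rewrite unitmxE unitfE -JS.
exists j => //; split => //; split => //=.
by rewrite (le_trans gx)// JS ler_wpM2l.
Qed.

Lemma integral_piece_le (E : set X) T : measurable E -> E `<=` Om -> T \in unitmx ->
  near_linear F T kap E ->
  (forall x, E x -> gam x <= c * ((1 + kap) ^+ k.+1 * `|\det T|)) ->
  (\int[@lebX R k]_(x in E) (gam x)%:E <=
   (c * ((1 + kap) / (1 - kap)) ^+ k.+1)%:E * leb (F @` E))%E.
Proof.
move=> mE EOm uT lE gamE; pose bound := c * ((1 + kap) ^+ k.+1 * `|\det T|).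
have k1 : 0 <= 1 + kap by rewrite addr_ge0// ltW.
apply: (@le_trans _ _ (\int[@lebX R k]_(x in E) (cst bound%:E) x)%E).
  apply: ge0_le_integral; [exact: mE|by move=> x _; rewrite lee_fin|exact: mgamS
    |exact: measurable_cst|by move=> x Ex; rewrite lee_fin; exact: gamE].
rewrite integral_cst// /bound mulrA EFinM -muleA exprMn mulrA [X in (_ <= X * _)%E]EFinM -muleA.
apply: lee_wpmul2l; first by rewrite lee_fin mulr_ge0// exprn_ge0.
exact: leb_near_linear_image.
Qed.

Lemma integral_outside_pieces (U : set X) (E : set X) : measurable U -> measurable E ->
  E `<=` Om -> ae_on Om (fun x => gam x != 0 -> U x) ->
  (\int[@lebX R k]_(x in E) (gam x)%:E = \int[@lebX R k]_(x in E `&` U) (gam x)%:E)%E.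
Proof.
move=> mU mE EOm aeU; set Z := Om `&` [set x | ~ (gam x != 0 -> U x)] in aeU.
have mZ : measurable (Z : set X) by exact: null_measurable.
have gE0 (D : set X) x : D x -> (0 <= (gam x)%:E)%E by rewrite lee_fin.
have mED : measurable (E `\` U) by exact: measurableD.
have dEU : [disjoint E `&` U & E `\` U].
  by rewrite disj_set2E; apply/eqP/seteqP; split => x // -[[_ Ux] [_ nUx]].
have mEU : measurable (E `&` U) by exact: measurableI.
have mgU : measurable_fun (E `&` U `|` E `\` U) (fun x => (gam x)%:E).
  by rewrite setUIDK; exact: mgamS.
rewrite -{1}(setUIDK E U) (ge0_integral_setU _ mEU mED mgU (gE0 _) dEU).
rewrite [X in (_ + X)%E](_ : _ = 0%E) ?adde0//.
have mg : measurable_fun (E `\` U) (fun x => (gam x)%:E) by apply: mgamS => x [/EOm].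
rewrite (@ge0_negligible_integral _ _ _ (@lebX R k) _ Z _ mZ mED mg (gE0 _) aeU).
apply: integral0_eq => x [[Ex nUx] nZx]; congr EFin; apply/eqP.
apply: contraPT nUx => gx nUx; apply: nZx; split; first exact: EOm.
by move=> /(_ gx).
Qed.

Lemma area_pieces : exists Q : nat -> set Rk, [/\ trivIset setT Q, forall j, Q j `<=` Om,
  forall j, measurable (F @` Q j : set X) &
  forall B, measurable (B : set X) ->
    (\int[@lebX R k]_(x in Om `&` F @^-1` B) (gam x)%:E <=
     \sum_(j <oo) (c * ((1 + kap) / (1 - kap)) ^+ k.+1)%:E * leb (B `&` F @` Q j))%E].
Proof.
have [Q [T [tQ mQ uT lQ aeQ]]] := jacobian_pieces.
exists Q; split => // [j|j|B mB].
- by have [] := mQ j.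
- have [C C0 lipC] := near_linear_lipschitz (ltW kap0) (lQ j).1.
  by have [mQj QOm] := mQ j; exact: (measurable_image_lipschitz luzin mQj QOm lipC).
set E : set X := Om `&` F @^-1` B.
have mE : measurable E by exact: measurable_preimage.
have mEQ j : measurable (E `&` Q j) by apply: measurableI => //; have [] := mQ j.
have EOm : E `<=` Om by move=> x [].
rewrite (integral_outside_pieces (U := \bigcup_j Q j))//; last first.
  by apply: bigcup_measurable => j _; have [] := mQ j.
rewrite setI_bigcupr ge0_integral_bigcup; [|exact: mEQ|by apply: mgamS => x [j _ [/EOm]]
  |by move=> x _; rewrite lee_fin|]; last first.
  apply/trivIsetP => i j _ _ ij; apply/seteqP; split => x // -[[_ Qi] [_ Qj]].
  by have /trivIsetP/(_ i j Logic.I Logic.I ij)/seteqP[/(_ x) + _] := tQ; apply.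
apply: lee_nneseries => [j _ _|j _]; first by apply: integral_ge0 => x _; rewrite lee_fin.
have -> : B `&` F @` Q j = F @` (E `&` Q j).
  apply/seteqP; split => [y [By [x Qx xE]]|_ [x [[Ox Bx] Qx] <-]]; last first.
    by split => //; exists x.
  by exists x => //; split => //; split; [exact: (mQ j).2|rewrite /= xE].
apply: (integral_piece_le (mEQ j) _ (uT j)) => [x [/EOm]//||x [_ Qx]].
  by apply: near_linearS (lQ j).1 => x [].
exact: (lQ j).2.
Qed.

End area_pieces.

Section multiplicity.
Context {R : realType} {k : nat}.
Local Notation Rk := 'rV[R]_k.+1.
Local Notation X := (caratheodory_type (@leb R k)).
Variables (N : nat) (Om : set Rk) (f : 'I_N -> Rk -> Rk) (K : nat).
Implicit Types (F : Rk -> Rk) (x y : Rk).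

Definition fibre_exceeds F y := exists s : seq Rk,
  [/\ uniq s, size s = K.+1 & forall x, x \in s -> Om x /\ F x = y].

Lemma sum_indic_images_le (Q : nat -> set Rk) F m y :
  trivIset setT Q -> (forall j, Q j `<=` Om) -> ~ fibre_exceeds F y ->
  \sum_(j < m) (\1_(F @` Q j) y : R) <= K%:R.
Proof.
move=> tQ QOm noS; pose hit j := y \in F @` Q j.
have -> : \sum_(j < m) (\1_(F @` Q j) y : R) = (count hit (iota 0 m))%:R.
  rewrite -(big_mkord xpredT (fun j => \1_(F @` Q j) y)) -sum1_count natr_sum.
  rewrite [RHS]big_mkcond/= /index_iota subn0; apply: eq_bigr => j _.
  by rewrite indicE /hit; case: (_ \in _).
rewrite ler_nat leqNgt; apply/negP => Klt; apply: noS.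
have /choice[g gP] j : exists x, hit j -> Q j x /\ F x = y.
  have [|] := boolP (hit j); last by exists 0.
  by rewrite /hit inE => -[x Qx xy]; exists x.
pose js := [seq j <- iota 0 m | hit j].
have gQ j : j \in js -> Q j (g j) /\ F (g j) = y by rewrite mem_filter => /andP[/gP].
exists (take K.+1 (map g js)); split.
- apply: take_uniq; rewrite map_inj_in_uniq ?filter_uniq ?iota_uniq//.
  move=> i j /gQ[Qi _] /gQ[Qj _] gij; apply: contrapT => /eqP ij.
  have /trivIsetP/(_ i j Logic.I Logic.I ij)/seteqP[+ _] := tQ => /(_ (g i)).
  by apply; split => //; rewrite gij.
- by rewrite size_takel// size_map size_filter.
- by move=> x /mem_take/mapP[j /gQ[Qj Fj] ->]; split => //; exact: QOm Qj.
Qed.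

Let L := Lconst Om f.

Definition overlap : set Rk := \bigcup_(S : {set 'I_N})
  (if (L < #|S|)%N then \bigcap_(n in [set n | n \in S]) (f n @` Om) else set0).

Lemma overlap_null : leb overlap = 0%E.
Proof.
apply: null_bigcup_count => S; case: ifPn => [LS|_]; last exact: leb0.
apply/eqP; rewrite eq_le leb_ge0 andbT leNgt; apply/negP => S0.
move: LS; rewrite ltnNge; apply/negP; rewrite negbK.
by apply: (@leq_bigmax_cond _ _ (fun S : {set 'I_N} => #|S|)); apply/asboolP.
Qed.

Lemma overlap_count y : ~ overlap y -> (#|[set n | `[< (f n @` Om) y >]]%SET| <= L)%N.
Proof.
move=> no; rewrite leqNgt; apply/negP => LS; apply: no.
exists [set n | `[< (f n @` Om) y >]]%SET => //; rewrite LS => n /=.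
by rewrite inE => /asboolP.
Qed.

Hypothesis fOm : forall n x, Om x -> Om (f n x).
Hypothesis fK : forall n, leb [set y | Om y /\ fibre_exceeds (f n) y] = 0%E.

Lemma image_multiplicity_le (Q : 'I_N -> nat -> set Rk) y :
  (forall n, trivIset setT (Q n)) -> (forall n j, Q n j `<=` Om) -> ~ overlap y ->
  (forall n, ~ (Om y /\ fibre_exceeds (f n) y)) ->
  (\sum_n \sum_(j <oo) (\1_(f n @` Q n j) y)%:E <= (K * L)%:R%:E :> \bar R)%E.
Proof.
move=> tQ QOm no nfib.
apply: (@le_trans _ _ (\sum_(n < N) (if `[< (f n @` Om) y >] then K%:R else 0)%:E)%E).
  apply: lee_sum => n _; case: asboolP => fy; last first.
    rewrite eseries0// => j _ _; rewrite indicE memNset// => -[x /QOm Ox xy].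
    by apply: fy; exists x.
  apply: lime_le; first by apply: is_cvg_nneseries.
  apply: nearW => m; rewrite sumEFin lee_fin big_mkord.
  apply: sum_indic_images_le => // fib; apply: (nfib n); split => //.
  by case: fy => x Ox <-; exact: fOm.
rewrite sumEFin lee_fin -big_mkcond/= sumr_const -[leLHS]mulr_natr -natrM ler_nat.
rewrite leq_mul2l; apply/orP; right.
apply: leq_trans (overlap_count no); apply: eq_leq.
by apply: eq_card => n; rewrite !inE.
Qed.

Lemma ae_image_multiplicity_le (Q : 'I_N -> nat -> set Rk) :
  (forall n, trivIset setT (Q n)) -> (forall n j, Q n j `<=` Om) ->
  {ae @lebX R k, forall y,
    (\sum_n \sum_(j <oo) (\1_(f n @` Q n j) y)%:E <= (K * L)%:R%:E :> \bar R)%E}.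
Proof.
move=> tQ QOm; pose Z := overlap `|` \bigcup_n [set y | Om y /\ fibre_exceeds (f n) y].
have Z0 : leb Z = 0%E by apply: null_setU; [exact: overlap_null|exact: null_bigcup_count].
exists Z; split => //; first exact: null_measurable.
move=> y; apply: contra_notP => /not_orP[no nfib].
by apply: image_multiplicity_le => // n fib; apply: nfib; exists n.
Qed.

Lemma integral_image_multiplicity_le (Q : 'I_N -> nat -> set Rk) (B : set X) :
  (forall n, trivIset setT (Q n)) -> (forall n j, Q n j `<=` Om) ->
  (forall n j, measurable (f n @` Q n j : set X)) -> measurable B ->
  (\int[@lebX R k]_(y in B) (\sum_n \sum_(j <oo) (\1_(f n @` Q n j) y)%:E) <=
   (K * L)%:R%:E * leb B)%E.
Proof.
move=> tQ QOm mD mB; rewrite -(integral_cst (@lebX R k) mB (K * L)%:R%:E).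
apply: ae_ge0_le_integral.
- exact: mB.
- by move=> y _; apply: sume_ge0 => n _; exact: nneseries_ge0.
- apply: emeasurable_sum => n; apply: ge0_emeasurable_sum => // j _.
  by apply/measurable_EFinP; exact: measurable_indic.
- by move=> y _; rewrite lee_fin.
- exact: measurable_cst.
- have [Z [mZ Z0 multZ]] := ae_image_multiplicity_le tQ QOm.
  by exists Z; split => // y /= /not_implyP[_ nmult]; exact: multZ.
Qed.

Variables (gam : 'I_N -> X -> R) (alpha : R).
Hypotheses (oOm : open Om) (mf : forall n, lmeas_fun Om (f n)).
Hypotheses (luzin : forall n, luzinN (f n) Om) (nullf : forall n, null_preimages Om (f n)).
Hypotheses (mgam : forall n, measurable_fun (Om : set X) (gam n)).
Hypotheses (gam0 : forall n x, 0 <= gam n x) (alpha0 : 0 <= alpha).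
Hypothesis gamJ : forall n,
  ae_on Om (fun x => gam n x <= alpha / (K * L)%:R * `|Jac Om (f n) x|).

Lemma area_bound_approx (B : set X) (kap : R) : measurable B -> 0 < kap < 1 ->
  (\sum_n \int[@lebX R k]_(x in Om `&` f n @^-1` B) (gam n x)%:E <=
   (alpha * ((1 + kap) / (1 - kap)) ^+ k.+1)%:E * leb B)%E.
Proof.
move=> mB kap01; have /andP[kap0 kap1] := kap01.
pose c := alpha / (K * L)%:R; have c0 : 0 <= c by rewrite divr_ge0.
pose rho := ((1 + kap) / (1 - kap)) ^+ k.+1.
have rho0 : 0 <= rho.
  by apply: exprn_ge0; apply: divr_ge0; [rewrite addr_ge0// ltW|rewrite subr_ge0 ltW].
have /choice[Q QP] n :=
  area_pieces oOm (mf n) (@luzin n) (@nullf n) (mgam n) (gam0 n) (gamJ n) c0 kap01.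
have mind n j : measurable_fun B (fun x : X => (\1_(f n @` Q n j) x)%:E : \bar R).
  by apply/measurable_EFinP; apply: measurable_indic; have [] := QP n.
have crho0 : (0 <= (c * rho)%:E)%E by rewrite lee_fin mulr_ge0.
have int_le n : (\int[@lebX R k]_(x in Om `&` f n @^-1` B) (gam n x)%:E <=
    (c * rho)%:E * \int[@lebX R k]_(x in B) \sum_(j <oo) (\1_(f n @` Q n j) x)%:E)%E.
  rewrite integral_nneseries// -nneseriesZl//; last by move=> j _; exact: integral_ge0.
  have [_ _ mD area] := QP n; apply: le_trans (area B mB) _.
  by under [leRHS]eq_eseriesr do rewrite integral_indic// setIC.
apply: (@le_trans _ _ ((c * rho)%:E * \int[@lebX R k]_(x in B)
    \sum_n \sum_(j <oo) (\1_(f n @` Q n j) x)%:E)%E).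
  rewrite ge0_integral_sum; [|exact: mB|by move=> n; exact: ge0_emeasurable_sum
    |by move=> n x _; exact: nneseries_ge0].
  rewrite ge0_sume_distrr; last by move=> n _; apply: integral_ge0 => x _; exact: nneseries_ge0.
  by apply: lee_sum => n _; exact: int_le.
apply: (@le_trans _ _ ((c * rho)%:E * ((K * L)%:R%:E * leb B))%E).
  apply: lee_wpmul2l => //; apply: integral_image_multiplicity_le => //.
  - by move=> n; have [] := QP n.
  - by move=> n j; have [_ + _ _] := QP n; apply.
  - by move=> n j; have [] := QP n.
rewrite muleA -EFinM lee_wpmul2r ?leb_ge0// lee_fin mulrAC ler_wpM2r// /c.
have [->|KL0] := eqVneq (K * L)%N 0%N; first by rewrite mulr0.
by rewrite divfK// pnatr_eq0.
Qed.

Lemma cvg_distortion :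
  alpha * ((1 + m.+2%:R^-1) / (1 - m.+2%:R^-1)) ^+ k.+1 @[m --> \oo] --> alpha.
Proof.
rewrite -[X in _ --> X](_ : alpha * ((1 + 0) / (1 - 0)) ^+ k.+1 = alpha); last first.
  by rewrite addr0 subr0 divr1 expr1n mulr1.
have inv0 : (m.+2%:R^-1 : R) @[m --> \oo] --> (0 : R).
  by have := @cvg_harmonic R; rewrite -(cvg_shiftS (@harmonic R) (nbhs 0)).
have ratio1 : (1 + m.+2%:R^-1) / (1 - m.+2%:R^-1) @[m --> \oo] --> (1 + 0 : R) / (1 - 0).
  apply: cvgM; first by apply: cvgD => //; exact: cvg_cst.
  apply: cvgV; first by rewrite subr0 oner_neq0.
  by apply: cvgB => //; exact: cvg_cst.
apply: cvgM; first exact: cvg_cst.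
exact: (cvg_comp _ _ ratio1 (@exprn_continuous R k.+1 _)).
Qed.

Lemma area_bound (B : set X) : measurable B ->
  (\sum_n \int[@lebX R k]_(x in Om `&` f n @^-1` B) (gam n x)%:E <= alpha%:E * leb B)%E.
Proof.
move=> mB; set I := (\sum_n _)%E.
have bound m : (I <= (alpha * ((1 + m.+2%:R^-1) / (1 - m.+2%:R^-1)) ^+ k.+1)%:E * leb B)%E.
  by apply: area_bound_approx => //; rewrite invr_gt0 ltr0n/= invf_lt1// ltr1n.
have [By|] := eqVneq (leb B) +oo%E.
  move: alpha0; rewrite le_eqVlt => /predU1P[a0|a0].
    by have := bound 0%N; rewrite -a0 mul0r.
  by rewrite By gt0_muley ?leey// lte_fin.
rewrite -ltey => Bfin; have {}Bfin : leb B \is a fin_num by rewrite ge0_fin_numE ?leb_ge0.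
pose distortion m : R := alpha * ((1 + m.+2%:R^-1) / (1 - m.+2%:R^-1)) ^+ k.+1.
have cv : (distortion m * fine (leb B))%:E @[m --> \oo] --> (alpha * fine (leb B))%:E.
  apply: cvg_EFin; first exact: nearW.
  by apply: cvgM; [exact: cvg_distortion|exact: cvg_cst].
rewrite -(fineK Bfin) -EFinM -(cvg_lim _ cv)//; apply: lime_ge.
  by apply/cvg_ex; eexists; exact: cv.
by apply: nearW => m; rewrite EFinM fineK//; exact: bound.
Qed.

End multiplicity.

(** * The elementary solution *)

Section absolute_series.
Context {R : realType} {b : bool} {V : completeNormedModType (Kof R b)}.
Variables (a : nat -> V) (c : nat -> \bar R).
Hypotheses (ac : forall i, ((Vnorm (a i))%:E <= c i)%E)
  (cfin : (\sum_(0 <= i <oo) c i < +oo)%E).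

Let c0 i : (0 <= c i)%E.
Proof. by apply: le_trans (ac i); rewrite lee_fin Vnorm_ge0. Qed.

Lemma Vnorm_partial_sum_le j m :
  ((Vnorm (\sum_(j <= i < m) a i))%:E <= \sum_(j <= i <oo) c i)%E.
Proof.
apply: (@le_trans _ _ (\sum_(j <= i < m) (Vnorm (a i))%:E)%E).
  by rewrite sumEFin lee_fin Vnorm_sum.
apply: (@le_trans _ _ (\sum_(j <= i < m) c i)%E); first by apply: lee_sum => i _.
by apply: nneseries_lim_ge => i _ _.
Qed.

Definition tail_sum j : V := lim ((fun m => \sum_(j <= i < m) a i) @ \oo).

Lemma tail_sum_cvg j : (fun m => \sum_(j <= i < m) a i) @ \oo --> tail_sum j.
Proof.
have tail0 : (\sum_(n <= i <oo) c i)%E @[n --> \oo] --> 0%E by exact: nneseries_tail_cvg.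
have cv0 : cvg (series a @ \oo).
  apply/cauchy_cvgP/cauchy_seriesP => e /gt0_RtoK[r r0 ->].
  have [M _ tailM] := tail0 _ (nbhs_open_ereal_lt (f := fun=> r) r0).
  exists ([set n | (M <= n)%N], setT); first by split => //=; [exists M|exact: filterT].
  move=> [n m] [/= Mn _]; rewrite VnormE ltr_RtoK -lte_fin.
  exact: le_lt_trans (Vnorm_partial_sum_le n m) (tailM n Mn).
suff cvj : (fun m => \sum_(j <= i < m) a i) @ \oo --> lim (series a @ \oo) - series a j.
  by rewrite /tail_sum; apply/cvg_ex; exists (lim (series a @ \oo) - series a j).
have : (fun m => series a m - series a j) @ \oo --> lim (series a @ \oo) - series a j.
  by apply: cvgB => //; exact: cvg_cst.
apply: cvg_trans; apply: near_eq_cvg; near=> m.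
have jm : (j <= m)%N by near: m; exact: nbhs_infty_ge.
by rewrite sub_series_geq.
Unshelve. all: by end_near. Qed.

Lemma tail_sum_split j m : (j <= m)%N -> tail_sum j = \sum_(j <= i < m) a i + tail_sum m.
Proof.
move=> jm.
suff cvj : (fun n => \sum_(j <= i < n) a i) @ \oo --> \sum_(j <= i < m) a i + tail_sum m.
  by rewrite {1}/tail_sum; apply: cvg_lim => //; exact: norm_hausdorff.
have : (fun n => \sum_(j <= i < m) a i + \sum_(m <= i < n) a i) @ \oo -->
    \sum_(j <= i < m) a i + tail_sum m.
  by apply: cvgD; [exact: cvg_cst|exact: tail_sum_cvg].
apply: cvg_trans; apply: near_eq_cvg; near=> n.
have mn : (m <= n)%N by near: n; exact: nbhs_infty_ge.
by rewrite [RHS](big_cat_nat (n := m)) //=.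
Unshelve. all: by end_near. Qed.

Lemma Vnorm_tail_sum_le j : ((Vnorm (tail_sum j))%:E <= \sum_(j <= i <oo) c i)%E.
Proof.
apply/lee_addgt0Pr => r r0.
have [M _ cvM] := (Vnorm_cvgP _ _).1 (@tail_sum_cvg j) r r0.
apply: le_trans (leeD2r _ (Vnorm_partial_sum_le j M)).
rewrite -EFinD lee_fin -{1}(subrK (\sum_(j <= i < M) a i) (tail_sum j)) addrC.
by rewrite (le_trans (VnormD _ _))// lerD2l ltW// (cvM M (leqnn M)).
Qed.

End absolute_series.

Section psi_norm.
Context {R : realType} {k : nat}.
Local Notation Rk := 'rV[R]_k.+1.
Local Notation X := (caratheodory_type (@leb R k)).
Variables (psi : R -> R) (gpsi : good_psi psi) (Om : set Rk) (oOm : open Om).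
Variables (b : bool) (V : completeNormedModType (Kof R b)).
Local Notation Rpos := [set s : R | (0 <= s)%R].
Local Notation lor := (lorentz (@lebX R k) (tau_inv psi)).
Implicit Types (h w : Rk -> V) (u : Rk -> R).
Let qpsi := tau_inv_quasiconcave gpsi.

Lemma measurable_distrib (f : \bar R -> \bar R) (C : set Rk) u :
  {homo f : x y / (x <= y)%E} -> measurable_fun Rpos (fun s : R => f (distrib C u s)).
Proof.
move=> homof; apply: nonincreasing_emeasurable => [|s t st]; first exact: measurable_ger.
by apply: homof; apply: le_leb => x [Cx tx]; split => //; exact: le_lt_trans st tx.
Qed.

Definition Vnorm_on h : X -> \bar R := (fun x => (Vnorm (h x))%:E) \_ Om.

Lemma Vnorm_onE h x : Om x -> Vnorm_on h x = (Vnorm (h x))%:E.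
Proof. by move=> Ox; rewrite /Vnorm_on patchT// inE. Qed.

Lemma Vnorm_on_ge0 h x : (0 <= Vnorm_on h x)%E.
Proof. by rewrite /Vnorm_on /patch; case: ifP => // _; rewrite lee_fin Vnorm_ge0. Qed.

Lemma measurable_Vnorm_on h : lmeas_fun Om h -> measurable_fun setT (Vnorm_on h).
Proof.
move=> mh; apply/(measurable_restrictT _ _).1; first exact: measurable_open_rV.
by apply/measurable_EFinP; apply: lmeas_fun_measurable => //; exact: lmeas_fun_Vnorm.
Qed.

Lemma lorentz_Vnorm_on h : lor (Vnorm_on h) = psinorm psi Om h.
Proof.
apply: eq_integral => s /[!inE] /= s0; congr (tau_inv psi); congr (leb _).
apply/seteqP; split => x /=.
  rewrite /Vnorm_on /patch; case: ifPn => [|_]; last by rewrite lte_fin ltNge s0.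
  by rewrite inE => Ox; rewrite lte_fin => sx; split => //; rewrite ger0_norm// Vnorm_ge0.
by move=> [Ox]; rewrite ger0_norm ?Vnorm_ge0// => sx; rewrite Vnorm_onE// lte_fin.
Qed.

Lemma psinorm_ge0 h : (0 <= psinorm psi Om h)%E.
Proof. by rewrite -lorentz_Vnorm_on; apply: lorentz_ge0. Qed.

Lemma psinorm_le_lorentz w (H : X -> \bar R) : measurable_fun setT H ->
  ae_on Om (fun x => ((Vnorm (w x))%:E <= H x)%E) -> (psinorm psi Om w <= lor H)%E.
Proof.
move=> mH aewH; set Z := Om `&` [set x | ~ ((Vnorm (w x))%:E <= H x)%E] in aewH.
apply: ge0_le_integral.
- exact: measurable_ger.
- by move=> s _; apply: (qc_ge0 qpsi); exact: leb_ge0.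
- by apply: measurable_distrib; exact: qc_homo.
- by apply: measurable_distribution => //; [exact: qc_homo|exact: measurable_ger].
move=> s _; apply: (qc_homo qpsi).
apply: (@le_trans _ _ (leb ([set x | (s%:E < H x)%E] `|` Z))).
  apply: le_leb => x [Ox]; rewrite ger0_norm ?Vnorm_ge0// => sx.
  have [wH|nwH] := pselect ((Vnorm (w x))%:E <= H x)%E; last by right.
  by left; apply: lt_le_trans wH; rewrite lte_fin.
apply: le_trans (outer_measureU2 leb _ _) _.
by rewrite [X in (_ + X <= _)%E]aewH adde0.
Qed.

Lemma distrib_le_chord (c : R) (C : set Rk) u s : 0 < c -> leb C = c%:E -> C `<=` Om ->
  (distrib C u s * tau_inv psi c%:E <= c%:E * tau_inv psi (distrib Om u s))%E.
Proof.
move=> c0 cE COm; have dC : (distrib C u s <= c%:E)%E by rewrite -cE; apply: le_leb => x [].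
rewrite (le_trans (qc_chord qpsi c0 _ dC)) ?leb_ge0// lee_wpmul2l ?lee_fin ?(ltW c0)//.
by apply: (qc_homo qpsi); apply: le_leb => x [/COm].
Qed.

Lemma psinormR_L1loc u : (psinormR psi Om u < +oo)%E -> L1loc Om u.
Proof.
move=> ufin C cC COm; have Cfin : leb C \is a fin_num.
  by rewrite ge0_fin_numE ?leb_ge0//; exact: leb_compact_fin.
have [C0|C0] := eqVneq (leb C) 0%E.
  rewrite /int_abs integral0_eq// => s _; apply/eqP; rewrite eq_le leb_ge0 andbT -C0.
  by apply: le_leb => x [].
pose c := fine (leb C); have cE : leb C = c%:E by rewrite fineK.
have c0 : 0 < c by rewrite -lte_fin -cE lt0e C0 leb_ge0.
have pfin : tau_inv psi c%:E \is a fin_num.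
  by rewrite ge0_fin_numE ?(qc_lty qpsi)// ltW// (qc_gt0 qpsi).
have p0 : 0 < fine (tau_inv psi c%:E) by rewrite fine_gt0// (qc_gt0 qpsi)// (qc_lty qpsi).
have mpsi : measurable_fun Rpos (fun s => tau_inv psi (distrib Om u s)).
  by apply: measurable_distrib; exact: qc_homo.
have md : measurable_fun Rpos (distrib C u) by exact: (@measurable_distrib id).
have psi_ge0 s : Rpos s -> (0 <= tau_inv psi (distrib Om u s))%E.
  by move=> _; apply: (qc_ge0 qpsi); exact: leb_ge0.
have d0 s : Rpos s -> (0 <= distrib C u s)%E by move=> _; exact: leb_ge0.
have scaled : (int_abs C u * tau_inv psi c%:E <= c%:E * psinormR psi Om u)%E.
  rewrite -(fineK pfin) -ge0_integralZr//; try exact: measurable_ger; last by rewrite lee_fin ltW.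
  rewrite -ge0_integralZl//; try exact: measurable_ger; last by rewrite lee_fin ltW.
  apply: ge0_le_integral => //; first exact: measurable_ger.
  - by move=> s s0; rewrite mule_ge0 ?d0// lee_fin ltW.
  - by apply: emeasurable_funM => //; exact: measurable_cst.
  - exact: measurable_funeM.
  - by move=> s _; rewrite fineK//; exact: distrib_le_chord.
rewrite ltey; apply: contraTneq scaled => ->; rewrite -ltNge -(fineK pfin).
by rewrite gt0_mulye ?lte_fin// lte_mul_pinfty// lee_fin ltW.
Qed.

Lemma Lpsi_intro w : lmeas_fun Om w -> (psinorm psi Om w < +oo)%E -> Lpsi psi Om w.
Proof.
move=> mw wfin; split => //; split; first exact: lmeas_fun_Vnorm.
by split => //; exact: psinormR_L1loc.
Qed.

End psi_norm.

Section elementary_solution.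
Context {R : realType} {k N : nat} {b : bool} {V : completeNormedModType (Kof R b)}.
Local Notation Rk := 'rV[R]_k.+1.
Local Notation X := (caratheodory_type (@leb R k)).
Variables (Om : set Rk) (f : 'I_N -> Rk -> Rk) (g : 'I_N -> Rk -> Kof R b).
Variables (K : nat) (psi : R -> R) (alpha : R) (p : nat -> V).
Hypotheses (N0 : (0 < N)%N) (oOm : open Om) (dp : dense_family p).
Hypothesis fOm : forall n x, Om x -> Om (f n x).
Hypothesis mf : forall n, lmeas_fun Om (f n).
Hypothesis luzin : forall n, luzinN (f n) Om.
Hypothesis nullf : forall n, null_preimages Om (f n).
Hypothesis fK : forall n, leb [set y | Om y /\ fibre_exceeds Om K (f n) y] = 0%E.
Hypothesis mg : forall n, lmeas_fun Om (g n).
Hypothesis gpsi : good_psi psi.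
Hypotheses (alpha0 : 0 <= alpha) (ahalf : alpha < 1 / 2).
Hypothesis gbound : forall n, ae_on Om (fun x => Knorm (g n x) <=
  alpha * Num.min (`|Jac Om (f n) x| / (K * Lconst Om f)%:R) (N%:R)^-1).

Local Notation P := (Pop g f).
Local Notation lor := (lorentz (@lebX R k) (tau_inv psi)).
Let qpsi := tau_inv_quasiconcave gpsi.

Definition weight n : X -> R := (fun x => Num.min (Knorm (g n x)) (alpha / N%:R)) \_ Om.

(* Outside [Om] the weights vanish, so the values of [selfmap] there are irrelevant. *)
Definition selfmap n : X -> X := fun x => if x \in Om then f n x else x.

Lemma weight_in n x : Om x -> weight n x = Num.min (Knorm (g n x)) (alpha / N%:R).
Proof. by move=> Ox; rewrite /weight patchT// inE. Qed.

Lemma weight_out n x : ~ Om x -> weight n x = 0.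
Proof. by move=> Ox; rewrite /weight patchC// inE. Qed.

Lemma selfmap_in n x : Om x -> selfmap n x = f n x.
Proof. by move=> Ox; rewrite /selfmap mem_set. Qed.

Lemma weight_ge0 n x : 0 <= weight n x.
Proof.
have [Ox|Ox] := pselect (Om x); last by rewrite weight_out.
by rewrite weight_in// le_min Knorm_ge0 divr_ge0.
Qed.

Lemma sum_weight_le x : \sum_n weight n x <= alpha.
Proof.
have N1 : N%:R != 0 :> R by rewrite pnatr_eq0 -lt0n.
apply: (@le_trans _ _ (\sum_(n < N) alpha / N%:R)); last first.
  by rewrite sumr_const card_ord -(mulr_natr (alpha / _)) divfK.
apply: ler_sum => n _; have [Ox|Ox] := pselect (Om x).
  by rewrite weight_in// ge_min lexx orbT.
by rewrite weight_out// divr_ge0.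
Qed.

Lemma measurable_weight n : measurable_fun setT (weight n).
Proof.
apply/(measurable_restrictT _ _).1; first exact: measurable_open_rV.
apply: measurable_minr; last exact: measurable_cst.
apply: lmeas_fun_measurable => //.
by apply: (lmeas_fun_comp (mg n)); exact: (@Vnorm_continuous R b (Kof R b)^o).
Qed.

Lemma measurable_selfmap n : measurable_fun setT (selfmap n).
Proof.
move=> _ B mB; rewrite setTI.
rewrite (_ : _ @^-1` B = (Om `&` f n @^-1` B) `|` (B `\` Om)); last first.
  apply/seteqP; split => x; rewrite /selfmap /=; last first.
    by move=> [[Ox]|[Bx Ox]]; [rewrite mem_set|rewrite memNset].
  case: ifPn => [/set_mem Ox Bx|/negP nO Bx]; [by left|right; split => // Ox].
  by apply: nO; rewrite inE.
apply: measurableU; first exact: (measurable_preimage oOm (mf n) (@nullf n) mB).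
by apply: measurableD => //; exact: measurable_open_rV.
Qed.

Lemma weight_le_Jac n : ae_on Om (fun x => weight n x <=
  alpha / (K * Lconst Om f)%:R * `|Jac Om (f n) x|).
Proof.
apply: ae_onS (gbound n) => x Ox gx; rewrite weight_in// ge_min; apply/orP; left.
by rewrite (le_trans gx)// mulrAC -mulrA ler_wpM2l// ge_min lexx.
Qed.

Lemma weight_Knorm : ae_on Om (fun x => forall n, weight n x = Knorm (g n x)).
Proof.
apply: ae_on_all => n; apply: ae_onS (gbound n) => x Ox gx.
by rewrite weight_in//; apply/min_idPl; rewrite (le_trans gx)// ler_wpM2l// ge_min lexx orbT.
Qed.

Lemma integral_weight_le (A : set X) : measurable A ->
  (\int[@lebX R k]_x (\sum_n (weight n x)%:E * (\1_A (selfmap n x))%:E) <= alpha%:E * lebX A)%E.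
Proof.
move=> mA; rewrite ge0_integral_sum; first last.
- by move=> n x _; rewrite mule_ge0// lee_fin weight_ge0.
- move=> n; apply: emeasurable_funM; apply/measurable_EFinP; first exact: measurable_weight.
  by apply: (measurableT_comp (measurable_indic mA)); exact: measurable_selfmap.
- exact: measurableT.
have mwOm n : measurable_fun (Om : set X) (weight n).
  by apply: measurable_funS (measurable_weight n).
apply: le_trans (area_bound fOm fK oOm mf luzin nullf mwOm weight_ge0 alpha0 weight_le_Jac mA).
apply: lee_sum => n _; rewrite [leRHS]integral_mkcond le_eqVlt.
apply/orP; left; apply/eqP; apply: eq_integral => x _; rewrite /patch.
have [Ox|Ox] := pselect (Om x); last first.
  by rewrite weight_out// mul0e memNset// => -[].
rewrite selfmap_in// indicE; have [Ax|Ax] := pselect (A (f n x)).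
  by rewrite !mem_set// mule1.
by rewrite !memNset ?mule0// => -[].
Qed.

Local Notation Q := (transfer weight selfmap).
Local Notation tail := (operator_tail Q).
Local Notation mod h := (Vnorm_on Om h).
Implicit Types h u : Rk -> V.

Let pQ : positive_operator Q.
Proof.
exact: positive_operator_transfer measurable_weight measurable_selfmap weight_ge0.
Qed.

Let bQ : bounded_operator (@lebX R k) alpha Q.
Proof.
exact: bounded_operator_transfer measurable_weight measurable_selfmap weight_ge0
  alpha0 sum_weight_le integral_weight_le.
Qed.

Let mtail h j : lmeas_fun Om h -> measurable_fun setT (tail j (mod h)).
Proof.
move=> mh; apply: (measurable_operator_tail pQ); last exact: Vnorm_on_ge0.
exact: measurable_Vnorm_on.
Qed.

Let iter_Q_ge0 h i x : (0 <= iter i Q (mod h) x)%E.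
Proof. by apply: (iter_pop_ge0 pQ); exact: Vnorm_on_ge0. Qed.

Lemma lmeas_fun_Pop h : lmeas_fun Om h -> lmeas_fun Om (P h).
Proof.
move=> mh; apply: (lmeas_fun_sum oOm dp) => n; apply: (lmeas_funZ dp) => //.
exact: (lmeas_fun_comp_map oOm (@fOm n) (mf n) (@nullf n) mh).
Qed.

Lemma lmeas_fun_iter_Pop i h : lmeas_fun Om h -> lmeas_fun Om (iter i P h).
Proof. by move=> mh; elim: i => // i; exact: lmeas_fun_Pop. Qed.

Lemma Vnorm_iter_Pop_le h : ae_on Om (fun x => forall i,
  ((Vnorm (iter i P h x))%:E <= iter i Q (mod h) x)%E).
Proof.
apply: ae_on_all; elim => [|i IH].
  by apply: ae_onT => x Ox; rewrite /= Vnorm_onE.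
have IHf : ae_on Om (fun x => forall n,
    ((Vnorm (iter i P h (f n x)))%:E <= iter i Q (mod h) (f n x))%E).
  by apply: ae_on_all => n; exact: (ae_on_comp (@fOm n) (@nullf n) IH).
apply: ae_onS (ae_onI IHf weight_Knorm) => x Ox [hf hw] /=.
apply: (@le_trans _ _ (\sum_n (Knorm (g n x) * Vnorm (iter i P h (f n x)))%:E)%E).
  rewrite sumEFin lee_fin (le_trans (Vnorm_sum _ _ _))//.
  by apply: ler_sum => n _; rewrite VnormZ.
apply: lee_sum => n _; rewrite selfmap_in// hw EFinM.
by apply: lee_wpmul2l => //; rewrite lee_fin Knorm_ge0.
Qed.

Lemma lorentz_tail_le j h : Lpsi psi Om h ->
  (lor (tail j (mod h)) <= ((2 * alpha) ^+ j / (1 - 2 * alpha))%:E * psinorm psi Om h)%E.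
Proof.
move=> [mh [_ [_ hfin]]]; rewrite -lorentz_Vnorm_on.
apply: (lorentz_operator_tail_le pQ bQ qpsi j ahalf (measurable_Vnorm_on oOm mh)
  (Vnorm_on_ge0 Om h)).
by rewrite lorentz_Vnorm_on.
Qed.

Lemma lorentz_tail_fin j h : Lpsi psi Om h -> (lor (tail j (mod h)) < +oo)%E.
Proof.
move=> Lh; apply: le_lt_trans (lorentz_tail_le j Lh) _.
have [_ [_ [_ hfin]]] := Lh; apply: lte_mul_pinfty => //.
have a0 := alpha0; have a1 := ahalf; have double0 : 0 <= 2 * alpha by lra.
have gap0 : 0 <= 1 - 2 * alpha by lra.
by rewrite lee_fin divr_ge0// exprn_ge0.
Qed.

Definition summable h x := (forall i, ((Vnorm (iter i P h x))%:E <= iter i Q (mod h) x)%E) /\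
  (tail 0 (mod h) x < +oo)%E.

Lemma ae_summable h : Lpsi psi Om h -> ae_on Om (summable h).
Proof.
move=> Lh; have mh : lmeas_fun Om h by case: Lh.
apply: ae_onI; first exact: Vnorm_iter_Pop_le.
have := lorentz_pinfty qpsi (mtail 0 mh) (lorentz_tail_fin 0 Lh).
apply: null_subset => x [_ /negP]; rewrite -leNgt leye_eq => /eqP; exact.
Qed.

Definition series_tail h j x := tail_sum (fun i => iter i P h x) j.

Lemma series_tail_cvg h j x : summable h x ->
  \sum_(j <= i < m) iter i P h x @[m --> \oo] --> series_tail h j x.
Proof. by case=> normP tailfin; exact: (tail_sum_cvg normP tailfin). Qed.

Lemma Vnorm_series_tail_le h j x : summable h x ->
  ((Vnorm (series_tail h j x))%:E <= tail j (mod h) x)%E.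
Proof. by case=> normP tailfin; exact: (Vnorm_tail_sum_le normP tailfin). Qed.

Lemma lmeas_fun_series_tail h j : Lpsi psi Om h -> lmeas_fun Om (series_tail h j).
Proof.
move=> Lh; have mh : lmeas_fun Om h by case: Lh.
apply: (lmeas_fun_cvg oOm dp (F := fun m x => \sum_(j <= i < m) iter i P h x)).
  by move=> m; apply: (lmeas_fun_sum oOm dp) => i; exact: lmeas_fun_iter_Pop.
by apply: ae_onS (ae_summable Lh) => x Ox; exact: series_tail_cvg.
Qed.

Lemma psinorm_series_tail_le h j : Lpsi psi Om h ->
  (psinorm psi Om (series_tail h j) <=
    ((2 * alpha) ^+ j / (1 - 2 * alpha))%:E * psinorm psi Om h)%E.
Proof.
move=> Lh; have mh : lmeas_fun Om h by case: Lh.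
apply: le_trans (lorentz_tail_le j Lh).
apply: psinorm_le_lorentz => //; first exact: mtail.
by apply: ae_onS (ae_summable Lh) => x _; exact: Vnorm_series_tail_le.
Qed.

Lemma Lpsi_le_tail h (w : Rk -> V) j : Lpsi psi Om h -> lmeas_fun Om w ->
  ae_on Om (fun x => ((Vnorm (w x))%:E <= tail j (mod h) x)%E) -> Lpsi psi Om w.
Proof.
move=> Lh mw aew; have mh : lmeas_fun Om h by case: Lh.
apply: Lpsi_intro => //; apply: le_lt_trans (lorentz_tail_fin j Lh).
by apply: psinorm_le_lorentz => //; exact: mtail.
Qed.

Lemma Lpsi_series_tail h j : Lpsi psi Om h -> Lpsi psi Om (series_tail h j).
Proof.
move=> Lh; apply: (Lpsi_le_tail (j := j) Lh); first exact: lmeas_fun_series_tail.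
by apply: ae_onS (ae_summable Lh) => x _; exact: Vnorm_series_tail_le.
Qed.

Let iter_le_tail h i x : (iter i Q (mod h) x <= tail i (mod h) x)%E.
Proof.
rewrite -[leLHS](big_nat1 +%E i (fun j => iter j Q (mod h) x)).
by apply: nneseries_lim_ge => j _ _.
Qed.

Lemma Lpsi_iter_Pop i h : Lpsi psi Om h -> Lpsi psi Om (iter i P h).
Proof.
move=> Lh; have mh : lmeas_fun Om h by case: Lh.
apply: (Lpsi_le_tail (j := i) Lh); first exact: lmeas_fun_iter_Pop.
apply: ae_onS (Vnorm_iter_Pop_le h) => x _ normP.
exact: le_trans (normP i) (iter_le_tail h i x).
Qed.

Lemma series_tail_psinorm_cvg h j : Lpsi psi Om h ->
  (fun m => psinorm psi Om (fun x => \sum_(j <= i < m) iter i P h x - series_tail h j x))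
    @ \oo --> 0%E.
Proof.
move=> Lh; have mh : lmeas_fun Om h by case: Lh.
have hfin : psinorm psi Om h \is a fin_num.
  by rewrite ge0_fin_numE ?psinorm_ge0//; case: Lh => _ [_ []].
apply: (@squeeze_cvge _ _ _ _ (fun=> 0%E) _
  (fun m => (geometric (fine (psinorm psi Om h) / (1 - 2 * alpha)) (2 * alpha) m)%:E)).
- near=> m; have jm : (j <= m)%N by near: m; exact: nbhs_infty_ge.
  rewrite psinorm_ge0//=; apply: (@le_trans _ _ (lor (tail m (mod h)))).
    apply: psinorm_le_lorentz => //; first exact: mtail.
    apply: ae_onS (ae_summable Lh) => x _ sx; have [normP tailfin] := sx.
    rewrite /series_tail (tail_sum_split normP tailfin jm) opprD addrA subrr sub0r VnormN.
    exact: Vnorm_series_tail_le.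
  apply: le_trans (lorentz_tail_le m Lh) _.
  rewrite -[X in (_ * X)%E](fineK hfin) -EFinM lee_fin /=.
  by rewrite [leLHS]mulrC mulrCA mulrC lexx.
- exact: cvg_cst.
- apply: cvg_EFin; first exact: nearW.
  have a0 := alpha0; have a1 := ahalf; have double0 : 0 <= 2 * alpha by lra.
  by apply: cvg_geometric; rewrite ger0_norm//; lra.
Unshelve. all: by end_near. Qed.

Lemma Pop_partial_sum h m x : \sum_(0 <= i < m.+1) iter i P h x =
  P (fun y => \sum_(0 <= i < m) iter i P h y) x + h x.
Proof.
rewrite big_nat_recl//= addrC; congr (_ + _).
by rewrite exchange_big/=; apply: eq_bigr => n _; rewrite scaler_sumr.
Qed.

Lemma series_tail_solves h : Lpsi psi Om h -> solves Om g f h (series_tail h 0).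
Proof.
move=> Lh; have sh := ae_summable Lh.
have shf : ae_on Om (fun x => forall n, summable h (f n x)).
  by apply: ae_on_all => n; exact: (ae_on_comp (@fOm n) (@nullf n) sh).
apply: ae_onS (ae_onI sh shf) => x Ox [sx sfx].
have cv_tail : \sum_(0 <= i < m.+1) iter i P h x @[m --> \oo] --> series_tail h 0 x.
  by have := @series_tail_cvg h 0 x sx; rewrite -(cvg_shiftS _ (nbhs _)).
have cv_Pop : \sum_(0 <= i < m.+1) iter i P h x @[m --> \oo] -->
    P (series_tail h 0) x + h x.
  under eq_cvg do rewrite Pop_partial_sum.
  apply: cvgD; last exact: cvg_cst.
  rewrite /Pop; apply: (@cvg_big V _ +%R 0 _ (@add_continuous V)) => n _.
  by apply: cvgZl_tmp; exact: series_tail_cvg.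
exact: (cvg_unique (@norm_hausdorff _ V) cv_tail cv_Pop).
Qed.

Lemma solves_expand h u : solves Om g f h u ->
  ae_on Om (fun x => forall m, u x = \sum_(0 <= i < m) iter i P h x + iter m P u x).
Proof.
move=> su; apply: ae_on_all; elim => [|m IH].
  by apply: ae_onT => x _; rewrite big_geq// add0r.
have IHf : ae_on Om (fun x => forall n,
    u (f n x) = \sum_(0 <= i < m) iter i P h (f n x) + iter m P u (f n x)).
  by apply: ae_on_all => n; exact: (ae_on_comp (@fOm n) (@nullf n) IH).
apply: ae_onS (ae_onI su IHf) => x Ox [-> hf].
rewrite Pop_partial_sum addrAC; congr (_ + _); rewrite /= /Pop -big_split/=.
by apply: eq_bigr => n _; rewrite hf scalerDr.
Qed.

Lemma solution_unique h u : Lpsi psi Om h -> Lpsi psi Om u -> solves Om g f h u ->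
  ae_on Om (fun x => u x = series_tail h 0 x).
Proof.
move=> Lh Lu /solves_expand su.
apply: ae_onS (ae_onI su (ae_onI (ae_summable Lh) (ae_summable Lu))).
move=> x Ox [ux [sh [normPu tailfin]]].
have cv_u : \sum_(0 <= i < m) iter i P h x @[m --> \oo] --> u x.
  apply/Vnorm_cvgP => r r0.
  have tail0 : tail n (mod u) x @[n --> \oo] --> 0%E by exact: nneseries_tail_cvg.
  have [M _ tailM] := tail0 _ (nbhs_open_ereal_lt (f := fun=> r) r0).
  exists M => // m /= Mm; rewrite {1}(ux m) addrAC subrr add0r -lte_fin.
  apply: le_lt_trans (normPu m) _.
  exact: le_lt_trans (iter_le_tail u m x) (tailM m Mm).
exact: (cvg_unique (@norm_hausdorff _ V) cv_u (@series_tail_cvg h 0 x sh)).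
Qed.

Lemma series_tail_Lpsi j h : Lpsi psi Om h ->
  [/\ Lpsi psi Om (series_tail h j),
    (fun m => psinorm psi Om (fun x => \sum_(j <= i < m) iter i P h x - series_tail h j x))
      @ \oo --> 0%E
  & (psinorm psi Om (series_tail h j) <=
      ((2 * alpha) ^+ j / (1 - 2 * alpha))%:E * psinorm psi Om h)%E].
Proof.
by move=> Lh; split;
  [exact: Lpsi_series_tail|exact: series_tail_psinorm_cvg|exact: psinorm_series_tail_le].
Qed.

End elementary_solution.

Theorem theorem4p8 (R : realType) (k N : nat) (b : bool)
  (V : completeNormedModType (Kof R b))
  (Om : set 'rV[R]_k)
  (f : 'I_N -> 'rV[R]_k -> 'rV[R]_k) (g : 'I_N -> 'rV[R]_k -> Kof R b)
  (h0 : 'rV[R]_k -> V) (K L : nat) (psi : R -> R) (alpha : R) :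
  (0 < k)%N -> (0 < N)%N ->
  open Om ->
  separable_space V ->
  (forall n x, Om x -> Om (f n x)) ->
  hypH Om f g h0 K L ->
  good_psi psi ->
  Lpsi psi Om h0 ->
  0 <= alpha -> alpha < 1 / 2 ->
  (forall n, ae_on Om (fun x =>
      Knorm (g n x) <= alpha * Num.min (`|Jac Om (f n) x| / (K * L)%:R) (N%:R)^-1)) ->
  exists phi : 'rV[R]_k -> V,
    [/\ (* the elementary solution exists: every term lies in L^{psi,1}, the
           series converges in L^{psi,1} to phi, and phi is a solution *)
        (forall i, Lpsi psi Om (iter i (Pop g f) h0)),
        Lpsi psi Om phi /\
        (fun m => psinorm psi Om
            (fun x => \sum_(0 <= i < m) iter i (Pop g f) h0 x - phi x))
          @ \oo --> 0%E,
        solves Om g f h0 phi,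
        (* uniqueness in L^{psi,1} *)
        (forall phi' : 'rV[R]_k -> V, Lpsi psi Om phi' -> solves Om g f h0 phi' ->
            ae_on Om (fun x => phi' x = phi x))
      & (* tail estimate *)
        (forall j : nat, exists T : 'rV[R]_k -> V,
           [/\ Lpsi psi Om T,
               (fun m => psinorm psi Om
                   (fun x => \sum_(j <= i < m) iter i (Pop g f) h0 x - T x))
                 @ \oo --> 0%E
             & (psinorm psi Om T <=
                  ((2 * alpha) ^+ j / (1 - 2 * alpha))%:E * psinorm psi Om h0)%E])].
Proof.
case: k Om f g h0 => // k Om f g h0 _ N0 oOm /separable_dense_family[p dp] fOm.
move=> [mf [_ [luzin [nullf [_ [fK [mg [_ ->]]]]]]]] gpsi Lh alpha0 ahalf gbound.
have tails j := series_tail_Lpsi N0 oOm dp fOm mf luzin nullf fK mg gpsi alpha0 ahalf gbound j Lh.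
exists (series_tail f g h0 0); split.
- by move=> i; apply: (Lpsi_iter_Pop N0 oOm dp fOm mf luzin nullf fK mg gpsi alpha0 ahalf gbound).
- by have [] := tails 0%N.
- exact: (series_tail_solves N0 oOm fOm mf luzin nullf fK mg gpsi alpha0 ahalf gbound).
- by move=> u; apply: (solution_unique N0 oOm fOm mf luzin nullf fK mg gpsi alpha0 ahalf gbound).
- by move=> j; exists (series_tail f g h0 j).
Qed.
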